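(* Let $R$ be a standard graded $\mathsf{k}$-algebra over an infinite field $\mathsf{k}$, and let $M$ be a nonzero finitely generated graded $R$-module that is pure. Then $\operatorname{codim}(M)\leq\operatorname{pdim}_R(M)$. Moreover, if $\operatorname{pdim}_R(M)$ is finite, then $\operatorname{cmd}(R)\leq\operatorname{cmd}(M)$.
   Context: A standard graded $\mathsf{k}$-algebra is a graded ring $R=\bigoplus_{i\ge 0}R_i$ with $R_0=\mathsf{k}$, generated as a $\mathsf{k}$-algebra by finitely many elements of degree $1$. For a finitely generated graded module $M\neq 0$, $\operatorname{cmd}(M)=\dim(M)-\operatorname{depth}(M)$ (depth with respect to the homogeneous maximal ideal), $\operatorname{codim}(M)=\dim(R)-\dim(M)$, and $\operatorname{pdim}_R(M)\in\mathbb{N}\cup\{\infty\}$ is the projective dimension. With graded Betti numbers $\beta^R_{i,j}(M)=\dim_{\mathsf{k}}(\operatorname{Tor}^R_i(M,\mathsf{k})_j)$, the module $M$ is pure if for each $i$ there is at most one $j$ with $\beta^R_{i,j}(M)\neq 0$. *)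

(* Defs.v *)
From HB Require Import structures.
From mathcomp Require Import all_boot all_order all_algebra.
From mathcomp Require Import all_classical.
From mathcomp Require Import constructive_ereal.

Set Implicit Arguments.
Unset Strict Implicit.
Unset Printing Implicit Defensive.

Import Order.TTheory GRing.Theory Num.Theory.
Local Open Scope classical_set_scope.
Local Open Scope ring_scope.

(* Suprema and infima in Z with -oo and +oo adjoined. *)
Definition esup (A : set nat) : \bar int := supremum -oo%E [set n%:Z%:E | n in A].
Definition einf (A : set nat) : \bar int := infimum +oo%E [set n%:Z%:E | n in A].

Section Gradings.

Definition additive_subgroup (V : zmodType) (A : set V) : Prop :=
  A 0 /\ forall x y, A x -> A y -> A (x - y).

(* V is the internal direct sum of the subgroups A i. *)
Definition direct_sum_decomposition (I : choiceType) (V : zmodType)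
    (A : I -> set V) : Prop :=
  [/\ forall i, additive_subgroup (A i),
      forall x, exists f : I -> V,
        [/\ forall i, A i (f i), finite_set [set i | f i <> 0]
          & x = \sum_(i \in [set: I]) f i]
    & forall f : I -> V, (forall i, A i (f i)) ->
        finite_set [set i | f i <> 0] ->
        \sum_(i \in [set: I]) f i = 0 -> forall i, f i = 0].

(* The condition that R 0 is the image of k and the multiplicativity of the
   grading make every R i a k-subspace. *)
Definition standard_graded (k : fieldType) (R : comAlgType k)
    (Rg : nat -> set R) : Prop :=
  [/\ direct_sum_decomposition Rg,
      forall i j a b, Rg i a -> Rg j b -> Rg (i + j)%N (a * b),
      Rg 0%N = range (fun c : k => c%:A)
    & exists s : seq R, (forall x, x \in s -> Rg 1%N x) /\
        forall S : {pred R}, GRing.subalg_closed S -> {subset s <= S} ->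
          forall r, r \in S].

Definition graded_module (k : fieldType) (R : comAlgType k)
    (Rg : nat -> set R) (M : lmodType R) (Mg : int -> set M) : Prop :=
  direct_sum_decomposition Mg /\
  forall i j a x, Rg i a -> Mg j x -> Mg (i%:Z + j) (a *: x).

End Gradings.

Section Modules.
Variable R : comNzRingType.

Definition finitely_generated (M : lmodType R) : Prop :=
  exists s : seq M, forall x, exists c : 'I_(size s) -> R,
    x = \sum_i c i *: s`_i.

(* The additive subgroup generated by A when A is closed under opposites. *)
Definition finite_sums (V : zmodType) (A : set V) : set V :=
  [set x | exists s : seq V,
     (forall y, y \in s -> A y) /\ x = \sum_(y <- s) y].

(* The submodule I M, for I an arbitrary set of ring elements. *)
Definition set_scale (M : lmodType R) (I : set R) : set M :=
  finite_sums [set a *: y | a in I & y in [set: M]].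

Definition prime_ideal (P : {pred R}) : Prop :=
  idealr_closed P /\ prime_idealr_closed P.

Definition annihilator (M : lmodType R) : set R :=
  [set a | forall x : M, a *: x = 0].

(* Strict chains P 0 < ... < P n of primes containing Ann M; these primes form
   the support of M when M is finitely generated. *)
Definition prime_chain (M : lmodType R) (n : nat) (P : nat -> {pred R}) : Prop :=
  (forall i, (i <= n)%N ->
     prime_ideal (P i) /\ annihilator M `<=` [set a | a \in P i]) /\
  (forall i, (i < n)%N ->
     {subset P i <= P i.+1} /\ ~ {subset P i.+1 <= P i}).

Definition krull_dim (M : lmodType R) : \bar int :=
  esup [set n | exists P, prime_chain M n P].

Definition regular_sequence (M : lmodType R) (s : seq R) : Prop :=
  (forall i, (i < size s)%N -> forall y : M,
     set_scale [set` take i s] (s`_i *: y) -> set_scale [set` take i s] y) /\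
  set_scale (M := M) [set` s] != [set: M].

(* Supremum of the lengths of M-regular sequences in I. *)
Definition depth (I : set R) (M : lmodType R) : \bar int :=
  esup [set n | exists s : seq R,
    [/\ size s = n, forall x, x \in s -> I x & regular_sequence M s]].

Definition projective (P : lmodType R) : Prop :=
  forall (A B : lmodType R) (f : {linear A -> B}) (g : {linear P -> B}),
    (forall b, exists a, f a = b) ->
    exists h : {linear P -> A}, forall x, f (h x) = g x.

Record projective_resolution (M : lmodType R) := ProjectiveResolution {
  res_module :> nat -> lmodType R;
  res_diff : forall i, {linear res_module i.+1 -> res_module i};
  res_aug : {linear res_module 0%N -> M};
  res_projective : forall i, projective (res_module i);
  res_aug_surj : forall m, exists x, res_aug x = m;
  res_exact0 : forall x, res_aug x = 0 <-> exists y, res_diff 0%N y = x;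
  res_exact : forall i x,
    res_diff i x = 0 <-> exists y, res_diff i.+1 y = x }.

Definition pdim (M : lmodType R) : \bar int :=
  einf [set n | exists F : projective_resolution M,
    forall i, (n < i)%N -> forall x : F i, x = 0].

Definition codim (M : lmodType R) : \bar int :=
  (krull_dim R^o - krull_dim M)%E.

End Modules.

Section Graded.
Variables (k : fieldType) (R : comAlgType k) (Rg : nat -> set R).

(* The homogeneous maximal ideal, i.e., the sum of the R i with i > 0. *)
Definition irrelevant_ideal : set R :=
  finite_sums [set a | exists2 i, (0 < i)%N & Rg i a].

Definition cmd (M : lmodType R) : \bar int :=
  (krull_dim M - depth irrelevant_ideal M)%E.

(* B being a subspace of Z, there are b elements of Z that form a k-basis of
   Z / B; k acts through the structure map of R. *)
Definition quotient_dim (V : lmodType R) (Z B : set V) (b : nat) : Prop :=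
  exists e : 'I_b -> V, (forall s, Z (e s)) /\
    forall z, Z z ->
      exists! c : 'rV[k]_b, B (z - \sum_s ((c 0 s)%:A : R) *: e s).

Record graded_resolution (M : lmodType R) (Mg : int -> set M) :=
  GradedResolution {
  gres_res :> projective_resolution M;
  gres_grading : forall i, int -> set (gres_res i);
  gres_graded : forall i, graded_module Rg (@gres_grading i);
  gres_aug_deg : forall j x, gres_grading (i := 0%N) j x ->
    Mg j (res_aug gres_res x);
  gres_diff_deg : forall i j x, gres_grading (i := i.+1) j x ->
    gres_grading (i := i) j (res_diff gres_res i x) }.

Section Tor.
Variables (M : lmodType R) (Mg : int -> set M) (F : graded_resolution Mg).

(* With m the homogeneous maximal ideal, F (x)_R k is the complex F / m F, and
   Tor_i(M, k)_j is its homology in homological degree i and internal degree j,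
   that is, tor_cycles i j / tor_boundaries i j, where both groups are pulled
   back to the degree j part of F i. *)
Definition tor_cycles (i : nat) (j : int) : set (F i) :=
  match i return set (F i) with
  | 0 => gres_grading (g := F) (i := 0%N) j
  | i'.+1 => gres_grading (g := F) (i := i'.+1) j `&`
             [set x | set_scale irrelevant_ideal (res_diff F i' x)]
  end.

Definition tor_boundaries (i : nat) (j : int) : set (F i) :=
  gres_grading (g := F) (i := i) j `&`
  [set x | exists y : F i.+1, set_scale irrelevant_ideal (x - res_diff F i y)].

End Tor.

Arguments tor_cycles [M Mg] F i j _.
Arguments tor_boundaries [M Mg] F i j _.

(* dim_k Tor_i(M, k)_j, computed from some graded projective resolution of M;
   for finitely generated M over a standard graded algebra it is a natural
   number that does not depend on the resolution. *)
Definition betti (M : lmodType R) (Mg : int -> set M) (i : nat) (j : int) : nat :=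
  xget 0%N [set b | exists F : graded_resolution Mg,
    quotient_dim (tor_cycles F i j) (tor_boundaries F i j) b].

Definition pure_module (M : lmodType R) (Mg : int -> set M) : Prop :=
  forall i j j', betti Mg i j != 0%N -> betti Mg i j' != 0%N -> j = j'.

End Graded.

(* Main.v *)
(** Herzog and Kuehl's argument. Let F be the minimal graded free resolution of
    M, of length L. By purity all generators of F_i have the same degree d_i, and
    minimality makes the d_i strictly increasing, so the Hilbert series of M is
    that of R times P(t) = sum_i (-1)^i b_i t^(d_i). A polynomial with L + 1
    terms vanishes at 1 to order at most L (characteristic 0), while the Hilbert
    functions of R and M grow with exponents dim R and dim M; hence
    codim M <= L, and L <= pdim M by comparison with an arbitrary projective
    resolution. For the second claim, the Auslander-Buchsbaum inequality
    depth M + L <= depth R follows by chasing Ext(R / m, -) through F. *)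

From HB Require Import structures.
From mathcomp Require Import all_boot all_order all_algebra.
From mathcomp Require Import all_classical.
From mathcomp Require Import constructive_ereal.
From mathcomp Require Import ring zify.
Require Import Defs.

Set Implicit Arguments.
Unset Strict Implicit.
Unset Printing Implicit Defensive.

Import Order.TTheory GRing.Theory Num.Theory.
Local Open Scope classical_set_scope.
Local Open Scope ring_scope.

(** * Dimension of subspaces *)

(** Krull dimension is defined by chains of arbitrary primes, so it has to be tied to growth in both
    directions. A chain of length n makes the dimension of the elements of degree at most j grow at
    least like j^n, by multiplying with elements taken from the successive primes. Conversely, a
    homogeneous ideal I for which R / I is not O(j^s) lies below a chain of length s + 1: an ideal
    maximal with such growth is prime, and adding a linear form costs at most one exponent. Purity
    also puts the generators of M in one degree, so M is bounded degree by degree by a power of R /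
    Ann M.

    [betti] takes its value from some unspecified graded resolution. Purity therefore says something
    about F only after a generator of F is carried to that resolution and back, which changes
    nothing modulo the maximal ideal.

    The field being infinite enters once: vanishing of Ext^i(R / m, R) for i < n + L becomes a
    regular sequence of linear forms, each chosen outside finitely many proper subspaces of R_1. *)

Definition mklin (R : nzRingType) (U V : lmodType R) (f : U -> V)
    (lf : linear f) : {linear U -> V} :=
  HB.pack f (GRing.isLinear.Build R U V _ f lf).

Section Dimension.
Variables (k : fieldType) (R : comAlgType k).
Implicit Types V W : lmodType R.

(** Modules carry only their R-structure; k acts through the scalars [c%:A] of R. *)
Definition ksub V (A : set V) : Prop :=
  A 0 /\ forall (c : k) x y, A x -> A y -> A ((c%:A : R) *: x + y).

Definition kadj V (A : set V) (x : V) : set V :=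
  [set y | exists c : k, A (y - (c%:A : R) *: x)].

Lemma ksub0 V (A : set V) : ksub A -> A 0.
Proof. by case. Qed.

Lemma ksubZ V (A : set V) (c : k) x : ksub A -> A x -> A ((c%:A : R) *: x).
Proof. by case=> A0 AD Ax; rewrite -[_ *: x]addr0; exact: AD. Qed.

Lemma ksubD V (A : set V) x y : ksub A -> A x -> A y -> A (x + y).
Proof.
by case=> A0 AD Ax Ay; rewrite -[x](scale1r x) -[1](scale1r 1); exact: AD.
Qed.

Lemma ksubN V (A : set V) x : ksub A -> A x -> A (- x).
Proof.
by move=> kA Ax; rewrite -scaleN1r -[1](scale1r 1) -scaleNr; exact: ksubZ.
Qed.

Lemma ksubB V (A : set V) x y : ksub A -> A x -> A y -> A (x - y).
Proof. by move=> kA Ax Ay; apply: ksubD => //; exact: ksubN. Qed.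

Lemma ksub_inv V (A : set V) (c : k) x :
  ksub A -> A ((c%:A : R) *: x) -> c != 0 -> A x.
Proof.
move=> kA /(ksubZ c^-1 kA); rewrite scalerA -scalerAl mul1r scalerA => + c0.
by rewrite mulVf // !scale1r.
Qed.

Lemma scaleAB (V : lmodType R) (c d : k) (x : V) :
  (c%:A : R) *: ((d%:A : R) *: x) = ((c * d)%:A : R) *: x.
Proof. by rewrite scalerA -scalerAl mul1r scalerA. Qed.

Lemma ksub_adj V (A : set V) x : ksub A -> ksub (kadj A x).
Proof.
move=> kA; split; first by exists 0; rewrite // scale0r scale0r subr0; exact: ksub0.
move=> c y z [d Ay] [e Az]; exists (c * d + e) => //.
rewrite scalerDl scalerDl opprD addrACA -scaleAB -scalerBr.
by apply: ksubD => //; exact: ksubZ.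
Qed.

Lemma kadj_sub V (A : set V) x : A `<=` kadj A x.
Proof. by move=> y Ay; exists 0; rewrite // scale0r scale0r subr0. Qed.

Lemma kadj_mem V (A : set V) x : A 0 -> kadj A x x.
Proof. by exists 1; rewrite // scale1r scale1r subrr. Qed.

Lemma kadj_le V (A B : set V) x : ksub B -> A `<=` B -> B x -> kadj A x `<=` B.
Proof.
move=> kB AB Bx y [c Ay]; rewrite -(subrK ((c%:A : R) *: x) y).
by apply: ksubD => //; [exact: AB|exact: ksubZ].
Qed.

(* dim_k A = n, witnessed by a flag rather than by a basis, so that the dimension
   formula fdim_sum is an induction on the flag of A. *)
Inductive fdim V : set V -> nat -> Prop :=
| fdim0 : fdim [set 0] 0
| fdimS A n x : fdim A n -> ~ A x -> fdim (kadj A x) n.+1.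

Lemma ksub_zero V : ksub [set 0 : V].
Proof. by split=> // c x y -> ->; rewrite scaler0 addr0. Qed.

Lemma fdim_ksub V (A : set V) n : fdim A n -> ksub A.
Proof. by elim=> [|B m x _ kB _]; [exact: ksub_zero|exact: ksub_adj]. Qed.

(** This is f(A) + B: the image of A for B = 0, and an ordinary sum for f the identity, so one
    dimension formula serves both. *)
Definition ksum V W (f : V -> W) (A : set V) (B : set W) : set W :=
  [set y | exists2 x, A x & B (y - f x)].

(** When x is added to A, either f x already lies in f(A) + B, say f x = f z + b, and then the
    preimage part gains x - z while the sum is unchanged; or f x is new and the sum grows while the
    preimage part is unchanged. *)
Lemma fdim_sum V W (f : {linear V -> W}) A B a b :
  fdim A a -> fdim B b ->
  exists r, [/\ (r <= a)%N, fdim (A `&` f @^-1` B) r &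
                fdim (ksum f A B) (a - r + b)].
Proof.
have fZ c t : f (c *: t) = c *: f t by rewrite linearZ.
move=> + dB; have kB := fdim_ksub dB; elim=> [|{}A {}a x dA].
  exists 0%N; split=> //.
    suff -> : [set 0] `&` f @^-1` B = [set 0] by exact: fdim0.
    apply/seteqP; split=> y /=; first by case.
    by move=> ->; split=> //; rewrite linear0; exact: ksub0.
  rewrite subn0 add0n; suff -> : ksum f [set 0] B = B by [].
  apply/seteqP; split=> y /=; first by case=> z ->; rewrite linear0 subr0.
  by move=> By; exists 0 => //; rewrite linear0 subr0.
move=> [r [ra dI dS]] nAx.
have kA := fdim_ksub dA; have kS := fdim_ksub dS; have kI := fdim_ksub dI.
have kAx := ksub_adj x kA.
case: (pselect (ksum f A B (f x))) => [[z Az Bxz]|nS].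
  exists r.+1; split=> //.
    suff -> : kadj A x `&` f @^-1` B = kadj (A `&` f @^-1` B) (x - z).
      apply: fdimS => // -[Axz _]; apply: nAx.
      by rewrite -(subrK z x); apply: ksubD.
    apply/seteqP; split=> y /=.
      case=> -[c Ay] By; exists c => //; split.
        by rewrite scalerBr opprB addrA addrAC; apply: ksubD => //; exact: ksubZ.
      rewrite /= linearB; apply: ksubB => //.
      by rewrite fZ; apply: ksubZ => //; rewrite linearB.
    case=> c [Ay By]; split.
      exists c => //; move: Ay; rewrite scalerBr opprB addrA => Ay.
      rewrite -(addrK ((c%:A : R) *: z) (y - _)); apply: ksubB => //.
        by rewrite addrAC.
      exact: ksubZ.
    rewrite -(subrK ((c%:A : R) *: (x - z)) y) linearD; apply: ksubD => //.
    by rewrite fZ; apply: ksubZ => //; rewrite linearB.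
  rewrite subSS; suff -> : ksum f (kadj A x) B = ksum f A B by [].
  apply/seteqP; split=> y /=; last first.
    by case=> t At By; exists t => //; exact: kadj_sub.
  case=> t [c At] By; exists (t - (c%:A : R) *: x + (c%:A : R) *: z).
    by apply: ksubD => //; exact: ksubZ.
  have -> : y - f (t - (c%:A : R) *: x + (c%:A : R) *: z) =
            (y - f t) + (c%:A : R) *: (f x - f z).
    by rewrite linearD linearB !fZ scalerBr opprD opprB !addrA (addrAC y).
  by apply: ksubD => //; exact: ksubZ.
exists r; split; first exact: leqW.
  suff -> : kadj A x `&` f @^-1` B = A `&` f @^-1` B by [].
  apply/seteqP; split=> y /= -[]; last by move=> Ay By; split=> //; exact: kadj_sub.
  case=> c Ay By; split=> //.
  case: (eqVneq c 0) => [c0|c0].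
    by move: Ay; rewrite c0 scale0r scale0r subr0.
  exfalso; apply: nS; apply: (ksub_inv kS _ c0).
  exists (- (y - (c%:A : R) *: x)); first exact: ksubN.
  by rewrite linearN opprK linearB fZ addrC subrK.
rewrite subSn // addSn; suff -> : ksum f (kadj A x) B = kadj (ksum f A B) (f x).
  exact: fdimS.
apply/seteqP; split=> y /=.
  case=> t [c At] By; exists c => //; exists (t - (c%:A : R) *: x) => //.
  by rewrite linearB fZ opprB addrA subrK.
case=> c [t At By]; exists (t + (c%:A : R) *: x).
  by exists c => //; rewrite addrK.
by rewrite linearD fZ opprD addrA addrAC.
Qed.

(** A subspace of B + k x meets B in codimension at most one. This lets [fdim_leq] induct on the
    flag of the larger space. *)
Lemma fdim_hyperplane V (A B : set V) x n :
  ksub B -> fdim A n -> A `<=` kadj B x ->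
  A `<=` B \/ exists r, n = r.+1 /\ fdim (A `&` B) r.
Proof.
move=> kB; elim=> [|{}A {}n y dA IH nAy] AB.
  by left=> z ->; exact: ksub0.
have kA := fdim_ksub dA.
have {}IH := IH (subset_trans (@kadj_sub _ A y) AB).
have Bxy : kadj B x y by apply: AB; apply: kadj_mem; exact: ksub0.
case: (pselect (A `<=` B)) => [sAB|nAB].
  case: (pselect (B y)) => [By|nBy]; [left; exact: kadj_le|right].
  exists n; split=> //; suff -> : kadj A y `&` B = A by [].
  apply/seteqP; split=> z /=; last by move=> Az; split; [exact: kadj_sub|exact: sAB].
  case=> -[c Az] Bz; case: (eqVneq c 0) => [c0|c0].
    by move: Az; rewrite c0 scale0r scale0r subr0.
  exfalso; apply: nBy; apply: (ksub_inv kB _ c0).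
  by rewrite -[_ *: y](subKr z); apply: ksubB => //; exact: sAB.
right; case: IH => // -[r [-> dAB]]; exists r.+1; split=> //.
have [z [Az nBz]] : exists z, A z /\ ~ B z.
  by apply: contra_notP nAB => H z Az; apply: contra_notP H => nBz; exists z.
have [c Bz] := AB _ (@kadj_sub _ A y z Az).
have [d By] := Bxy.
have c0 : c != 0.
  by apply: contra_notN nBz => /eqP c0; move: Bz; rewrite c0 scale0r scale0r subr0.
(* Both y and z lie in A and B + k x; the multiple of z cancels the x-part of y, so that [y'] spans
   the new direction inside B. *)
pose y' := y - ((d / c)%:A : R) *: z.
have By' : B y'.
  have -> : y' = (y - (d%:A : R) *: x) - ((d / c)%:A : R) *: (z - (c%:A : R) *: x).
    by rewrite scalerBr scaleAB divfK // opprB addrA subrK.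
  by apply: ksubB => //; exact: ksubZ.
have -> : kadj A y `&` B = kadj (A `&` B) y'.
  apply/seteqP; split=> t /=.
    case=> -[e At] Bt; exists e => //; split.
      rewrite /y' scalerBr opprB addrA addrAC; apply: ksubD => //.
      by apply: ksubZ => //; exact: ksubZ.
    by apply: ksubB => //; exact: ksubZ.
  case=> e [At Bt]; split.
    exists e => //; move: At; rewrite /y' scalerBr opprB addrA => At.
    rewrite -(addrK ((e%:A : R) *: (((d / c)%:A : R) *: z)) (t - _)).
    by apply: ksubB => //; [rewrite addrAC|apply: ksubZ => //; exact: ksubZ].
  by rewrite -(subrK ((e%:A : R) *: y') t); apply: ksubD => //; exact: ksubZ.
apply: fdimS => // -[Ay' _]; apply: nAy.
by rewrite -(subrK (((d / c)%:A : R) *: z) y); apply: ksubD => //; exact: ksubZ.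
Qed.

Lemma fdim_leq V (A B : set V) n m :
  fdim A n -> fdim B m -> A `<=` B -> (n <= m)%N.
Proof.
move=> dA dB; elim: dB A n dA => [|{}B {}m x dB IH nBx] A n dA AB.
  case: dA AB => // {}A {}n x dA nAx AB; have A0 := ksub0 (fdim_ksub dA).
  by case: nAx; rewrite (AB x (kadj_mem x A0)).
have [AB'|[r [-> dr]]] := fdim_hyperplane (fdim_ksub dB) dA AB.
  by apply: leqW; exact: IH dA AB'.
by rewrite ltnS; apply: IH dr _ => y [].
Qed.

Lemma fdim_uniq V (A : set V) n m : fdim A n -> fdim A m -> n = m.
Proof.
by move=> dn dm; apply/eqP; rewrite eqn_leq (fdim_leq dn dm) // (fdim_leq dm dn).
Qed.

Definition fd V (A : set V) : Prop := exists n, fdim A n.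

(** The value is meaningful under [fd]; infinite-dimensional subspaces may get the default 0. *)
Definition kdim V (A : set V) : nat := xget 0%N [set n | fdim A n].

Lemma kdimP V (A : set V) : fd A -> fdim A (kdim A).
Proof. by case=> n dA; exact: (xgetI _ dA). Qed.

Lemma kdim_eq V (A : set V) n : fdim A n -> kdim A = n.
Proof. by move=> dA; apply: fdim_uniq (dA); apply: kdimP; exists n. Qed.

Lemma fd_ksub V (A : set V) : fd A -> ksub A.
Proof. by case=> n; exact: fdim_ksub. Qed.

Lemma fd_subset V (A B : set V) : ksub A -> fd B -> A `<=` B -> fd A.
Proof.
move=> + [m dB]; elim: dB A => [|{}B {}m x dB IH nBx] A kA AB.
  exists 0%N; suff -> : A = [set 0] by exact: fdim0.
  by apply/seteqP; split=> // y ->; exact: ksub0.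
have kB := fdim_ksub dB.
have kAB : ksub (A `&` B).
  split; first by split; exact: ksub0.
  by case: kA kB => _ hA [_ hB] c y z [Ay By] [Az Bz]; split; [exact: hA|exact: hB].
have [r dr] : fd (A `&` B) by apply: IH => // y [].
case: (pselect (A `<=` B)) => [sAB|nAB].
  by exists r; rewrite (_ : A = A `&` B) //; apply/esym/setIidPl.
have [z [Az nBz]] : exists z, A z /\ ~ B z.
  by apply: contra_notP nAB => H z Az; apply: contra_notP H => nBz; exists z.
exists r.+1; suff -> : A = kadj (A `&` B) z by apply: fdimS => // -[].
apply/seteqP; split; last first.
  by apply: kadj_le => // y [].
move=> y Ay; have [c Bz] := AB _ Az.
have c0 : c != 0.
  by apply: contra_notN nBz => /eqP c0; move: Bz; rewrite c0 scale0r scale0r subr0.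
have [d By] := AB _ Ay.
exists (d / c) => //; split; first by apply: ksubB => //; exact: ksubZ.
have -> : y - ((d / c)%:A : R) *: z =
          (y - (d%:A : R) *: x) - ((d / c)%:A : R) *: (z - (c%:A : R) *: x).
  by rewrite scalerBr scaleAB divfK // opprB addrA subrK.
by apply: ksubB => //; exact: ksubZ.
Qed.

Lemma kdim_leq V (A B : set V) : ksub A -> fd B -> A `<=` B -> (kdim A <= kdim B)%N.
Proof.
by move=> kA fB AB; exact: (fdim_leq (kdimP (fd_subset kA fB AB)) (kdimP fB) AB).
Qed.

Lemma fd_sum V W (f : {linear V -> W}) A B : fd A -> fd B -> fd (ksum f A B).
Proof. by move=> [a dA] [b dB]; have [r [_ _ ?]] := fdim_sum f dA dB; eexists; eauto. Qed.

Lemma kdim_sum V W (f : {linear V -> W}) A B : fd A -> fd B ->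
  (kdim (ksum f A B) + kdim (A `&` f @^-1` B) = kdim A + kdim B)%N.
Proof.
move=> [a dA] [b dB]; have [r [ra d1 d2]] := fdim_sum f dA dB.
by rewrite (kdim_eq d1) (kdim_eq d2) (kdim_eq dA) (kdim_eq dB) addnAC subnK.
Qed.

Lemma fd0 V : fd [set 0 : V].
Proof. by exists 0%N; exact: fdim0. Qed.

Lemma kdim0 V : kdim [set 0 : V] = 0%N.
Proof. exact/kdim_eq/fdim0. Qed.

Lemma ksum_image V W (f : {linear V -> W}) A : ksum f A [set 0] = f @` A.
Proof.
apply/seteqP; split=> y /=; first by case=> x Ax /eqP; rewrite subr_eq0 => /eqP ->; exists x.
by case=> x Ax <-; exists x => //; rewrite subrr.
Qed.

Lemma kdim_image V W (f : {linear V -> W}) A : fd A ->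
  (kdim (f @` A) + kdim (A `&` f @^-1` [set 0%R]) = kdim A)%N.
Proof. by move=> fA; rewrite -ksum_image kdim_sum ?kdim0 ?addn0//; exact: fd0. Qed.

Definition rcoord n (s : 'I_n) (x : 'rV[R]_n) : (R^o : lmodType R) := x 0 s.

Lemma rcoord_is_linear n (s : 'I_n) : linear (rcoord s).
Proof. by move=> a x y; rewrite /rcoord !mxE. Qed.

HB.instance Definition _ n (s : 'I_n) :=
  GRing.isLinear.Build R 'rV[R]_n (R^o : lmodType R) _ (rcoord s)
    (rcoord_is_linear s).

Lemma fdim_rV n (A : 'I_n -> set (R^o : lmodType R)) : (forall s, fd (A s)) ->
  fdim [set x : 'rV[R]_n | forall s, A s (x 0 s)] (\sum_s kdim (A s)).
Proof.
move=> fA; have kA s := fd_ksub (fA s).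
(* Vectors supported on the first m coordinates: passing from T m to T m.+1 adds the dimension of
   one coordinate space, with T m as the kernel of that coordinate. *)
pose T m := [set x : 'rV[R]_n |
  forall s : 'I_n, if (s < m)%N then A s (x 0 s) else x 0 s = 0].
have kT m : ksub (T m).
  split=> [s|c x y Tx Ty s].
    by rewrite mxE; case: ifP => _ //; exact: (ksub0 (kA _)).
  rewrite !mxE; move: (Tx s) (Ty s); case: ifP => _ => [|-> ->].
    by case: (kA s) => _; apply.
  by rewrite mulr0 addr0.
suff H m : (m <= n)%N -> fdim (T m) (\sum_(s < n | (s < m)%N) kdim (A s)).
  have := H n (leqnn n).
  rewrite [X in fdim _ X -> _](eq_bigl xpredT); last by move=> s; rewrite ltn_ord.
  suff -> : T n = [set x : 'rV[R]_n | forall s, A s (x 0 s)] by [].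
  by apply/seteqP; split=> x Tx s; have := Tx s; rewrite ltn_ord.
elim: m => [_|m IH mn].
  rewrite big_pred0 //; suff -> : T 0%N = [set 0] by exact: fdim0.
  apply/seteqP; split=> x; first by move=> Tx; apply/rowP => s; rewrite mxE; exact: Tx.
  by move=> -> s; rewrite mxE.
have {}IH := IH (ltnW mn); pose s0 := Ordinal mn.
have lem (s : 'I_n) : (s < m.+1)%N = (s == m :> nat) || (s < m)%N.
  by rewrite ltnS leq_eqVlt.
have Tker : T m.+1 `&` rcoord s0 @^-1` [set 0] = T m.
  apply/seteqP; split=> x.
    case=> Tx x0 s; move: (Tx s); rewrite lem.
    by case: eqP => [e _|_ //]; rewrite e ltnn; have -> : s = s0 by exact: val_inj.
  move=> Tx; split.
    move=> s; move: (Tx s); rewrite lem.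
    case: eqP => [e|_ //]; rewrite e ltnn /= => ->; exact: (ksub0 (kA _)).
  by have := Tx s0; rewrite ltnn.
have im : rcoord s0 @` T m.+1 = A s0.
  apply/seteqP; split=> y.
    by case=> x Tx <-; have := Tx s0; rewrite ltnSn.
  move=> Ay; exists (\row_s if s == s0 then y else 0); last by rewrite /rcoord mxE eqxx.
  move=> s; rewrite mxE; case: eqP => [->|_]; first by rewrite ltnSn.
  by case: ifP => // _; exact: (ksub0 (kA _)).
have fT : fd (T m.+1).
  have Tsub : T m.+1 `<=`
      ksum (V := R^o : lmodType R) (fun y : R^o => \row_s if s == s0 then y else 0)
           (A s0) (T m).
    move=> x Tx; exists (x 0 s0); first by have := Tx s0; rewrite ltnSn.
    move=> s; rewrite !mxE; have := Tx s; rewrite lem.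
    case: (eqVneq s s0) => [->|ne]; first by rewrite eqxx ltnn subrr.
    by rewrite (negbTE (ne : (s : nat) != m)) subr0.
  apply: fd_subset Tsub => //.
  have lf : linear (fun y : (R^o : lmodType R) => \row_(s < n) if s == s0 then (y : R) else 0).
    by move=> a x y; apply/rowP => s; rewrite !mxE; case: eqP; rewrite ?mulr0 ?addr0.
  by apply: (@fd_sum _ _ (mklin lf)) => //; eexists; exact: IH.
have := kdim_image (rcoord s0) fT; rewrite Tker im (kdim_eq IH) => e.
rewrite (bigD1 s0) //= ?ltnSn // (eq_bigl (fun s : 'I_n => (s < m)%N)).
  by rewrite e; exact: kdimP.
move=> s; rewrite ltnS -val_eqE /=; by case: ltngtP.
Qed.

End Dimension.

(** * Homogeneous components *)

Section Components.
Variables (I : choiceType) (V : zmodType).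
Implicit Types (A : I -> set V) (x y : V).

(** An explicit duplicate-free list carrying the support, so that sums are over sequences instead of
    finite sets. *)
Definition decomposes A x (f : I -> V) (s : seq I) : Prop :=
  [/\ forall i, A i (f i), uniq s, forall i, i \notin s -> f i = 0
    & x = \sum_(i <- s) f i].

Lemma fsbig_supp_seq (f : I -> V) (s : seq I) :
  uniq s -> (forall i, i \notin s -> f i = 0) ->
  \sum_(i \in [set: I]) f i = \sum_(i <- s) f i.
Proof.
move=> us fs; rewrite (fsbigE s) //; last by move=> i _; exact: fs.
by apply: eq_bigl => i; rewrite in_setT.
Qed.

Lemma dsd_intro A : (forall i, additive_subgroup (A i)) ->
  (forall x, exists f s, decomposes A x f s) ->
  (forall f s, decomposes A 0 f s -> forall i, f i = 0) ->
  direct_sum_decomposition A.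
Proof.
move=> hA ex un; split=> // [x|f Af /finite_seqP[s fs] sum0].
  have [f [s [Af us f0 ->]]] := ex x; exists f; split=> //.
    apply: (sub_finite_set _ (finite_seq s)) => i /= fi.
    by apply: contra_notT fi; exact: f0.
  by rewrite (fsbig_supp_seq us).
have f0 i : i \notin undup s -> f i = 0.
  rewrite mem_undup; apply: contraNeq => /eqP fi.
  suff : [set` s] i by []; by rewrite -fs.
apply: (un f (undup s)); split=> //; first exact: undup_uniq.
by rewrite -(fsbig_supp_seq (undup_uniq s)).
Qed.

(** Homogeneous components, by choice; for a direct sum decomposition [cmp_dec] and [cmpE] give
    existence and uniqueness. *)
Definition cmp A x : I -> V :=
  xget (fun=> 0) [set f | exists s, decomposes A x f s].

Variable A : I -> set V.
Hypothesis dA : direct_sum_decomposition A.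

Lemma dsd_add0 i : A i 0. Proof. by case: dA => /(_ i)[]. Qed.

Lemma dsd_addB i x y : A i x -> A i y -> A i (x - y).
Proof. by case: dA => /(_ i)[_ h] _ _; exact: h. Qed.

Lemma dsd_addN i x : A i x -> A i (- x).
Proof. by rewrite -sub0r; apply: dsd_addB; exact: dsd_add0. Qed.

Lemma dsd_addD i x y : A i x -> A i y -> A i (x + y).
Proof. by move=> Ax Ay; rewrite -[y]opprK; apply: dsd_addB => //; exact: dsd_addN. Qed.

Lemma dsd_ex x : exists f s, decomposes A x f s.
Proof.
case: dA => _ /(_ x)[f [Af /finite_seqP[s fs] ->]] _; exists f, (undup s).
have f0 i : i \notin undup s -> f i = 0.
  rewrite mem_undup; apply: contraNeq => /eqP fi.
  suff : [set` s] i by []; by rewrite -fs.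
by split=> //; [exact: undup_uniq|apply: fsbig_supp_seq => //; exact: undup_uniq].
Qed.

Lemma dsd_zero f s : decomposes A 0 f s -> forall i, f i = 0.
Proof.
case=> Af us f0 sum0; case: dA => _ _; apply => //.
  apply: (sub_finite_set _ (finite_seq s)) => i /= fi.
  by apply: contra_notT fi; exact: f0.
by rewrite (fsbig_supp_seq us).
Qed.

Lemma decomposes_widen x f s t : decomposes A x f s -> uniq t ->
  {subset s <= t} -> decomposes A x f t.
Proof.
case=> Af us f0 -> ut st; split=> // [i|]; first by move=> /(contra (st i)); exact: f0.
by rewrite -!fsbig_supp_seq // => i /(contra (st i)); exact: f0.
Qed.

Lemma decomposes_sub x y f g s t : decomposes A x f s -> decomposes A y g t ->
  decomposes A (x - y) (fun i => f i - g i) (undup (s ++ t)).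
Proof.
move=> df dg; have us := undup_uniq (s ++ t).
have [|Af _ f0 ->] := decomposes_widen df us.
  by move=> i si; rewrite mem_undup mem_cat si.
have [|Ag _ g0 ->] := decomposes_widen dg us.
  by move=> i si; rewrite mem_undup mem_cat si orbT.
split=> // [i|i si|]; first exact: dsd_addB.
  by rewrite f0 // g0 // subrr.
by rewrite sumrB.
Qed.

Lemma cmp_dec x : exists s, decomposes A x (cmp A x) s.
Proof.
have [f [s d]] := dsd_ex x.
exact: (@xgetI _ (fun=> 0) [set f | exists s, decomposes A x f s] f (ex_intro _ s d)). Qed.

Lemma cmpE x f s : decomposes A x f s -> forall i, cmp A x i = f i.
Proof.
move=> df i; have [t dg] := cmp_dec x.
have := decomposes_sub dg df; rewrite subrr => /dsd_zero/(_ i)/eqP.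
by rewrite subr_eq0 => /eqP.
Qed.

Lemma cmp_mem x i : A i (cmp A x i).
Proof. by have [s []] := cmp_dec x. Qed.

Lemma cmpB x y i : cmp A (x - y) i = cmp A x i - cmp A y i.
Proof.
have [s ds] := cmp_dec x; have [t dt] := cmp_dec y.
exact: (cmpE (decomposes_sub ds dt)).
Qed.

Lemma cmp0 i : cmp A 0 i = 0.
Proof. by rewrite -{1}(subrr 0) cmpB subrr. Qed.

Lemma cmpN x i : cmp A (- x) i = - cmp A x i.
Proof. by rewrite -sub0r cmpB cmp0 sub0r. Qed.

Lemma cmpD x y i : cmp A (x + y) i = cmp A x i + cmp A y i.
Proof. by rewrite -{1}[y]opprK cmpB cmpN opprK. Qed.

Lemma cmp_sum (J : Type) (r : seq J) (P : pred J) (F : J -> V) i :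
  cmp A (\sum_(j <- r | P j) F j) i = \sum_(j <- r | P j) cmp A (F j) i.
Proof.
by rewrite (big_morph (fun x => cmp A x i) (fun x y => cmpD x y i) (cmp0 i)).
Qed.

Lemma cmp_homog x i j : A i x -> cmp A x j = if j == i then x else 0.
Proof.
move=> Ax; apply: (@cmpE x (fun j => if j == i then x else 0) [:: i]); split=> //.
- by move=> l; case: eqP => [->|_] //; exact: dsd_add0.
- by move=> l; rewrite inE => /negbTE ->.
- by rewrite big_seq1 eqxx.
Qed.

Lemma cmp_id x i : A i x -> cmp A x i = x.
Proof. by move=> Ax; rewrite (cmp_homog _ Ax) eqxx. Qed.

Lemma cmp_ne x i j : A i x -> j != i -> cmp A x j = 0.
Proof. by move=> Ax /negbTE ji; rewrite (cmp_homog _ Ax) ji. Qed.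

Lemma cmp_ext x y : (forall i, cmp A x i = cmp A y i) -> x = y.
Proof.
move=> xy; apply/eqP; rewrite -subr_eq0; apply/eqP.
have [s [_ _ _ ->]] := cmp_dec (x - y).
by rewrite big1 // => i _; rewrite cmpB xy subrr.
Qed.

End Components.

(** R is graded by [nat] and modules by [int]. Extending by zero to negative degrees makes R a
    graded module over itself, with differences of degrees as indices. *)
Definition zgrade (V : zmodType) (A : nat -> set V) (z : int) : set V :=
  match z with Posz n => A n | Negz _ => [set 0] end.

Lemma zgrade_dsd (V : zmodType) (A : nat -> set V) :
  direct_sum_decomposition A -> direct_sum_decomposition (zgrade A).
Proof.
move=> dA; apply: dsd_intro => [[n|n]|x|f s [Af us f0 sum0] i].
- by case: dA => h _ _; exact: h.
- by split=> // x y -> ->; rewrite subrr.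
- have [f [s [Af us f0 ->]]] := dsd_ex dA x.
  exists (fun z => if z is Posz n then f n else 0), (map Posz s); split.
  + by case.
  + by rewrite map_inj_uniq // => a b [].
  + move=> [n|n] //= h; apply: f0; apply: contra h => h.
    by apply/mapP; exists n.
  + by rewrite big_map.
pose t := [seq absz z | z <- s & 0 <= z].
case: i => [n|n]; last by have := Af (Negz n).
apply: (dsd_zero dA (f := fun n => f (Posz n)) (s := t)); split.
- by move=> m; exact: (Af (Posz m)).
- rewrite map_inj_in_uniq ?filter_uniq // => -[a|a] [b|b]; rewrite !mem_filter //=.
  by move=> _ _ ->.
- move=> m mt; apply: f0; apply: contra mt => ms.
  by apply/mapP; exists (Posz m); rewrite ?mem_filter.
- rewrite [LHS]sum0 big_map big_filter [RHS]big_mkcond; apply: eq_bigr => -[m|m] _ //=.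
  by have := Af (Negz m).
Qed.

(** * Graded modules *)

Section SetScale.
Variable R : comNzRingType.
Implicit Types V W : lmodType R.

Lemma smul_linear V (a : R) : linear (fun x : V => a *: x).
Proof. by move=> b x y; rewrite scalerDr !scalerA mulrC. Qed.

Definition smul V (a : R) : {linear V -> V} := mklin (@smul_linear V a).

Definition rsub V (A : set V) : Prop :=
  A 0 /\ forall (a : R) x y, A x -> A y -> A (a *: x + y).

Lemma rsub0 V (A : set V) : rsub A -> A 0. Proof. by case. Qed.

Lemma rsubZ V (A : set V) a x : rsub A -> A x -> A (a *: x).
Proof. by case=> A0 h Ax; rewrite -[_ *: x]addr0; exact: h. Qed.

Lemma rsubD V (A : set V) x y : rsub A -> A x -> A y -> A (x + y).
Proof. by case=> A0 h Ax Ay; rewrite -[x]scale1r; exact: h. Qed.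

Lemma rsubN V (A : set V) x : rsub A -> A x -> A (- x).
Proof. by move=> rA Ax; rewrite -scaleN1r; exact: rsubZ. Qed.

Lemma rsubB V (A : set V) x y : rsub A -> A x -> A y -> A (x - y).
Proof. by move=> rA Ax Ay; apply: rsubD => //; exact: rsubN. Qed.

Lemma rsub_sum V (A : set V) (J : Type) (r : seq J) (P : pred J) (F : J -> V) :
  rsub A -> (forall j, P j -> A (F j)) -> A (\sum_(j <- r | P j) F j).
Proof.
move=> rA h; elim/big_rec: _ => [|j x Pj Ax]; first exact: rsub0.
by apply: rsubD => //; exact: h.
Qed.

Lemma rsub_sum_seq V (A : set V) (J : eqType) (r : seq J) (F : J -> V) :
  rsub A -> (forall j, j \in r -> A (F j)) -> A (\sum_(j <- r) F j).
Proof. by move=> rA h; rewrite big_seq; exact: rsub_sum. Qed.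

Lemma set_scale_sub V (I : set R) : rsub (set_scale (M := V) I).
Proof.
split; first by exists [::]; rewrite big_nil.
move=> a x y [s [hs ->]] [t [ht ->]]; exists ([seq a *: z | z <- s] ++ t).
split; last by rewrite big_cat big_map scaler_sumr.
move=> z; rewrite mem_cat => /orP[/mapP[w /hs[b Ib [v _ <-]] ->]|/ht //].
by exists b => //; exists (a *: v); rewrite // !scalerA mulrC.
Qed.

Lemma set_scaleZ V (I : set R) a (x : V) : I a -> set_scale I (a *: x).
Proof.
move=> Ia; exists [:: a *: x]; split; last by rewrite big_seq1.
by move=> y; rewrite inE => /eqP ->; exists a => //; exists x.
Qed.

Lemma set_scale_le V (I : set R) (A : set V) :
  rsub A -> (forall a x, I a -> A (a *: x)) -> set_scale I `<=` A.
Proof.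
move=> rA h x [s [hs ->]]; apply: rsub_sum_seq => // y /hs[a Ia [z _ <-]].
exact: h.
Qed.

Lemma rsub_preim V W (f : {linear V -> W}) (B : set W) :
  rsub B -> rsub (f @^-1` B).
Proof.
move=> rB; split=> [|a x y Bx By] /=; first by rewrite linear0; exact: rsub0.
by rewrite linearP; case: rB => _; apply.
Qed.

Lemma set_scale_linear V W (f : {linear V -> W}) (I : set R) x :
  set_scale I x -> set_scale I (f x).
Proof.
apply: (@set_scale_le _ _ (f @^-1` set_scale I)).
  by apply: rsub_preim; exact: set_scale_sub.
by move=> a y Ia /=; rewrite linearZ_LR; exact: set_scaleZ.
Qed.

Lemma rsub_zero V : rsub [set 0 : V].
Proof. by split=> // a x y -> ->; rewrite scaler0 addr0. Qed.

End SetScale.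

Lemma rsub_ksub (k : fieldType) (R : comAlgType k) (V : lmodType R) (A : set V) :
  rsub A -> ksub A.
Proof. by case=> A0 h; split=> // c x y; exact: h. Qed.

Section GradedModules.
Variables (k : fieldType) (R : comAlgType k) (Rg : nat -> set R).
Hypothesis hR : standard_graded Rg.
Local Notation Rz := (zgrade Rg).

Lemma Rg_dsd : direct_sum_decomposition Rg. Proof. by case: hR. Qed.

Lemma Rz_dsd : direct_sum_decomposition Rz.
Proof. by apply: zgrade_dsd; exact: Rg_dsd. Qed.

Lemma RgM i j a b : Rg i a -> Rg j b -> Rg (i + j) (a * b).
Proof. by case: hR => _ h _ _; exact: h. Qed.

Lemma Rg_const c : Rg 0 c%:A.
Proof. by case: hR => _ _ -> _; exists c. Qed.

Lemma Rg_constP a : Rg 0 a -> exists c : k, a = c%:A.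
Proof. by case: hR => _ _ -> _ [c _ <-]; exists c. Qed.

Lemma Rz_graded : graded_module Rg (M := (R^o : lmodType R)) Rz.
Proof.
split; first exact: Rz_dsd.
move=> i [j|j] a x Ra Rx; first by rewrite -PoszD; exact: RgM.
by rewrite [x]Rx scaler0; exact: (dsd_add0 Rz_dsd).
Qed.

Section OneModule.
Variables (V : lmodType R) (Vg : int -> set V).
Hypothesis hV : graded_module Rg Vg.

Lemma gm_dsd : direct_sum_decomposition Vg. Proof. by case: hV. Qed.

Lemma gm_scale i j a x : Rz i a -> Vg j x -> Vg (i + j) (a *: x).
Proof.
case: i => [i|i]; first by case: hV => _; apply.
by move=> -> _; rewrite scale0r; exact: (dsd_add0 gm_dsd).
Qed.

Lemma gm_ksub j : ksub (Vg j).
Proof.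
split=> [|c x y Vx Vy]; first exact: (dsd_add0 gm_dsd).
apply: (dsd_addD gm_dsd) => //; rewrite -[j]add0r; apply: gm_scale => //.
exact: Rg_const.
Qed.

Lemma cmp_scale i j a x : Rz i a -> cmp Vg (a *: x) (i + j) = a *: cmp Vg x j.
Proof.
move=> Ra; have [s [hs us h0 xE]] := cmp_dec gm_dsd x.
rewrite {1}xE scaler_sumr (cmp_sum gm_dsd).
have aux z : cmp Vg (a *: cmp Vg x z) (i + j) = if z == j then a *: cmp Vg x j else 0.
  rewrite (cmp_homog gm_dsd _ (gm_scale Ra (hs z))) (inj_eq (addrI i)) eq_sym.
  by case: eqP => [->|].
rewrite (eq_bigr _ (fun z _ => aux z)).
case: (boolP (j \in s)) => js.
  by rewrite (bigD1_seq j) //= eqxx big1 ?addr0 // => z /negbTE ->.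
rewrite h0 // scaler0 big1_seq // => z /andP[_ zs].
by case: eqP => // zj; rewrite zj in zs; rewrite zs in js.
Qed.

End OneModule.
End GradedModules.

(** * Standard graded algebras *)

Section StandardGraded.
Variables (k : fieldType) (R : comAlgType k) (Rg : nat -> set R).
Hypothesis hR : standard_graded Rg.
Local Notation Rz := (zgrade Rg).
Local Notation mm := (irrelevant_ideal Rg).
Local Notation RR := (R^o : lmodType R).

(** Replaces sums of elements of positive degree by one equation on the degree 0 component. *)
Lemma mmP a : mm a <-> cmp Rz a 0 = 0.
Proof.
have dR := Rz_dsd hR; split.
  case=> s [hs ->]; rewrite (cmp_sum dR) big1_seq // => b /andP[_ /hs[i i0 Rb]].
  by case: i i0 Rb => // i _ Rb; exact: (cmp_ne dR (i := Posz i.+1) Rb).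
move=> a0; have [s [hs us h0 aE]] := cmp_dec dR a.
exists [seq cmp Rz a z | z <- s & cmp Rz a z != 0]; split.
  move=> b /mapP[z]; rewrite mem_filter => /andP[nz zs] ->.
  case: z nz {zs} => [[|n]|n] nz; first by rewrite a0 eqxx in nz.
    by exists n.+1 => //; exact: (hs (Posz n.+1)).
  by have := hs (Negz n) => /= e; rewrite e eqxx in nz.
rewrite big_map big_filter [LHS]aE [RHS]big_mkcond; apply: eq_bigr => z _.
by case: eqP.
Qed.

Lemma mm_homog n a : Rg n.+1 a -> mm a.
Proof.
by move=> Ra; apply/mmP; apply: (cmp_ne (Rz_dsd hR) (i := Posz n.+1)).
Qed.

Lemma cmpR_scale i j a b : Rz i a -> cmp Rz (a * b) (i + j) = a * cmp Rz b j.
Proof. exact: (cmp_scale (Rz_graded hR)). Qed.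

(** There are no negative degrees, so only i = j = 0 contributes. The projection to R_0 is thus a
    ring morphism, which makes its kernel m a prime ideal. *)
Lemma cmp0_mul a b : cmp Rz (a * b) 0 = cmp Rz a 0 * cmp Rz b 0.
Proof.
have dR := Rz_dsd hR.
have [s [hs us h0 aE]] := cmp_dec dR a; have [t [ht ut k0 bE]] := cmp_dec dR b.
have hab i j : cmp Rz (cmp Rz a i * cmp Rz b j) 0 =
    (if i == 0 then cmp Rz a i else 0) * (if j == 0 then cmp Rz b j else 0).
  rewrite (cmp_homog dR (i := i + j) 0); last first.
    exact: (gm_scale (Rz_graded hR) (hs i) (ht j)).
  case: i => [[|i]|i].
  - by rewrite add0r eq_sym eqxx; case: eqP; rewrite ?mulr0.
  - case: j => [j|j]; first by rewrite /= mul0r.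
    by have e : cmp Rz b (Negz j) = 0 := ht (Negz j); rewrite e !(mulr0, if_same).
  - by have e : cmp Rz a (Negz i) = 0 := hs (Negz i); rewrite e !(mul0r, if_same).
have sum0 c r : (forall i, i \notin r -> cmp Rz c i = 0) -> uniq r ->
    \sum_(i <- r) (if i == 0 then cmp Rz c i else 0) = cmp Rz c 0.
  move=> c0 ur; case: (boolP (0 \in r)) => zr.
    by rewrite (bigD1_seq 0) //= big1 ?addr0 // => i /negbTE ->.
  by rewrite c0 // big1_seq // => i /andP[_ ir]; case: eqP => // e; rewrite -e ir in zr.
rewrite {1}aE {1}bE mulr_suml (cmp_sum dR).
under eq_bigr do rewrite mulr_sumr (cmp_sum dR).
under eq_bigr do under eq_bigr do rewrite hab.
under eq_bigr do rewrite -mulr_sumr.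
by rewrite -mulr_suml !sum0.
Qed.

Lemma mm_sub : rsub (mm : set RR).
Proof.
have dR := Rz_dsd hR.
split=> [|a x y /mmP x0 /mmP y0]; first by apply/mmP; exact: (cmp0 dR).
by apply/mmP; rewrite (cmpD dR) y0 addr0 [a *: x]/(a * x) cmp0_mul x0 mulr0.
Qed.

Lemma mmM a b : mm b -> mm (a * b).
Proof. by move=> /mmP b0; apply/mmP; rewrite cmp0_mul b0 mulr0. Qed.

Lemma const_mm c : mm (c%:A : R) -> c = 0.
Proof.
move=> /mmP; rewrite (cmp_id (Rz_dsd hR) (i := 0 : int)); last exact: Rg_const.
by move=> /eqP; rewrite scaler_eq0 oner_eq0 orbF => /eqP.
Qed.

Lemma mm1 : ~ mm 1.
Proof. by rewrite -[1](scale1r 1) => /const_mm/eqP; rewrite oner_eq0. Qed.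

Lemma cmp0_const a : exists c : k, cmp Rz a 0 = c%:A.
Proof. by apply: (Rg_constP hR); exact: (cmp_mem (Rz_dsd hR) a (0 : int)). Qed.

Lemma mm_set_scale_rV n (x : 'rV[R]_n) : set_scale mm x <-> forall s, mm (x 0 s).
Proof.
split; last first.
  move=> h; rewrite [x]row_sum_delta; apply: rsub_sum; first exact: set_scale_sub.
  by move=> s _; exact: set_scaleZ.
move=> + s; apply: (@set_scale_le _ _ _ [set x : 'rV[R]_n | mm (x 0 s)]).
  split=> [|a y z my mz] /=; first by rewrite mxE; case: mm_sub.
  by rewrite !mxE; case: mm_sub => _; exact.
by move=> a y ma /=; rewrite !mxE mulrC; exact: mmM.
Qed.

Fixpoint gen_span (xs : seq R) (A : set RR) : set RR :=
  if xs is x :: xs' then ksum (smul RR x) A (gen_span xs' A) else [set 0].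

(** The k-span of the monomials of degree n in [xs]; built from [ksum], it is finite-dimensional by
    construction. *)
Fixpoint mon_span (xs : seq R) (n : nat) : set RR :=
  if n is n'.+1 then gen_span xs (mon_span xs n') else Rg 0.

Lemma fd_gen_span xs A : fd A -> fd (gen_span xs A).
Proof. by move=> fA; elim: xs => [|x xs IH] /=; [exact: fd0|exact: fd_sum]. Qed.

Lemma fd_Rg0 : fd (Rg 0 : set RR).
Proof.
have e1 (c : k) : (c%:A : R) *: (1 : RR) = c%:A by exact: mulr1.
exists 1%N; suff -> : Rg 0 = kadj [set 0 : RR] 1.
  by apply: fdimS; [exact: fdim0|move=> /eqP; rewrite oner_eq0].
apply/seteqP; split=> a.
  by move=> /(Rg_constP hR)[c ->]; exists c => //; rewrite /= e1 subrr.
by case=> c /eqP; rewrite e1 subr_eq0 => /eqP ->; exact: Rg_const.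
Qed.

Lemma fd_mon_span xs n : fd (mon_span xs n).
Proof. by elim: n => [|n IH] /=; [exact: fd_Rg0|exact: fd_gen_span]. Qed.

Lemma gen_span_mem xs (A : set RR) x : fd A -> A 1 -> x \in xs -> gen_span xs A x.
Proof.
move=> fA A1; elim: xs => //= y xs IH; rewrite inE => /orP[/eqP ->|/IH h].
  exists 1 => //=; rewrite [y *: _]mulr1 subrr.
  exact: (ksub0 (fd_ksub (fd_gen_span xs fA))).
exists 0; first exact: (ksub0 (fd_ksub fA)).
by rewrite /= scaler0 subr0.
Qed.

Lemma gen_span_mul xs (A B : set RR) b :
  (forall a, A a -> B (a * b)) -> forall a, gen_span xs A a -> gen_span xs B (a * b).
Proof.
move=> AB; elim: xs => [|x xs IH] a /=; first by move=> ->; rewrite mul0r.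
case=> c Ac /IH h; exists (c * b); first exact: AB.
by move: h; rewrite mulrBl /= [x *: c]/(x * c) -mulrA.
Qed.

Lemma mon_span_mul xs i j a b :
  mon_span xs i a -> mon_span xs j b -> mon_span xs (i + j) (a * b).
Proof.
elim: i a => [|i IH] a Wa Wb; last first.
  by apply: gen_span_mul Wa => c Wc; exact: IH.
have [c ->] := Rg_constP hR Wa.
by have := ksubZ c (fd_ksub (fd_mon_span xs j)) Wb.
Qed.

(** The elements whose components all lie in the monomial spans form a subalgebra containing the
    generators, hence all of R. This bounds the dimension of each R_n. *)
Lemma gens_exist : exists xs : seq R,
  (forall x, x \in xs -> Rg 1 x) /\ forall n, Rg n `<=` mon_span xs n.
Proof.
have dR := Rz_dsd hR.
case: hR => _ _ _ [xs [xs1 gen]]; exists xs; split=> //.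
pose W (z : int) : set RR := if z is Posz n then mon_span xs n else [set 0].
have kW z : ksub (W z).
  by case: z => n; [exact: (fd_ksub (fd_mon_span xs n))|exact: ksub_zero].
have WM i j a b : W i a -> W j b -> W (i + j) (a * b).
  case: i => i; last by move=> -> _; rewrite mul0r; exact: (ksub0 (kW _)).
  case: j => j; last by move=> _ ->; rewrite mulr0; exact: (ksub0 (kW _)).
  by move=> Wa Wb; exact: mon_span_mul.
have Wsum z (J : Type) (r : seq J) (F : J -> R) :
    (forall j, W z (F j)) -> W z (\sum_(j <- r) F j).
  move=> h; elim: r => [|j r IH]; first by rewrite big_nil; exact: (ksub0 (kW _)).
  by rewrite big_cons; exact: (ksubD (kW z) (h j) IH).
pose S : {pred R} := [pred r | `[< forall z, W z (cmp Rz r z) >]].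
have SP r : reflect (forall z, W z (cmp Rz r z)) (r \in S) by exact: asboolP.
have WS i a : Rz i a -> W i a -> a \in S.
  move=> Ra Wa; apply/SP => z; rewrite (cmp_homog dR _ Ra).
  by case: eqP => [->|_] //; exact: (ksub0 (kW _)).
have gS : {subset xs <= S}.
  move=> x xxs; apply: (WS 1); first exact: xs1.
  apply: gen_span_mem => //; first exact: fd_Rg0.
  by have := Rg_const hR 1; rewrite scale1r.
have SS : GRing.subalg_closed S.
  split.
  - by apply: (WS 0); have := Rg_const hR 1; rewrite scale1r.
  - move=> c u v /SP Su /SP Sv; apply/SP => z; rewrite (cmpD dR).
    apply: (ksubD (kW z)) => //.
    have := cmpR_scale z u (Rg_const hR c : Rz 0 _).
    rewrite add0r mulr_algl => ->.
    by have := ksubZ c (kW z) (Su z); rewrite [_ *: _]/(_ * _).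
  - move=> u v /SP Su /SP Sv; apply/SP => z.
    have [s [hs us h0 ->]] := cmp_dec dR u; have [t [ht ut k0 ->]] := cmp_dec dR v.
    rewrite mulr_suml (cmp_sum dR); apply: (Wsum z) => i.
    rewrite mulr_sumr (cmp_sum dR); apply: (Wsum z) => j.
    rewrite (cmp_homog dR (i := i + j)); last first.
      exact: (gm_scale (Rz_graded hR) (hs i) (ht j)).
    by case: eqP => [->|_]; [exact: WM|exact: (ksub0 (kW _))].
move=> n a Ra; have /SP/(_ (Posz n)) := gen S SS gS a.
by rewrite (cmp_id dR (Ra : Rz (Posz n) a)).
Qed.

End StandardGraded.

(** * Noetherian modules *)

Section Noetherian.

Fixpoint lspan (R : comNzRingType) (V : lmodType R) (s : seq V) : set V :=
  if s is y :: s' then [set x | exists a : R, lspan s' (x - a *: y)]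
  else [set 0].

Definition noetherian (R : comNzRingType) (V : lmodType R) : Prop :=
  forall A : set V, rsub A -> exists s : seq V,
    (forall x, x \in s -> A x) /\ A `<=` lspan s.

Section Lspan.
Variables (R : comNzRingType) (V : lmodType R).
Implicit Types (s : seq V) (A : set V).

Lemma lspan_sub s : rsub (lspan s).
Proof.
elim: s => [|y s IH] /=; first exact: rsub_zero.
split; first by exists 0; rewrite scale0r subr0; exact: rsub0.
move=> a x z [b hb] [c hc]; exists (a * b + c).
rewrite scalerDl -scalerA opprD addrACA -scalerBr.
by apply: rsubD => //; exact: rsubZ.
Qed.

Lemma lspan_mem s x : x \in s -> lspan s x.
Proof.
elim: s => //= y s IH; rewrite inE => /orP[/eqP ->|/IH h].
  by exists 1; rewrite scale1r subrr; exact: (rsub0 (lspan_sub s)).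
by exists 0; rewrite scale0r subr0.
Qed.

Lemma lspan_le s A : rsub A -> (forall x, x \in s -> A x) -> lspan s `<=` A.
Proof.
move=> rA; elim: s => [|y s IH] h x /=; first by move=> ->; exact: rsub0.
case=> a hx; rewrite -(subrK (a *: y) x); apply: rsubD => //.
  by apply: IH hx => z zs; apply: h; rewrite inE zs orbT.
by apply: rsubZ => //; apply: h; rewrite inE eqxx.
Qed.

Lemma lspan_incl s t : {subset s <= t} -> lspan s `<=` lspan t.
Proof.
by move=> st; apply: lspan_le; [exact: lspan_sub|move=> x /st; exact: lspan_mem].
Qed.

Lemma lspan_coefs s x : lspan s x ->
  exists c : 'I_(size s) -> R, x = \sum_i c i *: s`_i.
Proof.
elim: s x => [|y s IH] x /=.
  by move=> ->; exists (fun=> 0); rewrite big_ord0.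
case=> a /IH[c e]; exists (fun i => if unlift ord0 i is Some j then c j else a).
rewrite big_ord_recl unlift_none /= -[x](subrK (a *: y)) addrC e; congr (_ + _).
by apply: eq_bigr => i _; rewrite liftK.
Qed.

End Lspan.

Lemma noetherian_image (A B : comNzRingType) (f : {rmorphism A -> B}) :
  (forall b, exists a, f a = b) -> noetherian (A^o : lmodType A) ->
  noetherian (B^o : lmodType B).
Proof.
move=> fs nA I rI.
have rJ : rsub (f @^-1` I : set (A^o : lmodType A)).
  split; first by rewrite /= rmorph0; exact: (rsub0 rI).
  by move=> a x y Ix Iy; rewrite /= rmorphD rmorphM; case: rI => _; apply.
have [s [sI Is]] := nA _ rJ; exists (map f s); split.
  by move=> _ /mapP[a /sI fa ->].
move=> b Ib; have [a ab] := fs b; rewrite -ab in Ib *.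
have {Ib}: lspan s a by apply: Is.
elim: s {b ab sI Is} a => [|y s IH] a /=; first by move=> ->; rewrite rmorph0.
by case=> c /IH h; exists (f c); move: h; rewrite rmorphB rmorphM.
Qed.

Lemma noetherian_field (k : fieldType) : noetherian (k^o : lmodType k).
Proof.
move=> A rA; case: (pselect (A `<=` [set 0])) => [A0|nA]; first by exists [::].
have [a [Aa a0]] : exists a, A a /\ a <> 0.
  by apply: contra_notP nA => H a Aa; apply: contra_notP H => a0; exists a.
exists [:: a]; split=> [x|x Ax]; first by rewrite inE => /eqP ->.
exists (x / a); rewrite /= [_ *: a](divfK (_ : a != 0)) ?subrr //.
exact/eqP.
Qed.

(** * Hilbert's basis theorem *)

Section HilbertBasis.
Variable A : comNzRingType.
Local Notation P := ({poly A}^o : lmodType {poly A}).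

Lemma lspan_lead (s : seq P) d a : (0 < d)%N ->
  (forall p : {poly A}, p \in s -> (size p <= d)%N) ->
  lspan (map (fun p : {poly A} => (lead_coef p : A^o)) s) a ->
  exists g : {poly A}, [/\ lspan s g, (size g <= d)%N & g`_d.-1 = a].
Proof.
move=> d0; elim: s a => [|y s IH] a sd /=.
  by move=> ->; exists 0; split; rewrite ?size_poly0 ?coef0.
case=> c /IH[p ps|g [sg gd ga]]; first by apply: sd; rewrite inE ps orbT.
have yd : (size (y : {poly A}) <= d)%N by apply: sd; rewrite inE eqxx.
exists (g + (c *: 'X^(d - size (y : {poly A}))) * y); split.
- exists (c *: 'X^(d - size (y : {poly A}))).
  by rewrite [_ *: y]/(_ * y) addrK.
- apply: leq_trans (size_polyD _ _) _; rewrite geq_max gd /=.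
  apply: leq_trans (size_polyMleq _ _) _.
  have aux (a1 b1 : nat) : (a1 <= (d - b1).+1 -> b1 <= d -> (a1 + b1).-1 <= d)%N by lia.
  apply: aux => //.
  by apply: leq_trans (size_scale_leq _ _) _; rewrite size_polyXn.
rewrite coefD ga -scalerAl coefZ coefXnM.
case: (posnP (size (y : {poly A}))) => [y0|y0].
  have -> : y = 0 by apply/eqP; rewrite -size_poly_eq0 y0.
  by rewrite /lead_coef !coef0 if_same scaler0 mulr0 subr0 addr0.
rewrite ifF; last by lia.
have -> : (d.-1 - (d - size (y : {poly A})) = (size (y : {poly A})).-1)%N by lia.
by rewrite [_ *: _ in LHS]/(_ * _) subrK.
Qed.

(** If I is not finitely generated, pick repeatedly an element f_n of least size outside the span of
    the earlier ones. The ideals of leading coefficients stop growing at some N, so an element of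
    the span of f_0, ..., f_(N-1) cancels the top term of f_N, leaving a smaller element outside
    that span. *)
Lemma noetherian_poly : noetherian (A^o : lmodType A) -> noetherian P.
Proof.
move=> nA I rI; apply: contrapT => nfg.
have /choice[nx nxP] : forall s : seq P, exists f : P,
    (forall x, x \in s -> I x) ->
    [/\ I f, ~ lspan s f & forall g : P, I g -> ~ lspan s g ->
      (size (f : {poly A}) <= size (g : {poly A}))%N].
  move=> s; case: (pselect (forall x, x \in s -> I x)) => [sI|nsI]; last by exists 0.
  have [f [If nf]] : exists f, I f /\ ~ lspan s f.
    apply: contrapT => H; apply: nfg; exists s; split=> // x Ix.
    by apply: contra_notP H => nx; exists x.
  have ex : exists n, `[< exists f : P, [/\ I f, ~ lspan s f & size (f : {poly A}) = n] >].
    by exists (size (f : {poly A})); apply/asboolP; exists f.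
  case: (ex_minnP ex) => n /asboolP[g [Ig ng <-]] mn; exists g => _; split=> // h Ih nh.
  by apply: mn; apply/asboolP; exists h.
pose sq n := iter n (fun s => nx s :: s) [::].
have sqI n x : x \in sq n -> I x.
  elim: n x => //= n IH x; rewrite inE => /orP[/eqP ->|]; last exact: IH.
  by have [] := nxP _ IH.
pose f n : {poly A} := nx (sq n).
have sq_le m n : (m <= n)%N -> {subset sq m <= sq n}.
  move=> mn; rewrite -(subnK mn); elim: (n - m)%N => // j IH x /IH h.
  by rewrite addSn /= inE h orbT.
have f_sq m n : (m < n)%N -> f m \in sq n.
  by move=> mn; apply: (sq_le _ _ mn); rewrite /= inE eqxx.
have sq_f n x : x \in sq n -> exists2 m, (m < n)%N & x = f m.
  elim: n => //= n IH; rewrite inE => /orP[/eqP ->|/IH[m mn ->]]; first by exists n.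
  by exists m => //; exact: ltnW.
have f_size m n : (m <= n)%N -> (size (f m) <= size (f n))%N.
  move=> mn; have [_ _] := nxP _ (sqI m); apply; first by have [] := nxP _ (sqI n).
  have [_ h _] := nxP _ (sqI n); apply: contra_not h.
  by apply: lspan_incl; exact: sq_le.
pose L n := lspan (map (fun p : {poly A} => (lead_coef p : A^o)) (sq n)).
have L_le m n : (m <= n)%N -> L m `<=` L n.
  by move=> mn; apply: lspan_incl => _ /mapP[x /(sq_le _ _ mn) xs ->]; exact: map_f.
have rJ : rsub [set a | exists n, L n a].
  split; first by exists 0%N.
  move=> a x y [n Lx] [m Ly]; exists (maxn n m).
  have [_] := lspan_sub (map (fun p : {poly A} => (lead_coef p : A^o)) (sq (maxn n m))).
  by apply; [apply: L_le Lx|apply: L_le Ly]; rewrite ?leq_maxl ?leq_maxr.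
have [t [tJ Jt]] := nA _ rJ.
have [N tN] : exists N, forall x, x \in t -> L N x.
  elim: t {Jt} tJ => [|y t IH] h; first by exists 0%N.
  have [|N hN] := IH; first by move=> x xt; apply: h; rewrite inE xt orbT.
  have [|n hn] := h y; first by rewrite inE eqxx.
  exists (maxn n N) => x; rewrite inE => /orP[/eqP ->|/hN].
    by apply: L_le hn; exact: leq_maxl.
  by apply: L_le; exact: leq_maxr.
have LN : L N (lead_coef (f N)).
  apply: (lspan_le (lspan_sub _) tN); apply: Jt; exists N.+1.
  by apply: lspan_mem; apply: map_f; apply: f_sq.
have [If nf minf] := nxP _ (sqI N).
have fN0 : (0 < size (f N))%N.
  rewrite lt0n size_poly_eq0; apply: contra_notN nf => /eqP e.
  rewrite -/(f N) e; exact: (rsub0 (lspan_sub _)).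
have [|g [sg gd ga]] := lspan_lead fN0 _ LN.
  by move=> p /sq_f[m mN ->]; apply: f_size; exact: ltnW.
have Ig : I g by apply: (lspan_le rI (sqI N)).
have := minf (f N - g) (rsubB rI If Ig).
have nfg' : ~ lspan (sq N) (f N - g).
  move=> h; apply: nf; rewrite -[nx _](subrK g).
  exact: (rsubD (lspan_sub _) h sg).
move=> /(_ nfg'); apply/negP; rewrite -ltnNge -[in X in (_ < X)%N](prednK fN0) ltnS.
apply/leq_sizeP => j; rewrite leq_eqVlt coefB => /orP[/eqP <-|hj].
  by rewrite ga /lead_coef subrr.
have hj' : (size (f N) <= j)%N by rewrite -(prednK fN0).
by rewrite !nth_default ?subr0 // (leq_trans gd).
Qed.

End HilbertBasis.

(** Induction on the number m of leading coordinates allowed to be nonzero: the last allowed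
    coordinate ranges over an ideal, generators of which lift to K, and subtracting a combination of
    the lifts reduces m. *)
Lemma noetherian_rV (R : comNzRingType) n :
  noetherian (R^o : lmodType R) -> noetherian 'rV[R]_n.
Proof.
move=> nR K rK.
suff H m : (m <= n)%N -> exists s : seq 'rV[R]_n, (forall x, x \in s -> K x) /\
    forall x, K x -> (forall i : 'I_n, (m <= i)%N -> x 0 i = 0) -> lspan s x.
  have [s [sK Ks]] := H n (leqnn n); exists s; split=> // x Kx.
  by apply: Ks => // i; rewrite leqNgt ltn_ord.
elim: m => [_|m IH mn].
  exists [::]; split=> // x _ x0; apply/rowP => i; rewrite mxE; exact: x0.
have [s [sK Ks]] := IH (ltnW mn); pose i0 := Ordinal mn.
pose T := [set x : 'rV[R]_n | K x /\ forall i : 'I_n, (m < i)%N -> x 0 i = 0].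
have rT : rsub T.
  split; first by split; [exact: rsub0|move=> i _; rewrite mxE].
  move=> a x y [Kx x0] [Ky y0]; split; first by case: rK => _; apply.
  by move=> i im; rewrite !mxE x0 // y0 // mulr0 addr0.
have rI : rsub ((fun x : 'rV[R]_n => (x 0 i0 : R^o)) @` T).
  split; first by exists 0; [exact: rsub0|rewrite mxE].
  move=> a _ _ [x Tx <-] [y Ty <-]; exists (a *: x + y); last by rewrite !mxE.
  by case: rT => _; apply.
have [t [tI It]] := nR _ rI.
have [u [uT ut]] : exists u : seq 'rV[R]_n, (forall x, x \in u -> T x) /\
    t = map (fun x : 'rV[R]_n => (x 0 i0 : R^o)) u.
  elim: t {It} tI => [|y t IHt] h; first by exists [::].
  have [|u [uT ->]] := IHt; first by move=> x xt; apply: h; rewrite inE xt orbT.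
  have [|x Tx xy] := h y; first by rewrite inE eqxx.
  exists (x :: u); rewrite /= xy; split=> // z; rewrite inE => /orP[/eqP ->|] //.
  exact: uT.
exists (u ++ s); split.
  by move=> x; rewrite mem_cat => /orP[/uT[]|/sK].
move=> x Kx x0; have : lspan t (x 0 i0 : R^o) by apply: It; exists x.
have Tx : T x by [].
rewrite ut => lx.
have [z [uz xz]] : exists z, lspan u z /\ x 0 i0 = z 0 i0.
  elim: u (x 0 i0 : R^o) lx {uT ut} => [|y u IHu] b /=.
    by move=> ->; exists 0; rewrite mxE.
  case=> a /IHu[z [uz e]]; exists (z + a *: y); split; first by exists a; rewrite addrK.
  by rewrite !mxE -e [_ *: _ in RHS]/(_ * _) subrK.
have Tz : T z by apply: (lspan_le rT uT).
have rus := lspan_sub (u ++ s).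
rewrite -(subrK z x); apply: rsubD => //; last first.
  by apply: lspan_incl uz => v; rewrite mem_cat => ->.
apply: (@lspan_incl _ _ s); first by move=> v vs; rewrite mem_cat vs orbT.
have [Kxz hxz] := rsubB rT Tx Tz.
apply: Ks => // i; rewrite leq_eqVlt => /orP[/eqP e|/hxz //].
have -> : i = i0 by apply: val_inj.
by rewrite !mxE xz subrr.
Qed.

(** R is the image of a polynomial ring over k, built with one variable per generator. *)
Lemma noetherian_standard (k : fieldType) (R : comAlgType k) (Rg : nat -> set R) :
  standard_graded Rg -> noetherian (R^o : lmodType R).
Proof.
case=> _ _ _ [s [_ gen]].
have [A [f [nA [fk fs]]]] : exists (A : comNzRingType) (f : {rmorphism A -> R}),
    noetherian (A^o : lmodType A) /\ (forall c : k, exists a, f a = c%:A) /\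
    forall x, x \in s -> exists a, f a = x.
  elim: s {gen} => [|x s [A [f [nA [fk fs]]]]].
    exists k, (in_alg R : {rmorphism k -> R}); split; first exact: noetherian_field.
    by split=> // c; exists c.
  have cx : commr_rmorph f x by move=> a; exact: mulrC.
  exists {poly A}, (horner_morph cx : {rmorphism {poly A} -> R}).
  split; first exact: noetherian_poly.
  split=> [c|y]; first by have [a <-] := fk c; exists a%:P; exact: horner_morphC.
  rewrite inE => /orP[/eqP ->|/fs[a <-]]; first by exists 'X; exact: horner_morphX.
  by exists a%:P; exact: horner_morphC.
apply: noetherian_image nA => r.
pose S : {pred R} := [pred r | `[< exists a, f a = r >]].
have SP t : reflect (exists a, f a = t) (t \in S) by exact: asboolP.
apply/SP; apply: gen; last by move=> x /fs ?; apply/SP.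
split.
- by apply/SP; exists 1; rewrite rmorph1.
- move=> c u v /SP[a <-] /SP[b <-]; apply/SP; have [d dc] := fk c.
  by exists (d * a + b); rewrite rmorphD rmorphM dc mulr_algl.
- by move=> u v /SP[a <-] /SP[b <-]; apply/SP; exists (a * b); rewrite rmorphM.
Qed.

End Noetherian.

(** * Minimal graded free resolutions *)

Section FreeModules.
Variable R : comNzRingType.
Variable V : lmodType R.

Lemma lcomb_linear n (g : 'I_n -> V) : linear (fun x : 'rV[R]_n => \sum_s x 0 s *: g s).
Proof.
move=> a x y; rewrite scaler_sumr -big_split; apply: eq_bigr => s _ /=.
by rewrite !mxE scalerDl scalerA.
Qed.

Definition lcomb n (g : 'I_n -> V) : {linear 'rV[R]_n -> V} := mklin (lcomb_linear g).

Lemma lcombE n (g : 'I_n -> V) x : lcomb g x = \sum_s x 0 s *: g s.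
Proof. by []. Qed.

Lemma lcomb_delta n (g : 'I_n -> V) s : lcomb g (delta_mx 0 s) = g s.
Proof.
rewrite lcombE (bigD1 s) //= mxE !eqxx scale1r big1 ?addr0 // => t /negbTE ts.
by rewrite mxE ts andbF scale0r.
Qed.

Lemma linear_lcomb n (f : {linear 'rV[R]_n -> V}) x :
  f x = lcomb (fun s => f (delta_mx 0 s)) x.
Proof.
rewrite {1}[x]row_sum_delta linear_sum; apply: eq_bigr => s _.
by rewrite linearZ_LR.
Qed.

Lemma linear_rV_in n (f : {linear 'rV[R]_n -> V}) (A : set V) :
  rsub A -> (forall s, A (f (delta_mx 0 s))) -> forall x, A (f x).
Proof.
move=> rA h x; rewrite linear_lcomb; apply: rsub_sum => // s _; exact: rsubZ.
Qed.

End FreeModules.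

Lemma rV_lift (R : comNzRingType) n (V W : lmodType R) (P : 'I_n -> V -> W -> Prop)
    (f : {linear 'rV[R]_n -> W}) :
  (forall s, exists v, P s v (f (delta_mx 0 s))) ->
  exists h : {linear 'rV[R]_n -> V}, forall s, P s (h (delta_mx 0 s)) (f (delta_mx 0 s)).
Proof.
by move=> /choice[v hv]; exists (lcomb v) => s; rewrite lcomb_delta.
Qed.

Lemma projective_rV (R : comNzRingType) n : projective ('rV[R]_n).
Proof.
move=> A B f g fs.
have [s|h hh] := @rV_lift _ n A B (fun _ v w => f v = w) g; first exact: fs.
exists h => x; rewrite [x]row_sum_delta !linear_sum.
by apply: eq_bigr => s _; rewrite !linearZ_LR hh.
Qed.

(** * Graded free modules and minimal systems of generators *)

Section GradedFree.
Variables (k : fieldType) (R : comAlgType k) (Rg : nat -> set R).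
Hypothesis hR : standard_graded Rg.
Local Notation Rz := (zgrade Rg).
Local Notation mm := (irrelevant_ideal Rg).
Local Notation RR := (R^o : lmodType R).
Local Notation gmod := (graded_module Rg).

(* The grading of the direct sum of the twists R(- deg s). *)
Definition rVg n (deg : 'I_n -> int) (j : int) : set 'rV[R]_n :=
  [set x | forall s, Rz (j - deg s) (x 0 s)].

Lemma rVg_graded n (deg : 'I_n -> int) : gmod (rVg deg).
Proof.
have dR := Rz_dsd hR; split; last first.
  move=> i j a x Ra Rx s; rewrite mxE -addrA.
  exact: (gm_scale (Rz_graded hR) (i := Posz i) Ra (Rx s)).
apply: dsd_intro => [j|x|f t [Vf ut f0 sum0] j].
- split; first by move=> s; rewrite mxE; exact: (dsd_add0 dR).
  by move=> x y Vx Vy s; rewrite !mxE; exact: (dsd_addB dR).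
- have /choice[t ht] : forall s, exists t, decomposes Rz (x 0 s) (cmp Rz (x 0 s)) t.
    by move=> s; exact: cmp_dec.
  pose r := undup (flatten [seq [seq z + deg s | z <- t s] | s <- enum 'I_n]).
  exists (fun j => \row_s cmp Rz (x 0 s) (j - deg s)), r; split.
  + by move=> j s; rewrite mxE; exact: (cmp_mem dR).
  + exact: undup_uniq.
  + move=> j; rewrite mem_undup => jr; apply/rowP => s; rewrite !mxE.
    have [_ _ h0 _] := ht s; apply: h0; apply: contra jr => js.
    apply/flattenP; exists [seq z + deg s | z <- t s].
      by apply/mapP; exists s; rewrite // mem_enum.
    by apply/mapP; exists (j - deg s); rewrite // subrK.
  apply/rowP => s; rewrite summxE; under eq_bigr do rewrite mxE.
  have [h1 h2 h3 _] := ht s.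
  have [||_ _ _ {1}->] := decomposes_widen (ht s) (t := [seq j - deg s | j <- r]).
  + by rewrite map_inj_uniq ?undup_uniq //; exact: addIr.
  + move=> z zs; apply/mapP; exists (z + deg s); last by rewrite addrK.
    rewrite mem_undup; apply/flattenP; exists [seq z + deg s | z <- t s].
      by apply/mapP; exists s; rewrite // mem_enum.
    exact: map_f.
  by rewrite big_map.
- apply/rowP => s; rewrite mxE.
  have d0 : decomposes Rz 0 (fun z => f (z + deg s) 0 s) [seq j - deg s | j <- t].
    split.
    + by move=> z; have := Vf (z + deg s) s; rewrite addrK.
    + by rewrite map_inj_uniq //; exact: addIr.
    + move=> z zt; rewrite f0 ?mxE //; apply: contra zt => zt.
      by apply/mapP; exists (z + deg s); rewrite // addrK.
    + have := congr1 (fun v : 'rV[R]_n => v 0 s) sum0; rewrite mxE summxE => e.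
      rewrite [LHS]e.
      by rewrite big_map; apply: eq_bigr => z _; rewrite subrK.
  by have := dsd_zero dR d0 (j - deg s); rewrite subrK.
Qed.

Lemma cmp_rVg n (deg : 'I_n -> int) x j s :
  cmp (rVg deg) x j 0 s = cmp Rz (x 0 s) (j - deg s).
Proof.
have dR := Rz_dsd hR; have dV := gm_dsd (rVg_graded deg).
have [t [Vt ut t0 xE]] := cmp_dec dV x.
rewrite {2}xE summxE (cmp_sum dR).
transitivity (\sum_(i <- t) if i == j then cmp (rVg deg) x i 0 s else 0).
  case: (boolP (j \in t)) => jt.
    by rewrite (bigD1_seq j) //= eqxx big1 ?addr0 // => i /negbTE ->.
  rewrite t0 // mxE big1_seq // => i /andP[_ it].
  by case: eqP => // e; rewrite -e it in jt.
apply: eq_bigr => i _; rewrite (cmp_homog dR _ (Vt i s)).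
by rewrite (inj_eq (addIr _)) eq_sym.
Qed.

Section OneModule.
Variables (V : lmodType R) (Vg : int -> set V).
Hypothesis hV : gmod Vg.

Definition hsub (K : set V) : Prop := rsub K /\ forall x j, K x -> K (cmp Vg x j).

Lemma lcomb_homog n (deg : 'I_n -> int) (g : 'I_n -> V) j x :
  (forall s, Vg (deg s) (g s)) -> rVg deg j x -> Vg j (lcomb g x).
Proof.
move=> hg hx; have dV := gm_dsd hV; rewrite lcombE.
elim/big_rec: _ => [|s y _ Vy]; first exact: (dsd_add0 dV).
apply: (dsd_addD dV) => //; rewrite -(subrK (deg s) j).
exact: (gm_scale hV (hx s) (hg s)).
Qed.

Lemma cmp_homog_map (W : lmodType R) (Wg : int -> set W) (hW : gmod Wg)
    (f : {linear W -> V}) : (forall j x, Wg j x -> Vg j (f x)) ->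
  forall x j, cmp Vg (f x) j = f (cmp Wg x j).
Proof.
move=> hf x j; have dW := gm_dsd hW; have dV := gm_dsd hV.
have [t [Wt ut t0 xE]] := cmp_dec dW x.
rewrite {1}xE linear_sum (cmp_sum dV).
rewrite (eq_bigr (fun i => if i == j then f (cmp Wg x i) else 0)); last first.
  by move=> i _; rewrite (cmp_homog dV _ (hf _ _ (Wt i))) eq_sym.
case: (boolP (j \in t)) => jt.
  by rewrite (bigD1_seq j) //= eqxx big1 ?addr0 // => i /negbTE ->.
rewrite t0 // linear0 big1_seq // => i /andP[_ it].
by case: eqP => // e; rewrite -e it in jt.
Qed.


Definition hgens (K : set V) n (deg : 'I_n -> int) (g : 'I_n -> V) : Prop :=
  [/\ forall s, Vg (deg s) (g s), forall s, K (g s)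
    & forall x, K x -> exists c, x = lcomb g c].

Lemma hgens_exist (K : set V) : hsub K ->
  (exists s : seq V, (forall x, x \in s -> K x) /\ K `<=` lspan s) ->
  exists n deg g, @hgens K n deg g.
Proof.
move=> [rK hK] [s [sK Ks]].
have [t [tK Kt]] : exists t : seq V,
    (forall x, x \in t -> K x /\ exists j, Vg j x) /\ K `<=` lspan t.
  suff [t [tK st]] : exists t : seq V,
      (forall x, x \in t -> K x /\ exists j, Vg j x) /\ forall x, x \in s -> lspan t x.
    exists t; split=> // x /Ks; apply: lspan_le => //; exact: lspan_sub.
  elim: s sK {Ks} => [|y s IH] sK; first by exists [::].
  have [|t [tK st]] := IH; first by move=> x xs; apply: sK; rewrite inE xs orbT.
  have [r [Vr ur r0 yE]] := cmp_dec (gm_dsd hV) y.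
  exists ([seq cmp Vg y j | j <- r] ++ t); split.
    move=> x; rewrite mem_cat => /orP[/mapP[j _ ->]|/tK //]; split; last by exists j.
    by apply: hK; apply: sK; rewrite inE eqxx.
  move=> x; rewrite inE => /orP[/eqP ->|/st]; last first.
    by apply: lspan_incl => z zt; rewrite mem_cat zt orbT.
  rewrite {2}yE; apply: rsub_sum_seq => [|j jr]; first exact: lspan_sub.
  by apply: lspan_mem; rewrite mem_cat map_f.
have tmem (i : 'I_(size t)) : t`_i \in t by rewrite mem_nth.
have /choice[deg hdeg] : forall i : 'I_(size t), exists j, Vg j t`_i.
  by move=> i; have [_] := tK _ (tmem i).
exists (size t), deg, (fun i => t`_i); split=> // [i|x /Kt/lspan_coefs[c ->]].
  by have [] := tK _ (tmem i).
by exists (\row_i c i); rewrite lcombE; apply: eq_bigr => i _; rewrite mxE.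
Qed.

(** The component of the relation c in degree [deg s] is again a relation, and its coefficient at s
    has degree 0: a nonzero scalar, as c 0 s is outside m. Hence g s is a combination of the other
    generators. *)
Lemma hgens_drop (K : set V) n (deg : 'I_n.+1 -> int) g s c :
  rsub K -> @hgens K n.+1 deg g -> lcomb g c = 0 -> ~ mm (c 0 s) ->
  exists deg' g', @hgens K n deg' g'.
Proof.
move=> rK [hg gK Kg] c0 nm; exists (deg \o lift s), (g \o lift s).
split=> [t|t|x /Kg[d ->]] //=; have dV := gm_dsd hV.
have hgr := rVg_graded deg.
pose c' := cmp (rVg deg) c (deg s).
have c'0 : lcomb g c' = 0.
  rewrite -(cmp_homog_map hgr) ?c0 ?(cmp0 dV) // => i y; exact: lcomb_homog.
have [a ac] : exists a : k, c' 0 s = a%:A.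
  by rewrite cmp_rVg subrr; exact: cmp0_const.
have a0 : a != 0.
  by apply: contra_notN nm => /eqP e; apply/mmP; move: ac; rewrite cmp_rVg subrr e scale0r.
have gs : g s = - (a^-1%:A : R) *: \sum_t c' 0 (lift s t) *: g (lift s t).
  apply/eqP; rewrite scaleNr -addr_eq0; apply/eqP.
  have := congr1 (fun v => (a^-1%:A : R) *: v) c'0.
  rewrite scaler0 lcombE (bigD1_ord s) //= scalerDr ac scaleAB mulVf //.
  by rewrite scale1r scale1r.
exists (\row_t (d 0 (lift s t) - d 0 s * (a^-1%:A : R) * c' 0 (lift s t))).
rewrite ?lcombE (bigD1_ord s) //= gs scalerA mulrN scaleNr scaler_sumr addrC -sumrB.
by apply: eq_bigr => t _; rewrite mxE scalerBl scalerA.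
Qed.

(** Minimality is obtained by counting: in a system with the fewest generators, a relation with a
    coefficient outside m would allow one of them to be dropped. *)
Lemma min_hgens (K : set V) : hsub K ->
  (exists s : seq V, (forall x, x \in s -> K x) /\ K `<=` lspan s) ->
  exists n deg g, @hgens K n deg g /\
    forall c, lcomb g c = 0 -> forall s, mm (c 0 s).
Proof.
move=> hK /(hgens_exist hK)[n0 [deg0 [g0 hg0]]].
have ex : exists n, `[< exists deg g, @hgens K n deg g >].
  by exists n0; apply/asboolP; exists deg0, g0.
case: (ex_minnP ex) => n /asboolP[deg [g hg]] minn; exists n, deg, g; split=> // c c0 s.
case: n deg g hg minn c c0 s => [|n] deg g hg minn c c0 s; first by case: s.
apply: contrapT => nm; have [deg' [g' hg']] := hgens_drop hK.1 hg c0 nm.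
have /minn : `[< exists deg g, @hgens K n deg g >].
  by apply/asboolP; exists deg', g'.
by rewrite ltnn.
Qed.

End OneModule.

Lemma lcomb_ker_hsub (V : lmodType R) (Vg : int -> set V) (hV : gmod Vg) n
    (deg : 'I_n -> int) (g : 'I_n -> V) : (forall s, Vg (deg s) (g s)) ->
  hsub (rVg deg) (lcomb g @^-1` [set 0]).
Proof.
move=> hg; split; first by apply: rsub_preim; exact: rsub_zero.
move=> x j x0; have e : lcomb g x = 0 by [].
rewrite /preimage /mkset -(cmp_homog_map hV (rVg_graded deg)).
  by rewrite e (cmp0 (gm_dsd hV)).
by move=> i y; exact: lcomb_homog.
Qed.

(* One stage of a resolution: the module gK still to be resolved. The stage
   after it consists of the relations between minimal generators of gK. *)
Record gsub := GSub {
  gn : nat;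
  gdeg : 'I_gn -> int;
  gK : set 'rV[R]_gn;
  gKP : hsub (rVg gdeg) gK }.

Definition gsub_step (a b : gsub) (g : 'I_(gn b) -> 'rV[R]_(gn a)) : Prop :=
  [/\ hgens (rVg (@gdeg a)) (@gK a) (@gdeg b) g,
      forall c, lcomb g c = 0 -> forall s, mm (c 0 s)
    & @gK b = lcomb g @^-1` [set 0]].

Lemma gsub_next (a : gsub) :
  exists bg : {b : gsub & 'I_(gn b) -> 'rV[R]_(gn a)}, gsub_step (projT2 bg).
Proof.
have [] := min_hgens (rVg_graded (@gdeg a)) (gKP a).
  by apply: noetherian_rV; [exact: noetherian_standard hR|exact: (gKP a).1].
move=> n [deg [g [hg ming]]].
have [hg1 _ _] := hg.
pose b := GSub (lcomb_ker_hsub (rVg_graded (@gdeg a)) hg1).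
by exists (existT _ b (g : 'I_(gn b) -> _)).
Qed.

Definition gnext (a : gsub) : gsub := projT1 (projT1 (cid (gsub_next a))).
Definition gmap (a : gsub) : 'I_(gn (gnext a)) -> 'rV[R]_(gn a) :=
  projT2 (projT1 (cid (gsub_next a))).

Lemma gmapP a : gsub_step (@gmap a).
Proof. exact: (projT2 (cid (gsub_next a))). Qed.

Variable a0 : gsub.

(** The complex [mF] resolves the quotient of its degree 0 module by the submodule [gK a0]. It is
    used twice, with a0 the relations of M and with a0 the maximal ideal in R. *)
Definition mst (i : nat) : gsub := iter i gnext a0.
Definition mF (i : nat) : lmodType R := 'rV[R]_(gn (mst i)).
Definition mdeg (i : nat) : 'I_(gn (mst i)) -> int := @gdeg (mst i).
Definition mFg (i : nat) : int -> set (mF i) := rVg (@mdeg i).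
Definition mD (i : nat) : {linear mF i.+1 -> mF i} := lcomb (@gmap (mst i)).

Lemma mFg_graded i : gmod (@mFg i). Proof. exact: rVg_graded. Qed.

Lemma mD_homog i j x : mFg (i := i.+1) j x -> mFg (i := i) j (mD i x).
Proof.
have [[hg _ _] _ _] := gmapP (mst i).
by apply: lcomb_homog => //; exact: rVg_graded.
Qed.

Lemma mD_im i x : @gK (mst i) x <-> exists y, mD i y = x.
Proof.
have [[_ hg h] _ _] := gmapP (mst i); split; first by move=> /h[c ->]; exists c.
case=> y <-; apply: linear_rV_in => [|s]; first exact: (gKP (mst i)).1.
by rewrite lcomb_delta.
Qed.

Lemma mD_exact i x : mD i x = 0 <-> exists y, mD i.+1 y = x.
Proof. by rewrite -mD_im; have [_ _] := gmapP (mst i) => /= ->. Qed.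

Lemma mD_comp i x : mD i (mD i.+1 x) = 0.
Proof. by apply/mD_exact; exists x. Qed.

Lemma mD_ker_min i x : mD i x = 0 -> set_scale mm x.
Proof.
by have [_ h _] := gmapP (mst i) => /h hx; apply/(mm_set_scale_rV hR).
Qed.

Lemma mD_min i x : set_scale mm (mD i.+1 x).
Proof. by apply: (@mD_ker_min i); exact: mD_comp. Qed.

End GradedFree.

(** * Comparison of resolutions *)

Section SubModules.
Variables (R : nzRingType) (V : lmodType R) (A : set V).
Hypothesis rA : GRing.submod_closed [pred x | `[< A x >]].

Definition sub_pred of GRing.submod_closed [pred x | `[< A x >]] : {pred V} :=
  [pred x | `[< A x >]].

HB.instance Definition _ := GRing.isSubmodClosed.Build R V (sub_pred rA) rA.

Record submod := SubMod { submod_val : V; _ : submod_val \in sub_pred rA }.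

HB.instance Definition _ := [isSub for submod_val].
HB.instance Definition _ := [Choice of submod by <:].
HB.instance Definition _ := [SubChoice_isSubLmodule of submod by <:].

End SubModules.

(** [projective] lifts only through surjections, so both maps are corestricted to the range of f;
    this is what the submodule type [submod] is for. *)
Lemma proj_lift (R : comNzRingType) (P A B : lmodType R) (f : {linear A -> B})
    (g : {linear P -> B}) : projective P -> (forall x, exists y, f y = g x) ->
  exists h : {linear P -> A}, forall x, f (h x) = g x.
Proof.
move=> projP fg.
pose S : set B := range f.
have rS : GRing.submod_closed [pred x | `[< S x >]].
  split; first by apply/asboolP; exists 0; rewrite ?linear0.
  move=> a x y /asboolP[u _ <-] /asboolP[v _ <-]; apply/asboolP.
  by exists (a *: u + v) => //; rewrite linearP.
have gS x : g x \in sub_pred rS by apply/asboolP; have [y <-] := fg x; exists y.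
have fS x : f x \in sub_pred rS by apply/asboolP; exists x.
have lf : linear (fun x => SubMod (fS x)) by move=> a x y; apply: val_inj; rewrite /= linearP.
have lg : linear (fun x => SubMod (gS x)) by move=> a x y; apply: val_inj; rewrite /= linearP.
have [|h hh] := projP _ _ (mklin lf) (mklin lg).
  move=> [b bS]; have /asboolP[a _ ab] := bS.
  by exists a; apply: val_inj.
by exists h => x; have := congr1 val (hh x).
Qed.

Lemma dep_choice (T : nat -> Type) (Q : forall i, T i -> Prop)
    (L : forall i, T i -> T i.+1 -> Prop) :
  (exists a, Q 0%N a) -> (forall i a, Q i a -> exists b, Q i.+1 b /\ L i a b) ->
  exists f : forall i, T i, forall i, Q i (f i) /\ L i (f i) (f i.+1).
Proof.
move=> /cid[a Qa] step.
pose F := nat_rect (fun i => {a : T i | Q i a}) (exist _ a Qa)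
  (fun i p => let s := cid (step i _ (svalP p)) in exist _ (sval s) (proj1 (svalP s))).
exists (fun i => sval (F i)) => i; split; first exact: (svalP (F i)).
exact: (proj2 (svalP (cid (step i _ (svalP (F i)))))).
Qed.

Section Comparison.
Variable R : comNzRingType.
Variables (C E : nat -> lmodType R) (M : lmodType R).
Variables (dC : forall i, {linear C i.+1 -> C i}) (dE : forall i, {linear E i.+1 -> E i}).
Hypothesis CC : forall i x, dC i (dC i.+1 x) = 0.

(** The predicate H records extra information on the maps, such as degrees. The single lift is left
    to the caller, who uses projectivity for arbitrary resolutions and homogeneous lifts of a basis
    for graded ones. *)
Lemma comparison (eC : {linear C 0%N -> M}) (eE : {linear E 0%N -> M})
    (H : forall i, {linear C i -> E i} -> Prop) :
  (forall x, eC (dC 0%N x) = 0) ->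
  (forall x, eE x = 0 -> exists y, dE 0%N y = x) ->
  (forall i x, dE i x = 0 -> exists y, dE i.+1 y = x) ->
  (exists a, H 0%N a /\ forall x, eE (a x) = eC x) ->
  (forall i a, H i a -> (forall x, exists y, dE i y = a (dC i x)) ->
     exists b, H i.+1 b /\ forall x, dE i (b x) = a (dC i x)) ->
  exists f : forall i, {linear C i -> E i},
    [/\ forall i, H i (f i), forall x, eE (f 0%N x) = eC x &
        forall i x, dE i (f i.+1 x) = f i (dC i x)].
Proof.
move=> eC0 ex0 exE [a [Ha ea]] step.
(* The solvability of the next lift is part of the invariant; the augmentation constrains the map in
   degree 0 only. *)
pose Q i (f : {linear C i -> E i}) := [/\ H i f, forall x, exists y, dE i y = f (dC i x)
  & match i return {linear C i -> E i} -> Prop with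
    | 0 => fun f => forall x, eE (f x) = eC x | _ => fun _ => True end f].
pose L i (f : {linear C i -> E i}) (g : {linear C i.+1 -> E i.+1}) :=
  forall x, dE i (g x) = f (dC i x).
have [||f hf] := @dep_choice (fun i => {linear C i -> E i}) Q L.
- exists a; split=> // x; apply: ex0; by rewrite ea eC0.
- move=> i f [Hf ff _]; have [g [Hg hg]] := step i f Hf ff.
  exists g; split=> //; split=> // x; apply: exE.
  by rewrite hg CC linear0.
exists f; split=> [i||i]; first by have [[]] := hf i.
  by have [[]] := hf 0%N.
by have [_] := hf i.
Qed.

(** A chain map that is zero on the cokernel of [dE 0] is null-homotopic. It is applied to the
    difference of two lifts of the identity of M, and to multiplication by an element of m on the
    resolution of R / m. *)
Lemma homotopy (f : forall i, {linear C i -> E i}) :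
  (forall i, projective (C i)) ->
  (forall i x, dE i x = 0 -> exists y, dE i.+1 y = x) ->
  (forall x, exists y, dE 0%N y = f 0%N x) ->
  (forall i x, dE i (f i.+1 x) = f i (dC i x)) ->
  exists h : forall i, {linear C i -> E i.+1},
    (forall x, f 0%N x = dE 0%N (h 0%N x)) /\
    (forall i x, f i.+1 x = dE i.+1 (h i.+1 x) + h i (dC i x)).
Proof.
move=> pC exE f0 fc.
pose Q i (h : {linear C i -> E i.+1}) :=
  (forall x, dE i (f i.+1 x - h (dC i x)) = 0) /\
  match i return {linear C i -> E i.+1} -> Prop with
    | 0 => fun h => forall x, dE 0%N (h x) = f 0%N x | _ => fun _ => True end h.
pose L i (h : {linear C i -> E i.+1}) (g : {linear C i.+1 -> E i.+2}) :=
  forall x, f i.+1 x = dE i.+1 (g x) + h (dC i x).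
have [||h hh] := @dep_choice (fun i => {linear C i -> E i.+1}) Q L.
- have [h hh] := proj_lift (f := dE 0%N) (g := f 0%N) (pC 0%N) f0.
  by exists h; split=> // x; rewrite linearB hh fc subrr.
- move=> i h [hh _].
  have lg : linear (fun x => f i.+1 x - h (dC i x)).
    by move=> a x y; rewrite linearP (linearP (dC i)) (linearP h) opprD scalerBr addrACA.
  have [|g gg] := proj_lift (f := dE i.+1) (g := mklin lg) (pC i.+1).
    by move=> x; apply: exE; exact: hh.
  have ggE x : dE i.+1 (g x) = f i.+1 x - h (dC i x) by exact: gg.
  exists g; split; last by move=> x; rewrite ggE subrK.
  by split=> // x; rewrite linearB fc ggE CC linear0 subr0 subrr.
exists h; split=> [x|i x]; first by have [[_ ->]] := hh 0%N.
by have [_] := hh i; apply.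
Qed.

End Comparison.

(** * The minimal resolution of M and its Betti numbers *)

Section MinimalResolution.
Variables (k : fieldType) (R : comAlgType k) (Rg : nat -> set R).
Hypothesis hR : standard_graded Rg.
Variables (M : lmodType R) (Mg : int -> set M).
Hypothesis hM : graded_module Rg Mg.
Variables (n0 : nat) (deg0 : 'I_n0 -> int) (g0 : 'I_n0 -> M).
Hypothesis hg0 : hgens Mg setT deg0 g0.
Hypothesis ming0 : forall c, lcomb g0 c = 0 -> forall s, irrelevant_ideal Rg (c 0 s).
Local Notation Rz := (zgrade Rg).
Local Notation mm := (irrelevant_ideal Rg).

Lemma g0_homog s : Mg (deg0 s) (g0 s). Proof. by case: hg0. Qed.

Definition syz0 : gsub Rg := GSub (lcomb_ker_hsub hR hM g0_homog).

Local Notation F := (mF hR syz0).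
Local Notation d := (mD hR syz0).
Local Notation fdeg i := (@mdeg _ _ _ hR syz0 i).
Local Notation Fg i := (@mFg _ _ _ hR syz0 i).

Definition aug : {linear F 0%N -> M} := lcomb g0.

Lemma aug_surj m : exists x, aug x = m.
Proof. by case: hg0 => _ _ /(_ m I)[c ->]; exists c. Qed.

Lemma aug_exact x : aug x = 0 <-> exists y, d 0%N y = x.
Proof. by rewrite -mD_im. Qed.

Lemma aug_homog j x : Fg 0%N j x -> Mg j (aug x).
Proof. by apply: lcomb_homog => //; exact: g0_homog. Qed.

Lemma d_min i x : set_scale mm (d i x).
Proof.
case: i x => [|i] x; last exact: mD_min.
by apply/(mm_set_scale_rV hR); apply: ming0; apply/aug_exact; exists x.
Qed.

Definition min_res : projective_resolution M :=
  @ProjectiveResolution R M F d aug (fun i => @projective_rV R _) aug_surj aug_exact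
    (@mD_exact _ _ _ hR syz0).

Definition min_gres : graded_resolution Rg Mg :=
  @GradedResolution k R Rg M Mg min_res (fun i => Fg i) (mFg_graded hR syz0) aug_homog
    (fun i j x => @mD_homog _ _ _ hR syz0 i j x).

Lemma linear_eq_basis n (V : lmodType R) (f g : {linear 'rV[R]_n -> V}) :
  (forall s, f (delta_mx 0 s) = g (delta_mx 0 s)) -> forall x, f x = g x.
Proof.
by move=> fg x; rewrite linear_lcomb [RHS]linear_lcomb; apply: eq_bigr => s _; rewrite fg.
Qed.

Lemma resD0 (P : projective_resolution M) x : res_aug P (res_diff P 0%N x) = 0.
Proof. by apply/res_exact0; exists x. Qed.

Lemma resDD (P : projective_resolution M) i x : res_diff P i (res_diff P i.+1 x) = 0.
Proof. by apply/res_exact; exists x. Qed.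

Lemma res_comparison (P Q : projective_resolution M) : exists f : forall i, {linear P i -> Q i},
  (forall x, res_aug Q (f 0%N x) = res_aug P x) /\
  forall i x, res_diff Q i (f i.+1 x) = f i (res_diff P i x).
Proof.
have [||||i a _ ha|f [_ f0 fS]] := @comparison R P Q M (res_diff P) (res_diff Q)
  (@resDD P) (res_aug P) (res_aug Q) (fun _ _ => True); last by exists f.
- exact: resD0.
- by move=> x /res_exact0.
- by move=> i x /res_exact.
- have [|a ha] := proj_lift (f := res_aug Q) (g := res_aug P) (@res_projective _ _ P 0%N).
    by move=> x; exact: res_aug_surj.
  by exists a.
have [|b hb] := proj_lift (f := res_diff Q i) (g := a \o res_diff P i)
    (@res_projective _ _ P i.+1); first exact: ha.
by exists b.
Qed.

(* Both composites lift the identity of M, so they agree up to homotopy, and the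
   homotopy terms vanish modulo mm because the resolution F is minimal. *)
Lemma min_retract (P : projective_resolution M) (a : forall i, {linear F i -> P i}) :
  (forall x, res_aug P (a 0%N x) = aug x) ->
  (forall i x, res_diff P i (a i.+1 x) = a i (d i x)) ->
  exists b : forall i, {linear P i -> F i},
    (forall i x, d i (b i.+1 x) = b i (res_diff P i x)) /\
    forall i x, set_scale mm (b i (a i x) - x).
Proof.
move=> a0 aS; have [b [b0 bS]] := res_comparison P min_res.
exists b; split; first exact: bS.
pose f i : {linear F i -> F i} := (b i \o a i) \- idfun.
have [||||h [h0 hS]] := @homotopy R F F d d (@mD_comp _ _ _ hR syz0) f.
- by move=> i; exact: projective_rV.
- by move=> i x /mD_exact.
- move=> x; apply/aug_exact; have -> : f 0%N x = b 0%N (a 0%N x) - x by [].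
  have e : aug (b 0%N (a 0%N x)) = aug x by rewrite -[RHS]a0 -b0.
  by rewrite linearB e subrr.
- move=> i x; have -> : f i.+1 x = b i.+1 (a i.+1 x) - x by [].
  have e : d i (b i.+1 (a i.+1 x)) = b i (a i (d i x)) by rewrite -aS -bS.
  by rewrite linearB e.
have fE i x : b i (a i x) - x = f i x by [].
move=> i x; rewrite fE; case: i x => [|i] x; first by rewrite h0; exact: d_min.
rewrite hS; apply: rsubD; first exact: set_scale_sub.
  exact: d_min.
by apply: set_scale_linear; exact: d_min.
Qed.

Lemma basis_not_mm n (s : 'I_n) : ~ set_scale mm (delta_mx 0 s : 'rV[R]_n).
Proof. by move/(mm_set_scale_rV hR)/(_ s); rewrite mxE !eqxx; exact: mm1. Qed.

(** The identity of F_i factors through P_i modulo m. Where P_i = 0 a basis vector would lie in m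
    F_i. *)
Lemma min_res_length (P : projective_resolution M) p :
  (forall i, (p < i)%N -> forall x : P i, x = 0) ->
  forall i, (p < i)%N -> gn (mst hR syz0 i) = 0%N.
Proof.
move=> P0 i pi; have [a [a0 aS]] := res_comparison min_res P.
have [b [_ hb]] := min_retract a0 aS.
apply/eqP; rewrite -leqn0 leqNgt; apply/negP => n_gt0.
apply: (@basis_not_mm _ (Ordinal n_gt0)).
have := hb i (delta_mx 0 (Ordinal n_gt0)).
rewrite (P0 i pi (a i _)) linear0 sub0r => h.
by rewrite -[delta_mx _ _]opprK; apply: rsubN => //; exact: set_scale_sub.
Qed.

(** Any lift of a homogeneous element may be replaced by its component in the right degree, because
    the differentials and the augmentation preserve degrees. P need not be free. *)
Lemma graded_comparison (P : graded_resolution Rg Mg) :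
  exists a : forall i, {linear F i -> P i},
    [/\ forall i s, @gres_grading _ _ _ _ _ P i (fdeg i s) (a i (delta_mx 0 s)),
        forall x, res_aug P (a 0%N x) = aug x &
        forall i x, res_diff P i (a i.+1 x) = a i (d i x)].
Proof.
have gP i := @gres_graded _ _ _ _ _ P i.
apply: (@comparison R F P M d (res_diff P) (@mD_comp _ _ _ hR syz0) aug (res_aug P)
  (fun i a => forall s : 'I_(gn (mst hR syz0 i)),
     @gres_grading _ _ _ _ _ P i (fdeg i s) (a (delta_mx 0 s)))).
- by move=> x; apply/aug_exact; exists x.
- by move=> x /res_exact0.
- by move=> i x /res_exact.
- have [|h hh] := @rV_lift R n0 (P 0%N) M
      (fun s v w => @gres_grading _ _ _ _ _ P 0%N (deg0 s) v /\ res_aug P v = w) aug.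
    move=> s; have [v vs] := @res_aug_surj _ _ P (aug (delta_mx 0 s)).
    exists (cmp (@gres_grading _ _ _ _ _ P 0%N) v (deg0 s)); split.
      exact: (cmp_mem (gm_dsd (gP 0%N))).
    rewrite -(cmp_homog_map hM (gP 0%N)); last by move=> j x; exact: gres_aug_deg.
    by rewrite vs (cmp_id (gm_dsd hM)) // lcomb_delta; exact: g0_homog.
  exists h; split=> [s|x]; first by have [] := hh s.
  by apply: (linear_eq_basis (f := res_aug P \o h)) => s; have [] := hh s.
move=> i a ha ex.
have [|h hh] := @rV_lift R _ (P i.+1) (P i)
    (fun s v w => @gres_grading _ _ _ _ _ P i.+1 (fdeg i.+1 s) v /\
                  res_diff P i v = w) (a \o d i).
  move=> s; have [v vs] := ex (delta_mx 0 s).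
  exists (cmp (@gres_grading _ _ _ _ _ P i.+1) v (fdeg i.+1 s)); split.
    exact: (cmp_mem (gm_dsd (gP i.+1))).
  rewrite -(cmp_homog_map (gP i) (gP i.+1)); last by move=> j x; exact: gres_diff_deg.
  rewrite vs (cmp_id (gm_dsd (gP i))) // linear_lcomb.
  apply: (lcomb_homog (gP i)) => //; apply: mD_homog => t.
  rewrite mxE eqxx /=; case: eqP => [->|_]; last exact: (dsd_add0 (Rz_dsd hR)).
  by rewrite subrr /=; have := Rg_const hR 1; rewrite scale1r.
exists h; split=> [s|x]; first by have [] := hh s.
by apply: (linear_eq_basis (f := res_diff P i \o h) (g := a \o d i)) => s; have [] := hh s.
Qed.

Lemma delta_homog i s : Fg i (fdeg i s) (delta_mx 0 s).
Proof.
move=> t; rewrite mxE eqxx /=; case: eqP => [->|_]; last exact: (dsd_add0 (Rz_dsd hR)).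
by rewrite subrr /=; have := Rg_const hR 1; rewrite scale1r.
Qed.

(** By minimality every element of degree j is a cycle modulo m and boundaries are the elements of m
    F_i, so the basis vectors of degree j represent a basis. This shows that [betti] is not the
    default value of [xget]. *)
Lemma min_quotient_dim i j : exists b,
  quotient_dim (@tor_cycles _ _ _ _ _ min_gres i j) (@tor_boundaries _ _ _ _ _ min_gres i j) b.
Proof.
pose S := [set s | fdeg i s == j].
have dR := Rz_dsd hR.
exists #|S|, (fun t => delta_mx 0 (enum_val t)); split.
  move=> t; have : enum_val t \in S by exact: enum_valP.
  rewrite inE => /eqP ft.
  have h : Fg i j (delta_mx 0 (enum_val t)) by rewrite -ft; exact: delta_homog.
  case: i S t ft h => [|i] S t ft h; first exact: h.
  by split=> //; exact: d_min.
move=> z Zz; have Fz : Fg i j z by case: i S z Zz => [|i] S z; [|case].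
have ez t : exists c : k, z 0 (enum_val (t : 'I_#|S|)) = c%:A.
  have : enum_val t \in S by exact: enum_valP.
  rewrite inE => /eqP ft; apply: (Rg_constP hR).
  by have := Fz (enum_val t); rewrite ft subrr.
have /choice[c hc] := ez.
have entry (c' : 'rV[k]_#|S|) s :
    (z - \sum_t ((c' 0 t)%:A : R) *: (delta_mx 0 (enum_val t) : F i)) 0 s =
    z 0 s - \sum_(t | enum_val t == s) (c' 0 t)%:A.
  rewrite !mxE summxE; congr (_ - _); rewrite [RHS]big_mkcond; apply: eq_bigr => t _.
  by rewrite !mxE eqxx eq_sym; case: eqP => _; rewrite ?mulr1 ?mulr0.
have entry_in (c' : 'rV[k]_#|S|) t :
    (z - \sum_t ((c' 0 t)%:A : R) *: (delta_mx 0 (enum_val t) : F i)) 0 (enum_val t) =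
    (c t - c' 0 t)%:A.
  rewrite entry hc scalerBl; congr (_ - _).
  rewrite (eq_bigl (pred1 t)) ?big_pred1_eq // => u.
  by rewrite (inj_eq enum_val_inj).
exists (\row_t c t); split.
  split.
    apply: (dsd_addB (gm_dsd (mFg_graded hR syz0 i))) => //.
    elim/big_rec: _ => [|t y _ Fy]; first exact: (dsd_add0 (gm_dsd (mFg_graded hR syz0 i))).
    apply: (dsd_addD (gm_dsd (mFg_graded hR syz0 i))) => //.
    rewrite -[j]add0r; apply: (gm_scale (mFg_graded hR syz0 i)); first exact: (Rg_const hR).
    have : enum_val t \in S by exact: enum_valP.
    by rewrite inE => /eqP <-; exact: delta_homog.
  exists 0; rewrite linear0 subr0; apply/(mm_set_scale_rV hR) => s.
  case: (boolP (s \in S)) => sS.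
    have -> : s = enum_val (enum_rank_in sS s) by rewrite enum_rankK_in.
    by rewrite entry_in mxE subrr scale0r; exact: (rsub0 (mm_sub hR)).
  rewrite entry big_pred0 ?subr0; last first.
    move=> t; apply/negP => /eqP ts; move: sS; rewrite -ts; apply/negP/negPn.
    exact: enum_valP.
  apply/(mmP hR); apply: (cmp_ne dR (Fz s)).
  by apply: contraNN sS; rewrite inE eq_sym subr_eq0 eq_sym.
move=> c' [_ [y hy]]; apply/rowP => t; rewrite mxE.
have : set_scale mm (z - \sum_t ((c' 0 t)%:A : R) *: (delta_mx 0 (enum_val t) : F i)).
  rewrite -(subrK (d i y) (z - _)); apply: rsubD => //; first exact: set_scale_sub.
  exact: d_min.
move=> /(mm_set_scale_rV hR)/(_ (enum_val t)); rewrite entry_in => /(const_mm hR)/eqP.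
by rewrite subr_eq0 => /eqP.
Qed.

Lemma comparison_cycle (P : graded_resolution Rg Mg) (a : forall i, {linear F i -> P i}) :
  (forall i s, @gres_grading _ _ _ _ _ P i (fdeg i s) (a i (delta_mx 0 s))) ->
  (forall i x, res_diff P i (a i.+1 x) = a i (d i x)) ->
  forall i s, @tor_cycles _ _ _ _ _ P i (fdeg i s) (a i (delta_mx 0 s)).
Proof.
move=> ag aS [|i] s; first exact: (ag 0%N).
split; first exact: (ag i.+1).
by rewrite /= aS; apply: set_scale_linear; exact: d_min.
Qed.

(** The value comes from an unknown resolution P. Were it 0, the image in P of a basis vector of F
    would be a boundary modulo m; mapping back to F by [min_retract] would put the basis vector in m
    F_i. *)
Lemma betti_neq0 i s : betti Rg Mg i (fdeg i s) != 0%N.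
Proof.
set j := fdeg i s; rewrite /betti; set B := (X in xget _ X).
have [b hb] := min_quotient_dim i j.
have : B (xget 0%N B) by apply: (@xgetI _ 0%N B b); exists min_gres.
case: (xget 0%N B) => // -[P [e [_ hP]]].
have [a [ag a0 aS]] := graded_comparison P.
have [b' [b'S hb']] := min_retract a0 aS.
have Z := comparison_cycle ag aS s.
have [c [[_ [y hy]] _]] := hP _ Z.
rewrite big_ord0 subr0 in hy; exfalso; apply: (@basis_not_mm _ s).
rewrite -[delta_mx 0 s](subKr (b' i (a i (delta_mx 0 s)))).
apply: rsubB; [exact: set_scale_sub| |exact: hb'].
rewrite -(subrK (b' i (res_diff P i y)) (b' i (a i _))) -linearB.
apply: rsubD; [exact: set_scale_sub|exact: set_scale_linear|].
by rewrite -b'S; exact: d_min.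
Qed.

Lemma pure_deg : pure_module Rg Mg -> forall i s t, fdeg i s = fdeg i t.
Proof. by move=> pM i s t; apply: (pM i); exact: betti_neq0. Qed.

End MinimalResolution.

(** * Regular elements and depth *)

Lemma noetherian_max (R : comNzRingType) (V : lmodType R) (F : set (set V)) (A0 : set V) :
  noetherian V -> (forall A, F A -> rsub A) -> F A0 ->
  exists A, [/\ F A, A0 `<=` A & forall B, F B -> A `<=` B -> B `<=` A].
Proof.
move=> nV FS FA0; apply: contrapT => nmax.
pose Q (i : nat) (A : set V) := F A /\ A0 `<=` A.
pose L (i : nat) (A B : set V) := A `<=` B /\ ~ B `<=` A.
have [||f hf] := @dep_choice (fun _ => set V) Q L; first by exists A0; split.
  move=> i A [FA A0A]; apply: contrapT => nB; apply: nmax; exists A; split=> // B FB AB.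
  apply: contrapT => nBA; apply: nB; exists B; split=> //.
  by split=> //; exact: subset_trans AB.
have fle i j : (i <= j)%N -> f i `<=` f j.
  move=> ij; rewrite -(subnK ij); elim: (j - i)%N => // m IH.
  by apply: subset_trans IH _; rewrite addSn; have [_ []] := hf (m + i)%N.
have rf i : rsub (f i) by apply: FS; have [[]] := hf i.
have rU : rsub [set x | exists i, f i x].
  split; first by exists 0%N; exact: (rsub0 (rf _)).
  move=> a x y [i fx] [j fy]; exists (maxn i j).
  by case: (rf (maxn i j)) => _; apply; [apply: fle fx|apply: fle fy]; rewrite ?leq_maxl ?leq_maxr.
have [s [sU Us]] := nV _ rU.
have [N sN] : exists N, forall x, x \in s -> f N x.
  elim: s {Us} sU => [|y s IH] h; first by exists 0%N.
  have [|N hN] := IH; first by move=> x xs; apply: h; rewrite inE xs orbT.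
  have [|n hn] := h y; first by rewrite inE eqxx.
  exists (maxn n N) => x; rewrite inE => /orP[/eqP ->|/hN].
    by apply: fle hn; exact: leq_maxl.
  by apply: fle; exact: leq_maxr.
have [_ [_]] := hf N; apply => x fx.
by apply: (lspan_le (rf N) sN); apply: Us; exists N.+1.
Qed.

(** * Regular linear forms over an infinite field *)

Section RegularForms.
Variables (k : fieldType) (R : comAlgType k) (Rg : nat -> set R).
Hypothesis hR : standard_graded Rg.
Local Notation mm := (irrelevant_ideal Rg).
Local Notation RR := (R^o : lmodType R).

Lemma gen_span_le xs (A B : set RR) : rsub B -> (forall x, x \in xs -> B x) ->
  gen_span xs A `<=` B.
Proof.
move=> rB; elim: xs => [|x xs IH] h y /=; first by move=> ->; exact: (rsub0 rB).
case=> a _ hy; rewrite -(subrK (x *: a) y); apply: (rsubD rB).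
  by apply: IH hy => z zs; apply: h; rewrite inE zs orbT.
rewrite [x *: a]mulrC; apply: (rsubZ a rB); apply: h; exact: mem_head.
Qed.

Lemma mm_gen (A : set RR) : rsub A -> Rg 1 `<=` A -> mm `<=` A.
Proof.
move=> rA R1A a [s [hs ->]]; apply: (rsub_sum_seq (V := RR)) => // b /hs[[//|i] _ Rb].
have [xs [xs1 hxs]] := gens_exist hR.
apply: (gen_span_le (xs := xs) (A := mon_span Rg xs i)) => //.
  by move=> x /xs1; exact: R1A.
exact: (hxs i.+1).
Qed.

Hypothesis k_inf : infinite_set [set: k].

Lemma fresh_scalar (s : seq k) : exists c, c \notin s.
Proof.
apply: contrapT => H; apply: k_inf; apply: (sub_finite_set _ (finite_seq s)) => c _ /=.
by apply: contra_notT H => cs; exists c.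
Qed.

(** Given v outside the subspaces in L but inside B, and w outside B, the elements v + c w with c
    nonzero avoid B. Each other subspace contains at most one of them, since two would put w, and
    then v, into it. *)
Lemma linear_avoid (L : seq (set RR)) : (forall A, List.In A L -> ksub A) ->
  (forall A, List.In A L -> ~ Rg 1 `<=` A) ->
  exists a, Rg 1 a /\ forall A, List.In A L -> ~ A a.
Proof.
have dR := Rg_dsd hR.
elim: L => [|B L IH] kL nL; first by exists 0; split=> //; exact: (dsd_add0 dR).
have [|A hA|v [v1 hv]] := IH; first by move=> A hA; apply: kL; right.
  by apply: nL; right.
have kB : ksub B by apply: kL; left.
have [w [w1 nw]] : exists w, Rg 1 w /\ ~ B w.
  have := nL B (or_introl erefl); apply: contra_notP => H w w1.
  by apply: contra_notP H => nw; exists w.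
case: (pselect (B v)) => [Bv|nBv]; last first.
  by exists v; split=> // A [<-|/hv].
have [bad hbad] : exists bad : seq k, forall c, c \notin bad ->
    forall A, List.In A L -> ~ A (v + (c%:A : R) *: (w : RR)).
  elim: L {IH nL} kL hv => [|A L IH] kL hv; first by exists [::].
  have [||bad hbad] := IH.
  - by move=> C [<-|hC]; apply: kL; [left|right; right].
  - by move=> C hC; apply: hv; right.
  have kA : ksub A by apply: kL; right; left.
  have nAv : ~ A v by apply: hv; left.
  case: (pselect (exists c, A (v + (c%:A : R) *: (w : RR)))) => [[c0 Ac0]|nc]; last first.
    by exists bad => c hc C [<- hA|/(hbad c hc) //]; apply: nc; exists c.
  exists (c0 :: bad) => c; rewrite inE negb_or => /andP[cc0 /hbad hc] C [<-|/hc //] Ac.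
  have Aw : A w.
    apply: (ksub_inv kA (c := c - c0)); last by rewrite subr_eq0.
    have := ksubB kA Ac Ac0; rewrite opprD addrACA subrr add0r -scalerBl.
    by rewrite -scalerBl.
  apply: nAv; rewrite -(addrK ((c%:A : R) *: (w : RR)) v).
  by apply: (ksubB kA) => //; exact: ksubZ.
have [c] := fresh_scalar (0 :: bad); rewrite inE negb_or => /andP[c0 /hbad hc].
exists (v + c%:A * w); split.
  apply: (dsd_addD dR) => //; exact: (RgM hR (i := 0) (Rg_const hR c) w1).
move=> A [<-|/hc //] Bvw; apply: nw; apply: (ksub_inv kB _ c0).
by have := ksubB kB Bvw Bv; rewrite addrAC subrr add0r.
Qed.

(* The zero divisors modulo N form the union of the finitely many maximal
   annihilators of elements outside N, none of which contains R_1. *)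
Lemma linear_regular (N : set RR) : rsub N ->
  (forall z, (forall a, mm a -> N (a * z)) -> N z) ->
  exists a, Rg 1 a /\ forall y, N (a * y) -> N y.
Proof.
move=> rN soc; have nR := noetherian_standard hR.
pose ann (z : RR) : set RR := [set a | N (a * z)].
have rann z : rsub (ann z).
  split; first by rewrite /ann /= mul0r; exact: (rsub0 rN).
  move=> a x y; rewrite /ann /= => Nx Ny; rewrite mulrDl -mulrA.
  by case: rN => _; apply.
pose F : set (set RR) := [set A | exists2 z, ~ N z & A = ann z].
pose Z : set RR := [set z | ~ N z /\ forall z', ~ N z' -> ann z `<=` ann z' -> ann z' `<=` ann z].
have Zmax z : ~ N z -> exists z', Z z' /\ ann z `<=` ann z'.
  move=> nz; have [||A [[z' nz' ->] zz' mz']] := @noetherian_max R RR F (ann z) nR.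
  - by move=> A [y _ ->].
  - by exists z.
  - exists z'; split=> //; split=> // y ny; apply: mz'; by exists y.
(* If b z is outside N, its annihilator contains that of z, so by maximality the two agree. *)
have Zprime z a b : Z z -> ann z (a * b) -> ann z a \/ ann z b.
  case=> nz mz hab; case: (pselect (ann z b)) => hb; [by right|left].
  apply: (mz (b * z) hb); last by rewrite /ann /= mulrA.
  by move=> c; rewrite /ann /= => Nc; rewrite mulrCA; have := rsubZ b rN Nc.
have rT : rsub [set x : RR | exists s : seq RR, (forall z, z \in s -> Z z) /\ lspan s x].
  split; first by exists [::].
  move=> a x y [s [sZ sx]] [t [tZ ty]]; exists (s ++ t); split.
    by move=> z; rewrite mem_cat => /orP[/sZ|/tZ].
  have [_] := lspan_sub (s ++ t); apply.
    by apply: lspan_incl sx => z zs; rewrite mem_cat zs.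
  by apply: lspan_incl ty => z zs; rewrite mem_cat zs orbT.
(* Finite generation of the span of Z yields finitely many elements of Z that span it; their
   annihilators are the finitely many to be avoided. *)
have [t [tT Tt]] := nR _ rT.
have [s [sZ sT]] : exists s : seq RR, (forall z, z \in s -> Z z) /\ forall z, Z z -> lspan s z.
  suff [s [sZ st]] : exists s : seq RR, (forall z, z \in s -> Z z) /\
      forall x, x \in t -> lspan s x.
    exists s; split=> // z Zz; apply: (lspan_le (lspan_sub s) st).
    apply: Tt; exists [:: z]; split; first by move=> y; rewrite inE => /eqP ->.
    by apply: lspan_mem; rewrite inE.
  elim: t {Tt} tT => [|x t IH] tT; first by exists [::].
  have [|s [sZ st]] := IH; first by move=> y yt; apply: tT; rewrite inE yt orbT.
  have [|s' [sZ' sx]] := tT x; first exact: mem_head.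
  exists (s' ++ s); split; first by move=> z; rewrite mem_cat => /orP[/sZ'|/sZ].
  move=> y; rewrite inE => /orP[/eqP ->|/st].
    by apply: lspan_incl sx => z zs; rewrite mem_cat zs.
  by apply: lspan_incl => z zs; rewrite mem_cat zs orbT.
(* Otherwise every z' in s has an element of its annihilator outside [ann z]; by primality their
   product is outside [ann z] too, yet it kills the span of s, which contains z, modulo N. *)
have cover z : Z z -> exists2 z', z' \in s & ann z `<=` ann z'.
  move=> Zz; apply: contrapT => H.
  have hb : forall r : seq RR, {subset r <= s} -> exists b,
      ~ ann z b /\ forall z', z' \in r -> ann z' b.
    elim=> [|y r IH] rs.
      by exists 1; split=> //; rewrite /ann /= mul1r; case: Zz.
    have [|b [nb hb]] := IH; first by move=> x xr; apply: rs; rewrite inE xr orbT.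
    have ys : y \in s by apply: rs; exact: mem_head.
    have [c [yc nc]] : exists c, ann y c /\ ~ ann z c.
      apply: contrapT => nc; apply: H; exists y => //.
      have [ny my] := sZ y ys; apply: my; first by case: Zz.
      by move=> c yc; apply: contrapT => zc; apply: nc; exists c.
    exists (c * b); split; first by case/(Zprime z c b Zz).
    move=> x; rewrite inE => /orP[/eqP ->|/hb xb]; last exact: (rsubZ c (rann x) xb).
    by rewrite mulrC; exact: (rsubZ b (rann y) yc).
  have [//|b [nb hb']] := hb s.
  apply: nb; have := sT z Zz; apply: (@lspan_le _ _ s [set x | N (b * x)]).
    split; first by rewrite /= mulr0; exact: (rsub0 rN).
    move=> a x y /= Nx Ny; rewrite mulrDr [b * _]mulrCA; by case: rN => _; apply.
  by move=> x /hb'.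
have [||a [a1 ha]] := @linear_avoid (map ann s).
- by move=> A /List.in_map_iff[z [<- _]]; apply: rsub_ksub.
(* A linear form exists outside each annihilator: R_1 generates m, and an element killed by m modulo
   N is in N by [soc]. *)
- move=> A /List.in_map_iff[z [<- zs]] R1A.
  have zs' : z \in s.
    elim: s zs {sZ sT cover} => //= y s IH [->|/IH]; rewrite inE ?eqxx // => ->.
    by rewrite orbT.
  have [nz _] := sZ z zs'; apply: nz; apply: soc => b mb.
  exact: (mm_gen (rann z) R1A).
exists a; split=> // y Nay; apply: contrapT => ny.
have [z [Zz yz]] := Zmax y ny; have [z' zs' zz'] := cover z Zz.
apply: (ha (ann z')); last by apply: zz'; apply: yz.
apply/List.in_map_iff; exists z'; split=> //.
elim: s zs' {sZ sT cover ha} => //= x s IH; rewrite inE => /orP[/eqP ->|/IH]; by [left|right].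
Qed.

End RegularForms.

(* Ext from the residue field, and regular sequences *)
#[local] Opaque mD aug.

Section Ext.
Variables (k : fieldType) (R : comAlgType k) (Rg : nat -> set R).
Hypothesis hR : standard_graded Rg.
Local Notation Rz := (zgrade Rg).
Local Notation mm := (irrelevant_ideal Rg).
Local Notation RR := (R^o : lmodType R).

Lemma mm_hsub : hsub (rVg Rg (fun _ : 'I_1 => 0)) [set x : 'rV[R]_1 | mm (x 0 0)].
Proof.
split.
  split; first by rewrite /= mxE; exact: (rsub0 (mm_sub hR)).
  by move=> a x y mx my; rewrite /= !mxE; case: (mm_sub hR) => _; exact.
move=> x j mx; rewrite /= cmp_rVg // subr0; apply/(mmP hR).
have dR := Rz_dsd hR; rewrite (cmp_homog dR _ (cmp_mem dR _ _)).
by case: eqP => // <-; exact/(mmP hR).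
Qed.

(* G is the minimal free resolution of the residue field R / mm. *)
Definition res0 : gsub Rg := GSub mm_hsub.
Local Notation G := (mF hR res0).
Local Notation dG := (mD hR res0).

(** Multiplication by a is zero on R / m, so it is null-homotopic on its resolution. This replaces
    the statement that m annihilates Ext. *)
Lemma G_null a : mm a -> exists h : forall i, {linear G i -> G i.+1},
  (forall x, a *: x = dG 0%N (h 0%N x)) /\
  forall i x, a *: x = dG i.+1 (h i.+1 x) + h i (dG i x).
Proof.
move=> ma; have [||||h [h0 hS]] := @homotopy R G G dG dG (@mD_comp _ _ _ hR res0)
    (fun i => smul (G i) a).
- by move=> i; exact: projective_rV.
- by move=> i x /mD_exact.
- move=> x; apply/(@mD_im _ _ _ hR res0 0%N) => /=.
  by rewrite mxE mulrC; exact: mmM.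
- by move=> i x; exact: (linearZ_LR (dG i) a x).
by exists h; split=> [x|i x]; [rewrite -h0|rewrite -hS].
Qed.

(** The quotient V / N is never formed: cochains take values in V and are read modulo N. In degree 0
    a coboundary is a zero cochain. *)
Definition cobound (V : lmodType R) (N : set V) (i : nat) : (G i -> V) -> Prop :=
  match i return (G i -> V) -> Prop with
  | 0 => fun u => forall x, N (u x)
  | j.+1 => fun u => exists v : {linear G j -> V}, forall x, N (u x - v (dG j x))
  end.

(* Ext^i(R / mm, V / N) = 0, computed from G. *)
Definition ext0 (V : lmodType R) (N : set V) (i : nat) : Prop :=
  forall u : {linear G i -> V}, (forall x, N (u (dG i x))) -> cobound N u.

(** This is N + a V, the kernel of the map from V to (V / N) / a (V / N). *)
Definition padj (V : lmodType R) (N : set V) (a : R) : set V :=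
  [set y | exists z, N (y - a *: z)].

Lemma padj_lift n (V : lmodType R) (N : set V) a (u : {linear 'rV[R]_n -> V}) :
  rsub N -> (forall x, padj N a (u x)) ->
  exists q : {linear 'rV[R]_n -> V}, forall x, N (u x - a *: q x).
Proof.
move=> rN hu; have [|q hq] := @rV_lift R n V V (fun _ v w => N (w - a *: v)) u.
  by move=> s; exact: hu.
exists q; exact: (@linear_rV_in _ _ _ (u \- (smul V a \o q)) N rN hq).
Qed.

(** In the long exact sequence of multiplication by a on V / N, vanishing of Ext^(i-1) of the
    cokernel makes a injective on Ext^i(R / m, V / N), where it also acts as zero. *)
Lemma ext0_up (V : lmodType R) (N : set V) a n : rsub N -> mm a ->
  (forall y, N (a *: y) -> N y) ->
  (forall i, (i < n)%N -> ext0 (padj N a) i) ->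
  forall i, (i < n.+1)%N -> ext0 N i.
Proof.
move=> rN ma reg hE [|i] iN u ud; have [h [h0 hS]] := G_null ma.
  by move=> x; apply: reg; rewrite -linearZ_LR h0.
have au x : N (a *: u x - u (h i (dG i x))).
  by rewrite -linearZ_LR hS linearD addrK.
have [q hq] : exists q : {linear G i -> V}, forall x, N (a *: u x - a *: q (dG i x)).
  have /(hE i iN) : forall x, padj N a ((u \o h i) (dG i x)).
    move=> x; exists (u x); rewrite -opprB; apply: rsubN => //; exact: au.
  case: i h {hE} iN u ud h0 hS au => [|i] h iN u ud h0 hS au /=.
    move=> hh; have [q hq] := padj_lift (u := u \o h 0%N) rN hh; exists q => x.
    rewrite -(subrKA (u (h 0%N (dG 0%N x)))); apply: rsubD => //; exact: hq.
  case=> w hw.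
  have [|q hq] := @padj_lift _ V N a (((u \o h i.+1) \- (w \o dG i)) : {linear G i.+1 -> V}) rN.
    by move=> x; exact: hw.
  exists q => x; rewrite -(subrKA (u (h i.+1 (dG i.+1 x)))); apply: rsubD => //.
  by have := hq (dG i.+1 x); rewrite /= mD_comp linear0 subr0.
by exists q => x; apply: reg; rewrite scalerBr.
Qed.

(** The other end of the same sequence: Ext^i of the cokernel sits between Ext^i and Ext^(i+1) of V
    / N, so one degree of vanishing is lost. *)
Lemma ext0_down (V : lmodType R) (N : set V) a n : rsub N ->
  (forall y, N (a *: y) -> N y) ->
  (forall i, (i < n.+1)%N -> ext0 N i) ->
  forall i, (i < n)%N -> ext0 (padj N a) i.
Proof.
move=> rN reg hE i iN u ud.
have [q hq] := padj_lift (u := u \o dG i) rN ud.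
have [w hw] : cobound N q.
  apply: hE => [|x]; first by rewrite ltnS.
  apply: reg; rewrite -[a *: _]opprK; apply: rsubN => //.
  by have := hq (dG i.+1 x); rewrite /= mD_comp linear0 sub0r.
have := hE i (ltnW iN) (u \- (smul V a \o w)).
have coc x : N ((u \- (smul V a \o w)) (dG i x)).
  rewrite /= -(subrKA (a *: q x)); apply: rsubD => //; first exact: hq.
  by rewrite -scalerBr; apply: rsubZ.
move=> /(_ coc) {hE iN ud coc}; case: i u q hq w hw => [|i] u q hq w hw /=.
  by move=> h x; exists (w x); exact: h.
case=> t ht; exists t => x; exists (w x).
by have := ht x; rewrite addrAC.
Qed.

(** An element z killed by m modulo N defines the cocycle sending 1 to z, because the image of
    [dG 0] in R is m. *)
Lemma ext0_socle (V : lmodType R) (N : set V) : rsub N -> ext0 N 0 ->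
  forall z, (forall a, mm a -> N (a *: z)) -> N z.
Proof.
move=> rN hE z hz.
have := hE (lcomb (fun _ : 'I_1 => z)); rewrite /cobound => h.
have := h _ (delta_mx 0 0); rewrite lcomb_delta; apply=> x.
have : @gK _ _ _ (mst hR res0 0) (dG 0%N x) by apply/mD_im; exists x.
move: (dG 0%N x) => y my; rewrite lcombE big_ord_recl big_ord0 addr0.
exact: hz.
Qed.

Lemma set_scale_nil (V : lmodType R) : set_scale (M := V) [set` [::]] = [set 0].
Proof.
apply/seteqP; split; last by move=> x ->; exact: (rsub0 (set_scale_sub _ _)).
by apply: set_scale_le => [|a x]; [exact: rsub_zero|rewrite /= inE].
Qed.

Lemma set_scale_rcons (V : lmodType R) (s : seq R) a :
  set_scale (M := V) [set` rcons s a] = padj (set_scale [set` s]) a.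
Proof.
have rs := @set_scale_sub _ V [set` s].
apply/seteqP; split.
  apply: set_scale_le.
    split; first by exists 0; rewrite scaler0 subr0; exact: rsub0.
    move=> b x y [z hz] [w hw]; exists (b *: z + w).
    rewrite scalerDr scalerA [a * b]mulrC -scalerA opprD addrACA -scalerBr.
    by case: rs => _; exact.
  move=> b x; rewrite /= mem_rcons inE => /orP[/eqP ->|bs].
    by exists x; rewrite subrr; exact: rsub0.
  by exists 0; rewrite scaler0 subr0; exact: set_scaleZ.
move=> y [z hz]; rewrite -(subrK (a *: z) y).
apply: rsubD; first exact: set_scale_sub.
  move: hz; apply: set_scale_le; first exact: set_scale_sub.
  by move=> b x bs; apply: set_scaleZ; rewrite /= mem_rcons inE bs orbT.
by apply: set_scaleZ; rewrite /= mem_rcons mem_head.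
Qed.

(** The sequence is peeled from its end: modulo all of it nothing is claimed, and each removed
    element gains one degree of vanishing by [ext0_up]. *)
Lemma regular_ext0 (V : lmodType R) (s : seq R) : (forall x, x \in s -> mm x) ->
  regular_sequence V s -> forall i, (i < size s)%N -> ext0 [set (0 : V)] i.
Proof.
move=> smm [reg _].
suff H j : (j <= size s)%N -> forall i, (i < j)%N ->
    ext0 (set_scale (M := V) [set` take (size s - j) s]) i.
  by have := H (size s) (leqnn _); rewrite subnn take0 set_scale_nil.
elim: j => // j IH js; set m := (size s - j.+1)%N.
have ms : (m < size s)%N by rewrite /m; lia.
apply: (@ext0_up _ _ s`_m).
- exact: set_scale_sub.
- by apply: smm; exact: mem_nth.
- exact: reg.
- move=> i ij; have := IH (ltnW js) i ij.
  have -> : (size s - j = m.+1)%N by rewrite /m; lia.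
  by rewrite (take_nth 0 ms) set_scale_rcons.
Qed.

Hypothesis k_inf : infinite_set [set: k].

(** As long as a degree of vanishing remains, [ext0_socle] and [linear_regular] produce the next
    linear form, and [ext0_down] pays for it with one degree. *)
Lemma ext0_regular n : (forall i, (i < n)%N -> ext0 [set (0 : RR)] i) ->
  exists s : seq R, [/\ size s = n, forall x, x \in s -> mm x & regular_sequence RR s].
Proof.
move=> hE; pose reg (s : seq R) := forall i, (i < size s)%N -> forall y : RR,
  set_scale [set` take i s] (s`_i *: y) -> set_scale [set` take i s] y.
suff H j : (j <= n)%N -> exists s : seq R, [/\ size s = j, forall x, x \in s -> mm x,
    reg s & forall i, (i < n - j)%N -> ext0 (set_scale (M := RR) [set` s]) i].
  have [s [ss smm rs _]] := H n (leqnn n); exists s; split=> //; split=> //.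
  apply/eqP => e; apply: (mm1 hR).
  have : set_scale (M := RR) [set` s] 1 by rewrite e.
  apply: set_scale_le; first exact: mm_sub.
  by move=> a x /smm ma; rewrite [a *: x]mulrC; exact: mmM.
elim: j => [_|j IH jn].
  by exists [::]; split=> // i; rewrite subn0 set_scale_nil; exact: hE.
have [s [ss smm rs sE]] := IH (ltnW jn).
pose N := set_scale (M := RR) [set` s]; have rN : rsub N by exact: set_scale_sub.
have [|a [a1 ra]] := linear_regular hR k_inf rN.
  have nj : (0 < n - j)%N by rewrite subn_gt0.
  exact: (@ext0_socle RR N rN (sE 0%N nj)).
exists (rcons s a); split.
- by rewrite size_rcons ss.
- by move=> x; rewrite mem_rcons inE => /orP[/eqP ->|/smm //]; exact: mm_homog a1.
- move=> i; rewrite size_rcons ltnS leq_eqVlt => /orP[/eqP ->|si] y.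
    have -> : take (size s) (rcons s a) = s by rewrite -cats1 take_size_cat.
    by rewrite nth_rcons ltnn eqxx; exact: (ra y).
  have -> : take i (rcons s a) = take i s by rewrite -cats1 takel_cat // ltnW.
  by rewrite nth_rcons si; exact: (rs i si y).
have nj : (n - j.+1).+1 = (n - j)%N by lia.
rewrite set_scale_rcons; apply: (@ext0_down RR N a (n - j.+1) rN ra) => i ij.
by apply: sE; rewrite -nj.
Qed.

Lemma ext0_free n i : ext0 [set (0 : RR)] i -> ext0 [set (0 : 'rV[R]_n)] i.
Proof.
move=> hE u ud.
have hs s : cobound [set (0 : RR)] (rcoord s \o u).
  by apply: hE => x; rewrite /= [u _]ud linear0.
case: i {hE ud} u hs => [|i] u hs.
  by move=> x; apply/rowP => s; rewrite mxE; exact: (hs s x).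
have /choice[v hv] := hs.
have lv : linear (fun x => \row_s (v s x : R)).
  by move=> a x y; apply/rowP => s; rewrite !mxE linearP.
exists (mklin lv) => x; apply/rowP => s; rewrite !mxE; exact: (hv s x).
Qed.

(** * The double complex and the Auslander-Buchsbaum inequality *)

Section Chase.
Variables (M : lmodType R) (Mg : int -> set M) (hM : graded_module Rg Mg).
Variables (n0 : nat) (deg0 : 'I_n0 -> int) (g0 : 'I_n0 -> M).
Hypothesis hg0 : hgens Mg setT deg0 g0.
Hypothesis ming0 : forall c, lcomb g0 c = 0 -> forall s, mm (c 0 s).
Local Notation F := (mF hR (syz0 hR hM hg0)).
Local Notation dF := (mD hR (syz0 hR hM hg0)).
Local Notation augF := (aug hR hM hg0).

(** The image of v one column to the left is zero in cohomology: for q > 0 it is a coboundary, and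
    for q = 0 it is only required to be a cocycle with values in M, which [hE] turns into a
    coboundary. *)
Definition bound_at (q s : nat) (v : {linear G s -> F q}) : Prop :=
  match q return {linear G s -> F q} -> Prop with
  | 0 => fun v => forall x, augF (v (dG s x)) = 0
  | q'.+1 => fun v => cobound [set 0] (dF q' \o v)
  end v.

Variable n : nat.
Hypothesis hE : forall i, (i < n)%N -> ext0 [set (0 : M)] i.

(* In the double complex Hom(G_s, F_q) the columns resolve Hom(G_s, M), and the
   rows have no cohomology in the degrees covered by the hypotheses. *)
Lemma chase q s (v : {linear G s -> F q}) : (s < n + q)%N ->
  (forall i, (i < s)%N -> ext0 [set (0 : RR)] i) -> bound_at v ->
  exists w : {linear G s -> F q.+1}, cobound [set 0] (fun x => v x - dF q (w x)).
Proof.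
elim: q s v => [|q IH] s v sn Rs bv.
  rewrite addn0 in sn.
  (* Base column: aug v is a coboundary w0 dG; lifting w0 to w1 with values in F_0, the difference v
     - w1 dG is zero in M and lifts through [dF 0]. *)
  have := hE sn (u := augF \o v) bv.
  case: s v sn Rs bv => [|s] v sn Rs bv.
    move=> a0; have [|w hw] := proj_lift (f := dF 0%N) (g := v) (@projective_rV R _).
      by move=> x; apply/aug_exact; exact: a0.
    by exists w => x /=; rewrite hw subrr.
  case=> w0 hw0.
  have [|w1 hw1] := proj_lift (f := augF) (g := w0) (@projective_rV R _).
    by move=> x; exact: aug_surj.
  have [|w hw] := proj_lift (f := dF 0%N) (g := (v \- (w1 \o dG s)))
      (@projective_rV R _).
    move=> x; apply/aug_exact; rewrite linearB /= hw1; exact: hw0.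
  exists w; exists w1 => x /=; rewrite hw /=.
  by rewrite subKr subrr.
case: s v sn Rs bv => [|s] v sn Rs bv.
  have [|w hw] := proj_lift (f := dF q.+1) (g := v) (@projective_rV R _).
    by move=> x; apply/mD_exact; exact: bv.
  by exists w => x /=; rewrite hw subrr.
case: bv => v1 hv1.
have {}hv1 x : dF q (v x) = v1 (dG s x) by apply/eqP; rewrite -subr_eq0; apply/eqP; exact: hv1.
(* [v1] satisfies the hypothesis one step down in both indices: for q = 0 by exactness at F_0,
   otherwise because [dF q] applied to v1 is a cocycle and Ext^s(R / m, R) = 0. *)
have [|||w1 hw1] := IH s v1; first by rewrite addnS ltnS in sn.
- by move=> i si; apply: Rs; exact: ltnW.
- case: q v v1 hv1 {IH sn} => [|q] v v1 hv1.
    by move=> x; rewrite -hv1; apply/aug_exact; eexists.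
  apply: ext0_free => [|x]; first by apply: Rs.
  by rewrite /= -hv1 mD_comp.
(* v1 and dF w1 differ by a coboundary, which dG kills. Hence v - w1 dG is in the kernel of dF and
   lifts to the next column. *)
have e x : v1 (dG s x) = dF q (w1 (dG s x)).
  case: s v sn Rs v1 hv1 w1 hw1 x => [|s] v sn Rs v1 hv1 w1 hw1 x.
    by apply/eqP; rewrite -subr_eq0; apply/eqP; exact: (hw1 (dG 0%N x)).
  case: hw1 => w2 /(_ (dG s.+1 x)) /=; rewrite mD_comp linear0 subr0 => /eqP.
  by rewrite subr_eq0 => /eqP.
have [|w hw] := proj_lift (f := dF q.+1) (g := (v \- (w1 \o dG s)))
    (@projective_rV R _).
  by move=> x; apply/mD_exact; rewrite linearB /= hv1 e subrr.
exists w; exists w1 => x /=; rewrite hw /=.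
by rewrite subKr subrr.
Qed.

(** For a in m with homotopy h, a u = u h dG on cocycles u, a coboundary; the general y is a sum of
    multiples by elements of m. *)
Lemma cobound_mm s (u : {linear G s -> RR}) (W : lmodType R) (y : W) :
  (forall x, u (dG s x) = 0) -> set_scale mm y ->
  cobound [set 0] (fun x => (u x : R) *: y).
Proof.
move=> ud; apply: (@set_scale_le _ _ _
  [set y : W | cobound [set 0] (fun x => (u x : R) *: y)]).
  split.
    case: s u ud => [|s] u ud; first by move=> x /=; rewrite scaler0.
    by exists \0 => x /=; rewrite scaler0 subrr.
  case: s u ud => [|s] u ud a y1 y2.
    move=> h1 h2 x; rewrite /= scalerDr scalerA mulrC -scalerA.
    by rewrite [_ *: y1]h1 [_ *: y2]h2 scaler0 addr0.
  case=> [v1 h1] [v2 h2]; exists (a \*: v1 \+ v2) => x /=.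
  rewrite scalerDr scalerA mulrC -scalerA opprD addrACA -scalerBr.
  by rewrite [_ - v1 _]h1 [_ - v2 _]h2 scaler0 addr0.
move=> a z ma /=; have [h [h0 hS]] := G_null ma.
case: s u ud => [|s] u ud.
  by move=> x /=; rewrite scalerA mulrC -[a * u x]/(a *: u x) -linearZ_LR h0 ud scale0r.
have lz : linear (fun x : G s => (u (h s x) : R) *: z).
  by move=> b x x'; rewrite !linearP scalerDl scalerA.
exists (mklin lz) => x /=; rewrite scalerA mulrC -[a * u x]/(a *: u x) -linearZ_LR hS.
by rewrite linearD ud add0r subrr.
Qed.

Lemma bound_at_scale q s (u : {linear G s -> RR}) (e : F q)
    (le : linear (fun x => (u x : R) *: e)) :
  (forall x, u (dG s x) = 0) -> bound_at (mklin le).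
Proof.
move=> ud; case: q e le => [|q] e le.
  by move=> x /=; rewrite ud scale0r linear0.
have := cobound_mm ud (@d_min _ _ _ hR _ _ hM _ _ _ hg0 ming0 _ e).
case: s u ud le => [|s] u ud le.
  by move=> h x /=; rewrite linearZ_LR; exact: h.
by case=> v hv; exists v => x /=; rewrite linearZ_LR; exact: hv.
Qed.

Variable L : nat.
Hypotheses (L_gt0 : (0 < gn (mst hR (syz0 hR hM hg0) L))%N)
  (L_last : gn (mst hR (syz0 hR hM hg0) L.+1) = 0%N).

(** For a cocycle u and a basis vector e of the last module F_L, minimality of F makes u e satisfy
    [bound_at]. As F_(L+1) = 0, the chase says that u e is a coboundary, and its coordinate along e
    exhibits u as one. Strong induction supplies the lower Ext groups needed by the chase. *)
Lemma ext0_ring : forall i, (i < n + L)%N -> ext0 [set (0 : RR)] i.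
Proof.
elim/ltn_ind => t IH tn u ud.
pose e : F L := delta_mx 0 (Ordinal L_gt0).
have lv : linear (fun x => (u x : R) *: e) by move=> a x y; rewrite linearP scalerDl scalerA.
have bv : bound_at (mklin lv) by exact: bound_at_scale.
have [|w] := chase tn _ bv.
  by move=> i it; apply: IH => //; apply: ltn_trans tn.
have w0 x : w x = 0 by apply/rowP => s; have := ltn_ord s; rewrite [X in (_ < X)%N]L_last.
have eE x : ((u x : R) *: e) 0 (Ordinal L_gt0) = u x by rewrite !mxE !eqxx mulr1.
case: t u ud lv {bv IH tn} w w0 eE => [|t] u ud lv w w0 eE.
  move=> h x; have hx : (u x : R) *: e = 0 by have := h x; rewrite /= w0 linear0 subr0.
  by rewrite /= -eE hx mxE.
case=> v hv; exists (rcoord (Ordinal L_gt0) \o v) => x /=.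
have := hv x; rewrite /= w0 linear0 subr0 => hx.
rewrite -{1}eE -[LHS]/(rcoord (Ordinal L_gt0) _ - rcoord (Ordinal L_gt0) _) -linearB.
by rewrite [_ - _]hx linear0.
Qed.

End Chase.
End Ext.

#[local] Transparent mD aug.

(** * Krull dimension and growth *)

Section Growth.
Variables (k : fieldType) (R : comAlgType k) (Rg : nat -> set R).
Hypothesis hR : standard_graded Rg.
Local Notation Rz := (zgrade Rg).
Local Notation mm := (irrelevant_ideal Rg).
Local Notation RR := (R^o : lmodType R).
Local Notation Rk n := (Rg n : set RR).

Lemma Rg_ksub n : ksub (Rk n).
Proof. exact: (gm_ksub hR (Rz_graded hR) (Posz n)). Qed.

Lemma fd_Rg n : fd (Rk n).
Proof.
have [xs [_ hxs]] := gens_exist hR.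
exact: (fd_subset (Rg_ksub n) (fd_mon_span hR xs n) (hxs n)).
Qed.

Lemma kdim_lt (V : lmodType R) (A B : set V) x :
  ksub A -> fd B -> A `<=` B -> B x -> ~ A x -> (kdim A < kdim B)%N.
Proof.
move=> kA fB AB Bx nAx; have dA := kdimP (fd_subset kA fB AB).
apply: (fdim_leq (fdimS dA nAx) (kdimP fB)).
by apply: kadj_le => //; exact: fd_ksub.
Qed.

Lemma ksubI (V : lmodType R) (A B : set V) : ksub A -> ksub B -> ksub (A `&` B).
Proof.
move=> [A0 hA] [B0 hB]; split=> // c x y [Ax Bx] [Ay By].
by split; [exact: hA|exact: hB].
Qed.

Lemma kdimI_le (V : lmodType R) (A B : set V) : ksub A -> fd B -> (kdim (A `&` B) <= kdim B)%N.
Proof.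
by move=> kA fB; apply: kdim_leq; [exact: ksubI kA (fd_ksub fB)|by []|by move=> x []].
Qed.

Lemma fdI (V : lmodType R) (A B : set V) : ksub A -> fd B -> fd (A `&` B).
Proof.
move=> kA fB; apply: (fd_subset _ fB); last by move=> x [].
by apply: ksubI => //; exact: fd_ksub.
Qed.

(** The primes in a chain need not be homogeneous, so growth is measured on the filtration by degree
    at most j rather than degree by degree. *)
Definition Rle (j : nat) : set RR := [set x | forall i : nat, (j < i)%N -> cmp Rz x i = 0].

Definition SR (j : nat) : nat := \sum_(i < j.+1) kdim (Rk i).

Lemma cmp_neg (x : R) n : cmp Rz x (Negz n) = 0.
Proof. exact: (cmp_mem (Rz_dsd hR) x (Negz n)). Qed.

Lemma Rle_ksub j : ksub (Rle j).
Proof.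
have dR := Rz_dsd hR; split=> [i _|c x y hx hy i ji]; first exact: (cmp0 dR).
rewrite (cmpD dR) hy // addr0.
have := cmpR_scale hR i x (Rg_const hR c : Rz 0 _); rewrite add0r => e.
by rewrite [LHS]e hx // mulr0.
Qed.

Lemma Rg_Rle i j : (i <= j)%N -> Rg i `<=` Rle j.
Proof.
move=> ij x Rx l jl; apply: (cmp_ne (Rz_dsd hR) (i := Posz i)) => //.
by rewrite eqz_nat gtn_eqF // (leq_ltn_trans ij).
Qed.

Lemma Rle_dim j : fdim (Rle j) (SR j).
Proof.
have dR := Rz_dsd hR; elim: j => [|j IH].
  rewrite /SR big_ord1; suff -> : Rle 0 = Rk 0 by exact: kdimP (fd_Rg 0).
  apply/seteqP; split; last exact: Rg_Rle.
  move=> x hx; have -> : x = cmp Rz x 0.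
    apply: (cmp_ext dR) => i; rewrite (cmp_homog dR _ (cmp_mem dR x 0)).
    by case: i => [[|i]|i] //=; [exact: hx|exact: cmp_neg].
  exact: (cmp_mem dR x 0).
rewrite /SR big_ord_recr /= -/(SR j).
have [r [_ d1 d2]] := fdim_sum (idfun : {linear RR -> RR}) IH (kdimP (fd_Rg j.+1)).
have E0 : Rle j `&` idfun @^-1` Rk j.+1 = [set 0].
  apply/seteqP; split=> x /=.
    case=> hx Rx; rewrite -(cmp_id dR (Rx : Rz j.+1 x)); exact: hx.
  move=> ->; split; first by move=> i _; exact: (cmp0 dR).
  exact: (dsd_add0 (Rg_dsd hR)).
have r0 : r = 0%N by rewrite -(kdim_eq d1) E0 kdim0.
move: d2; rewrite r0 subn0; suff -> : ksum idfun (Rle j) (Rk j.+1) = Rle j.+1 by [].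
apply/seteqP; split=> x.
  case=> y hy Rxy i ji; rewrite -(subrK y x) (cmpD dR) (hy i (ltnW ji)) addr0.
  by apply: (cmp_ne dR (Rxy : Rz j.+1 _)); rewrite eqz_nat gtn_eqF.
move=> hx; exists (x - cmp Rz x j.+1); last first.
  by rewrite subKr; exact: (cmp_mem dR x j.+1).
move=> i ji; rewrite (cmpB dR) (cmp_homog dR _ (cmp_mem dR x j.+1)).
case: eqP => [->|/eqP ne]; first by rewrite subrr.
rewrite subr0; apply: hx; rewrite ltn_neqAle ji andbT eq_sym.
by move: ne; rewrite eqz_nat.
Qed.

Lemma fd_Rle j : fd (Rle j). Proof. by eexists; exact: Rle_dim. Qed.

Lemma Rle_le i j : (i <= j)%N -> Rle i `<=` Rle j.
Proof. by move=> ij x hx l jl; apply: hx; exact: leq_ltn_trans jl. Qed.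

Lemma Rle_ex x : exists j, Rle j x.
Proof.
have [s [_ _ h0 _]] := cmp_dec (Rz_dsd hR) x.
exists (\sum_(z <- s) absz z)%N => i ji; apply: h0; apply: contraTN ji => si.
by rewrite -leqNgt (big_rem _ si) /= leq_addr.
Qed.

Lemma RleM i j a b : Rle i a -> Rle j b -> Rle (i + j) (a * b).
Proof.
have dR := Rz_dsd hR; move=> ha hb l ijl.
have [s [hs us h0 ->]] := cmp_dec dR a; have [t [ht ut k0 ->]] := cmp_dec dR b.
rewrite mulr_suml (cmp_sum dR) big1 // => x _.
rewrite mulr_sumr (cmp_sum dR) big1 // => y _.
case: x => x; last by rewrite cmp_neg mul0r (cmp0 dR).
case: y => y; last by rewrite cmp_neg mulr0 (cmp0 dR).
case: (ltnP i x) => ix; first by rewrite ha // mul0r (cmp0 dR).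
case: (ltnP j y) => jy; first by rewrite hb // mulr0 (cmp0 dR).
apply: (cmp_ne dR (i := Posz (x + y))); first exact: (RgM hR (hs (Posz x)) (ht (Posz y))).
by rewrite eqz_nat gtn_eqF // (leq_ltn_trans _ ijl) // leq_add.
Qed.

Definition cI (I : set RR) (j : nat) : nat := (kdim (Rle j) - kdim (I `&` Rle j))%N.

(* Multiplication by x embeds R / P into Q / P. *)
Lemma cI_step (P Q : set RR) x c j : rsub P -> rsub Q -> P `<=` Q -> Q x ->
  (forall a, P (x * a) -> P a) -> Rle c x ->
  (cI P j + cI Q (c + j) <= cI P (c + j))%N.
Proof.
move=> rP rQ PQ Qx Px cx.
have kP := rsub_ksub rP; have kQ := rsub_ksub rQ.
have := kdim_sum (smul RR x) (fd_Rle j) (fdI kP (fd_Rle (c + j))).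
have -> : Rle j `&` smul RR x @^-1` (P `&` Rle (c + j)) = P `&` Rle j.
  apply/seteqP; split=> a /=; first by case=> ja [/Px].
  by case=> Pa ja; split=> //; split; [exact: rsubZ|exact: RleM].
have : (kdim (ksum (smul RR x) (Rle j) (P `&` Rle (c + j))) <= kdim (Q `&` Rle (c + j)))%N.
  apply: kdim_leq => [||y].
  - by apply: fd_ksub; apply: fd_sum; [exact: fd_Rle|exact: fdI kP (fd_Rle _)].
  - exact: fdI kQ (fd_Rle _).
  case=> a ja [Py jy]; rewrite -(subrK (smul RR x a) y); split.
    by apply: (rsubD rQ); [exact: PQ|rewrite /= [x *: a]mulrC; exact: (rsubZ a rQ)].
  by apply: (ksubD (Rle_ksub _)) => //; exact: RleM.
have aux (a dQ pj rj pc r : nat) : (dQ <= r -> pc <= r -> pj <= rj -> a <= dQ ->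
  a + pj = rj + pc -> rj - pj + (r - dQ) <= r - pc)%N by lia.
by apply: aux; exact: kdimI_le (fd_Rle _).
Qed.

(** Choose x_i in P_(i+1) outside P_i, all of degree at most c. Then [cI_step] is Pascal's rule as
    an inequality: each step down the chain adds one to the lower index of the binomial, each shift
    by c one to the upper index. *)
Lemma chain_growth (M : lmodType R) n (P : nat -> {pred R}) : prime_chain M n P ->
  exists c, forall q, ('C(q, n) <= SR (c * q))%N.
Proof.
case=> Pp Ps; pose Q i : set RR := [set a | a \in P i].
have rQ i : (i <= n)%N -> rsub (Q i).
  move=> /Pp[[[P0 P1 PD] _] _]; split=> // a x y Px Py; exact: PD.
have Q1 i : (i <= n)%N -> ~ Q i 1.
  by move=> /Pp[[[_ P1 _] _] _]; rewrite /Q /=; exact/negP.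
have /choice[xc hxc] : forall i, exists xc : R * nat, (i < n)%N ->
    [/\ Q i.+1 xc.1, ~ Q i xc.1 & Rle xc.2 xc.1].
  move=> i; case: (ltnP i n) => [ni|]; last by exists (0, 0%N).
  have [_ nP] := Ps i ni.
  have [x [Qx nQx]] : exists x, Q i.+1 x /\ ~ Q i x.
    apply: contrapT => H; apply: nP => x xP; apply: contrapT => nx.
    by apply: H; exists x.
  by have [c hc] := Rle_ex x; exists (x, c).
pose c := (\sum_(i < n) (xc i).2)%N.
have cle i : (i < n)%N -> Rle c (xc i).1.
  move=> ni; have [_ _] := hxc i ni; apply: Rle_le.
  by rewrite /c (bigD1 (Ordinal ni)) //= leq_addr.
suff H m : (m <= n)%N -> forall q, ('C(q, m) <= cI (Q (n - m)%N) (c * q))%N.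
  exists c => q; apply: leq_trans (H n (leqnn n) q) _.
  by rewrite /cI (kdim_eq (Rle_dim _)) leq_subr.
elim: m => [_ q|m IH mn q].
  rewrite bin0 subn0 /cI subn_gt0; apply: (@kdim_lt RR _ _ 1).
  - by apply: ksubI; [exact: (rsub_ksub (rQ n (leqnn n)))|exact: Rle_ksub].
  - exact: fd_Rle.
  - by move=> x [].
  - by apply: Rg_Rle (leq0n _) _ _; have := Rg_const hR 1; rewrite scale1r.
  - by case=> /(Q1 n (leqnn n)).
have i1 : (n - m.+1 < n)%N by lia.
have i2 : ((n - m.+1).+1 = n - m)%N by lia.
have [x2 x1 _] := hxc _ i1; rewrite i2 in x2.
have stp j : (cI (Q (n - m.+1)%N) j + cI (Q (n - m)%N) (c + j) <= cI (Q (n - m.+1)%N) (c + j))%N.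
  apply: (@cI_step _ _ (xc (n - m.+1)%N).1).
  - by apply: rQ; exact: ltnW.
  - by apply: rQ; exact: leq_subr.
  - by rewrite -i2; have [h _] := Ps _ i1; move=> a /h.
  - exact: x2.
  - move=> a; have [[_ pr] _] := Pp _ (ltnW i1); rewrite /Q /= => /pr /orP[|//].
    by move/x1.
  - exact: cle.
elim: q => [|q IHq]; first by rewrite bin0n.
rewrite binS mulnS; apply: leq_trans (stp _).
by apply: leq_add => //; rewrite -mulnS; apply: leq_trans (IH (ltnW mn) _); exact: leq_bin2l.
Qed.

End Growth.

Lemma expn_monol a b s : (a <= b)%N -> (a ^ s <= b ^ s)%N.
Proof. by case: s => // s ab; rewrite leq_exp2r. Qed.

(** * Growth of quotients by homogeneous ideals *)

Section HomogeneousIdeals.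
Variables (k : fieldType) (R : comAlgType k) (Rg : nat -> set R).
Hypothesis hR : standard_graded Rg.
Local Notation Rz := (zgrade Rg).
Local Notation mm := (irrelevant_ideal Rg).
Local Notation RR := (R^o : lmodType R).
Local Notation Rk n := (Rg n : set RR).
Local Notation hideal := (hsub (Rz : int -> set RR)).

Implicit Types I J : set RR.

(* hI I n = dim_k (R / I)_n, and SI I is its partial sum. *)
Definition hI (I : set RR) (n : nat) : nat := (kdim (Rk n) - kdim (I `&` Rk n))%N.

Definition SI (I : set RR) (j : nat) : nat := \sum_(i < j.+1) hI I i.

(** The base [j.+1] is positive, so the bound makes sense at j = 0 and is monotone in s. *)
Definition bigO (f : nat -> nat) (s : nat) : Prop :=
  exists C, forall j, (f j <= C * j.+1 ^ s)%N.

Lemma padj_hideal I c a : hideal I -> Rg c a -> hideal (padj I a).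
Proof.
move=> [rI hI'] Ra; have dR := Rz_dsd hR; split.
  split; first by exists 0; rewrite scaler0 subr0; exact: (rsub0 rI).
  move=> b x y [z hz] [w hw]; exists (b *: z + w).
  rewrite scalerDr scalerA [a * b]mulrC -scalerA opprD addrACA -scalerBr.
  by case: rI => _; exact.
move=> x j [z hz]; exists (cmp Rz z (j - c%:Z)).
have := cmpR_scale hR (j - c%:Z) z (Ra : Rz c%:Z a); rewrite addrC subrK => e.
by rewrite -[_ *: _]e -(cmpB dR); exact: hI'.
Qed.

Definition colon (I : set RR) (a : R) : set RR := [set x | I (a * x)].

Lemma colon_hideal I c a : hideal I -> Rg c a -> hideal (colon I a).
Proof.
move=> [rI hI'] Ra; split.
  split; first by rewrite /colon /= mulr0; exact: (rsub0 rI).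
  move=> b x y; rewrite /colon /= => Ix Iy.
  by rewrite mulrDr [a * _]mulrCA; case: rI => _; exact.
move=> x j Ix; rewrite /colon /= -(cmpR_scale hR j x (Ra : Rz c%:Z a)).
exact: hI'.
Qed.

Lemma padj_le I a : rsub I -> I `<=` padj I a.
Proof. by move=> rI x Ix; exists 0; rewrite scaler0 subr0. Qed.

Lemma padj_mem (I : set RR) a : rsub I -> padj I a a.
Proof.
by move=> rI; exists 1; rewrite [_ *: _]mulr1 subrr; exact: (rsub0 rI).
Qed.

Lemma colon_le I a : rsub I -> I `<=` colon I a.
Proof. by move=> rI x Ix; exact: (rsubZ a rI). Qed.

Lemma hI_le I J n : rsub I -> rsub J -> I `<=` J -> (hI J n <= hI I n)%N.
Proof.
move=> rI rJ IJ; apply: leq_sub2l; apply: kdim_leq.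
- apply: ksubI; [exact: rsub_ksub|exact: Rg_ksub].
- by apply: fdI; [exact: rsub_ksub|exact: fd_Rg].
- by move=> x [/IJ].
Qed.

(** Multiplication by a embeds R / (I : a), shifted by c, into R / I with cokernel R / (I + a R). *)
Lemma hI_exact I c a n : hideal I -> Rg c a ->
  hI I (c + n) = (hI (padj I a) (c + n) + hI (colon I a) n)%N.
Proof.
move=> hId Ra; have [rI hI'] := hId; have dR := Rz_dsd hR.
have kI := rsub_ksub rI; have [rp _] := padj_hideal hId Ra.
have [rc _] := colon_hideal hId Ra.
have := kdim_sum (smul RR a) (fd_Rg hR n) (fdI kI (fd_Rg hR (c + n))).
have -> : Rk n `&` smul RR a @^-1` (I `&` Rk (c + n)) = colon I a `&` Rk n.
  apply/seteqP; split=> x /=; first by case=> Rx [].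
  by case=> Ix Rx; split=> //; split=> //; exact: (RgM hR).
have -> : ksum (smul RR a) (Rk n) (I `&` Rk (c + n)) = padj I a `&` Rk (c + n).
  apply/seteqP; split=> x.
    case=> r Rr [Ix Rx]; split; first by exists r.
    rewrite -(subrK (smul RR a r) x); apply: (dsd_addD (Rg_dsd hR)) => //.
    exact: (RgM hR).
  case=> -[r Ir] Rx; exists (cmp Rz r n%:Z); first exact: (cmp_mem dR r n%:Z).
  have e : cmp Rz (x - a *: r) (c + n)%:Z = x - a * (cmp Rz r n%:Z : R).
    rewrite (cmpB dR) (cmp_id dR (Rx : Rz (c + n)%:Z x)); congr (_ - _).
    exact: (cmpR_scale hR n%:Z r (Ra : Rz c%:Z a)).
  by rewrite /= -e; split; [exact: hI'|exact: (cmp_mem dR _ (c + n)%:Z)].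
have aux (p co r i rc' : nat) : (i <= rc' -> p <= rc' -> co <= r ->
    p + co = r + i -> rc' - i = rc' - p + (r - co))%N by lia.
apply: aux.
- exact: kdimI_le kI (fd_Rg hR _).
- exact: kdimI_le (rsub_ksub rp) (fd_Rg hR _).
- exact: kdimI_le (rsub_ksub rc) (fd_Rg hR _).
Qed.

Lemma hI_small I c a n : hideal I -> Rg c a -> (n < c)%N -> hI I n = hI (padj I a) n.
Proof.
move=> hId Ra nc; have [rI hI'] := hId; have dR := Rz_dsd hR.
congr (_ - kdim _)%N; apply/seteqP; split=> x [Ix Rx]; split=> //.
  exact: padj_le.
case: Ix => r Ir.
have e : cmp Rz (x - a *: r) n%:Z = x.
  rewrite (cmpB dR) (cmp_id dR (Rx : Rz n%:Z x)).
  have := cmpR_scale hR (n%:Z - c%:Z) r (Ra : Rz c%:Z a); rewrite addrC subrK => e.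
  have -> : cmp Rz (a *: r) n%:Z = a * cmp Rz r (n%:Z - c%:Z) := e.
  have : (n%:Z - c%:Z < 0) by rewrite subr_lt0 ltz_nat.
  by case: (n%:Z - c%:Z) => // m _; rewrite cmp_neg // mulr0 subr0.
by rewrite -e; exact: hI'.
Qed.

Lemma SI_split I c a j : hideal I -> Rg c a ->
  (SI I j <= SI (padj I a) j + SI (colon I a) j)%N.
Proof.
move=> hId Ra; rewrite /SI.
case: (leqP c j) => cj; last first.
  rewrite [X in (X <= _)%N](eq_bigr (fun i : 'I__ => hI (padj I a) i)) ?leq_addr // => i _.
  by apply: (hI_small hId Ra); apply: leq_ltn_trans cj; rewrite -ltnS.
have gs (f : nat -> nat) n m :
    (\sum_(i < n + m) f i = \sum_(i < n) f i + \sum_(i < m) f (n + i)%N)%N.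
  by rewrite big_split_ord.
have split_sum (f : nat -> nat) : (\sum_(i < j.+1) f i =
    \sum_(i < c) f i + \sum_(i < j.+1 - c) f (c + i)%N)%N.
  have cj' : (c + (j.+1 - c) = j.+1)%N by rewrite subnKC // leqW.
  by rewrite -gs cj'.
rewrite (split_sum (hI I)) (split_sum (hI (padj I a))) -addnA leq_add //.
  by apply/eq_leq/eq_bigr => i _; exact: (hI_small hId Ra (ltn_ord i)).
rewrite (eq_bigr (fun i : 'I_(j.+1 - c) => (hI (padj I a) (c + i) + hI (colon I a) i)%N)).
  rewrite big_split leq_add2l.
  have cj' : ((j.+1 - c) + c = j.+1)%N by rewrite subnK // leqW.
  by have := gs (hI (colon I a)) (j.+1 - c)%N c; rewrite cj' => ->; exact: leq_addr.
by move=> i _; exact: hI_exact.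
Qed.

(** With c = 1 and I contained in (I : a), the exact sequence bounds hI I (j + 1) by hI (I + a R) (j
    + 1) + hI I j, which telescopes. Hence a linear form lowers the exponent by at most one. *)
Lemma hI_SI_padj I a j : hideal I -> Rg 1 a -> (hI I j <= SI (padj I a) j)%N.
Proof.
move=> hId Ra; have [rI _] := hId.
elim: j => [|j IH]; first by rewrite /SI big_ord1 (hI_small hId Ra).
rewrite -add1n (hI_exact j hId Ra) add1n /SI big_ord_recr /= addnC leq_add2r.
apply: leq_trans IH; apply: hI_le => //; first exact: (colon_hideal hId Ra).1.
exact: colon_le.
Qed.

Lemma bigO_le f g s : (forall j, (f j <= g j)%N) -> bigO g s -> bigO f s.
Proof. by move=> fg [C hC]; exists C => j; exact: leq_trans (hC j). Qed.

Lemma bigOD f g s : bigO f s -> bigO g s -> bigO (fun j => f j + g j)%N s.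
Proof.
by move=> [C hC] [D hD]; exists (C + D)%N => j; rewrite mulnDl leq_add.
Qed.

Lemma bigO_sum f s : bigO f s -> bigO (fun j => \sum_(i < j.+1) f i)%N s.+1.
Proof.
move=> [C hC]; exists C => j.
apply: (@leq_trans (\sum_(i < j.+1) C * j.+1 ^ s)%N).
  by apply: leq_sum => i _; apply: leq_trans (hC i) _; rewrite leq_mul2l expn_monol ?orbT.
by rewrite sum_nat_const card_ord expnS mulnCA.
Qed.

Lemma bigO_mono f s t : (s <= t)%N -> bigO f s -> bigO f t.
Proof.
move=> st [C hC]; exists C => j; apply: leq_trans (hC j) _.
by rewrite leq_mul2l leq_pexp2l ?orbT.
Qed.

Lemma bigO_padj I a s : hideal I -> Rg 1 a ->
  bigO (SI (padj I a)) s -> bigO (SI I) s.+1.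
Proof.
by move=> hId Ra /bigO_sum; apply: bigO_le => j; apply: leq_sum => i _; exact: hI_SI_padj.
Qed.

Lemma bigO_mm I : rsub I -> mm `<=` I -> bigO (SI I) 0.
Proof.
move=> rI mI; exists (kdim (Rk 0)) => j; rewrite expn0 muln1 /SI big_ord_recl big1.
  by rewrite addn0 leq_subr.
move=> i _; apply/eqP; rewrite subn_eq0 /=.
apply: kdim_leq; first exact: Rg_ksub.
  by apply: fdI; [exact: rsub_ksub|exact: fd_Rg].
move=> x Rx; split=> //; apply: mI; exact: (mm_homog hR (n := i)).
Qed.

(** Adding the linear generators to the zero ideal one by one ends above m, where growth is bounded.
    With [chain_growth] this bounds the lengths of prime chains. *)
Lemma ring_bigO : exists s, bigO (SR Rg) s.
Proof.
have [xs [xs1 hxs]] := gens_exist hR.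
have H ys I : (forall y, y \in ys -> Rg 1 y) -> hideal I ->
    mm `<=` foldl (fun J y => padj J y) I ys -> bigO (SI I) (size ys).
  elim: ys I => [|y ys IH] I ys1 hId mI /=; first exact: bigO_mm hId.1 mI.
  have y1 : Rg 1 y by apply: ys1; exact: mem_head.
  apply: (bigO_padj hId y1); apply: IH => //; last exact: padj_hideal hId y1.
  by move=> z zs; apply: ys1; rewrite inE zs orbT.
have h0 : hideal [set 0].
  split; first exact: rsub_zero.
  by move=> x j ->; exact: (cmp0 (Rz_dsd hR)).
exists (size xs); apply: bigO_le (H xs [set 0] xs1 h0 _).
  move=> j; apply: leq_sum => i _; rewrite /hI.
  suff -> : kdim ([set 0] `&` Rk i) = 0%N by rewrite subn0.
  have -> : [set 0] `&` Rk i = [set (0 : RR)].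
    apply/seteqP; split=> x; first by case.
    by move=> ->; split=> //; exact: (ksub0 (Rg_ksub hR i)).
  exact: kdim0.
have fold_sub ys I : (forall y, y \in ys -> Rg 1 y) -> hideal I ->
    let J := foldl (fun J y => padj J y) I ys in
    [/\ rsub J, I `<=` J & forall y, y \in ys -> J y].
  elim: ys I => [|y ys IH] I ys1 hId /=; first by split=> //; exact: hId.1.
  have y1 : Rg 1 y by apply: ys1; exact: mem_head.
  have [|rJ IJ Jy] := IH (padj I y) _ (padj_hideal hId y1).
    by move=> z zs; apply: ys1; rewrite inE zs orbT.
  split=> // [|z]; first exact: subset_trans (padj_le y hId.1) IJ.
  rewrite inE => /orP[/eqP ->|/Jy //]; apply: IJ; exact: padj_mem _ hId.1.
have [rJ _ Jx] := fold_sub xs _ xs1 h0.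
move=> a [s [hs ->]]; apply: (rsub_sum_seq (V := RR)) => // b /hs[[//|i] _ Rb].
apply: (gen_span_le (xs := xs) (A := mon_span Rg xs i)) => //; exact: (hxs i.+1).
Qed.

(* Leading components: the highest components of a and b outside P multiply
   into P as soon as a * b lies in P. *)
Lemma homog_prime (P : set RR) : hideal P ->
  (forall i j a b, Rg i a -> Rg j b -> P (a * b) -> P a \/ P b) ->
  forall a b, P (a * b) -> P a \/ P b.
Proof.
move=> [rP hP] pr a b Pab; have dR := Rz_dsd hR.
have top x : ~ P x -> exists i : nat, ~ P (cmp Rz x i) /\
    forall j : nat, (i < j)%N -> P (cmp Rz x j).
  move=> nx; have [j hj] := Rle_ex hR x.
  have Pj l : (j < l)%N -> P (cmp Rz x l).
    by move=> /hj ->; exact: (rsub0 rP).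
  have [i ni] : exists i : nat, ~ P (cmp Rz x i).
    apply: contrapT => H; apply: nx; have [s [_ _ _ ->]] := cmp_dec dR x.
    apply: (rsub_sum (V := RR)) => // -[i|i] _.
      by apply: contrapT => h; apply: H; exists i.
    by rewrite cmp_neg //; exact: (rsub0 rP).
  have ex : exists i, `[< ~ P (cmp Rz x (Posz i)) >] by exists i; apply/asboolP.
  have ub l : `[< ~ P (cmp Rz x (Posz l)) >] -> (l <= j)%N.
    by move=> /asboolP h; rewrite leqNgt; apply/negP => /Pj.
  case: (ex_maxnP ex ub) => m /asboolP nm mx; exists m; split=> // l ml.
  apply: contrapT => h; have /mx : `[< ~ P (cmp Rz x (Posz l)) >] by apply/asboolP.
  by rewrite leqNgt ml.
case: (pselect (P a)) => [|nPa]; first by left.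
case: (pselect (P b)) => [|nPb]; first by right.
have [i [na ha]] := top a nPa; have [j [nb hb]] := top b nPb.
suff : P (cmp Rz a i * cmp Rz b j).
  by move=> /(pr _ _ _ _ (cmp_mem dR a i) (cmp_mem dR b j))[].
have [s [hs us s0 aE]] := cmp_dec dR a.
have e : cmp Rz (a * b) (i + j)%:Z =
    \sum_(z <- s) cmp Rz a z * cmp Rz b ((i + j)%:Z - z).
  rewrite {1}aE mulr_suml (cmp_sum dR); apply: eq_bigr => z _.
  by have := cmpR_scale hR ((i + j)%:Z - z) b (hs z); rewrite addrC subrK.
have is' : i%:Z \in s.
  by apply: contra_notT na => ns; rewrite s0 //; exact: (rsub0 rP).
have := hP _ (i + j)%:Z Pab; rewrite e (bigD1_seq i%:Z) //=.
have -> : (i + j)%:Z - i%:Z = j%:Z by rewrite PoszD addrC addKr.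
(* The remaining terms of this component lie in P: beyond i the factor from a does, and before i the
   factor from b has index above j. *)
set r := (X in _ + X) => h; rewrite -(addrK r (_ * _)); apply: (rsubB rP) => //.
apply: (rsub_sum (V := RR)) => // -[z|z] zi; last first.
  by rewrite cmp_neg // mul0r; exact: (rsub0 rP).
case: (ltngtP i z) zi => [iz _|zi _|->]; last by rewrite eqxx.
  by rewrite mulrC; apply: (rsubZ (V := RR)) => //; exact: ha.
apply: (rsubZ (V := RR)) => //.
have -> : (i + j)%:Z - z%:Z = (i + j - z)%N%:Z by rewrite subzn // (leq_trans (ltnW zi)) ?leq_addr.
by apply: hb; lia.
Qed.

(** The growth form of dim (R / I) >= s; at s = 0 there is no smaller exponent, and properness takes
    its place. *)
Definition large (I : set RR) (s : nat) : Prop :=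
  match s with 0 => ~ I 1 | s'.+1 => ~ bigO (SI I) s' end.

Lemma hideal_mm I : hideal I -> ~ I 1 -> I `<=` mm.
Proof.
move=> [rI hI'] nI a Ia; apply/(mmP hR).
have [c hc] := cmp0_const hR a; case: (eqVneq c 0) => [c0|c0].
  by rewrite hc c0 scale0r.
exfalso; apply: nI; have := hI' _ 0 Ia; rewrite hc => Ic.
have := rsubZ (c^-1%:A) rI Ic.
by rewrite [_ *: _]mulr_algl scalerA mulVf // scale1r.
Qed.

Lemma bigO_proper I s : hideal I -> ~ bigO (SI I) s -> ~ I 1.
Proof.
move=> hId nO I1; apply: nO; apply: (bigO_mono (leq0n s)).
apply: bigO_mm hId.1 _ => a _; rewrite -[a]mulr1; exact: (rsubZ a hId.1 I1).
Qed.

(** Take P maximal with this growth. If a b is in P with a and b homogeneous outside it, then P + a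
    R and (P : a), which contains b, are both strictly larger and so O(j^s); by [SI_split] so is
    P. *)
Lemma max_prime (F : set (set RR)) I s : hideal I -> ~ bigO (SI I) s ->
  exists P, [/\ hideal P, I `<=` P, ~ bigO (SI P) s &
    forall a b, P (a * b) -> P a \/ P b].
Proof.
move=> hId nO; have nR := noetherian_standard hR.
have [||P [[hP nP] IP maxP]] := @noetherian_max R RR
    [set P | hideal P /\ ~ bigO (SI P) s] I nR.
- by move=> A [[]].
- by split.
exists P; split=> //; apply: homog_prime => // i j a b Ra Rb Pab.
apply: contrapT => /not_orP[na nb]; apply: nP.
have big J x : hideal J -> P `<=` J -> J x -> ~ P x -> bigO (SI J) s.
  move=> hJ PJ Jx nx; apply: contrapT => nJ.
  by apply: nx; apply: (maxP J) Jx.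
have b1 : bigO (SI (padj P a)) s.
  apply: (big _ a) => //; first exact: padj_hideal hP Ra.
    exact: (padj_le a hP.1).
  exact: (padj_mem a hP.1).
have b2 : bigO (SI (colon P a)) s.
  apply: (big _ b) => //; first exact: colon_hideal hP Ra.
  exact: (colon_le a hP.1).
by apply: bigO_le (bigOD b1 b2) => l; exact: (SI_split l hP Ra).
Qed.

(** A prime P0 with large growth misses some linear form x, since otherwise it would contain m.
    Adding x loses at most one exponent, and the chain continues above P0 + x R; it ends at m. *)
Lemma large_chain s I : hideal I -> large I s -> exists P : nat -> set RR,
  (forall i, (i <= s)%N -> [/\ rsub (P i), ~ P i 1, I `<=` P i &
     forall a b, P i (a * b) -> P i a \/ P i b]) /\
  forall i, (i < s)%N -> P i `<=` P i.+1 /\ ~ P i.+1 `<=` P i.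
Proof.
elim: s I => [|s IH] I hId LI.
  exists (fun=> mm); split=> // i _; split.
  - exact: mm_sub.
  - exact: mm1.
  - exact: hideal_mm.
  move=> a b /(mmP hR); rewrite cmp0_mul //.
  have [c hc] := cmp0_const hR a; have [d hd] := cmp0_const hR b.
  rewrite hc hd -scalerAl mul1r scalerA => /eqP.
  rewrite scaler_eq0 oner_eq0 orbF mulf_eq0 => /orP[] /eqP e; [left|right];
    by apply/(mmP hR); rewrite ?hc ?hd e scale0r.
have [P0 [hP0 IP0 nP0 pr0]] := max_prime (fun=> True) hId LI.
have nP1 := bigO_proper hP0 nP0.
have [x [x1 nx]] : exists x, Rg 1 x /\ ~ P0 x.
  apply: contrapT => H; apply: nP0; apply: (bigO_mono (leq0n s)).
  apply: bigO_mm hP0.1 _; apply: (mm_gen hR hP0.1) => x x1.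
  by apply: contrapT => nx; apply: H; exists x.
have hpx := padj_hideal hP0 x1.
have [|P [hP sP]] := IH (padj P0 x) hpx.
  (* At s = 0 only properness is at stake: if 1 - x r were in P0, so would be its degree 0 component
     1. *)
  case: s {IH} LI nP0 => [|s] LI nP0 /=; last first.
    by move=> O; apply: nP0; exact: bigO_padj hP0 x1 O.
  case=> r hr; apply: nP1; have := hP0.2 _ 0 hr.
  have dR := Rz_dsd hR; rewrite (cmpB dR).
  have -> : cmp Rz (x *: r) 0 = 0.
    by apply/(mmP hR); rewrite [_ *: _]mulrC; apply: mmM => //; exact: mm_homog x1.
  by rewrite subr0 (cmp_id dR (i := 0)) //; have := Rg_const hR 1; rewrite scale1r.
exists (fun i => if i is i'.+1 then P i' else P0); split.
  case=> [_|i si]; first by split=> //; exact: hP0.1.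
  have [r1 n1 l1 p1] := hP i si; split=> //.
  by apply: subset_trans l1; apply: subset_trans IP0 _; exact: (padj_le x hP0.1).
case=> [_|i si]; last exact: sP.
have [_ _ l1 _] := hP 0%N (leq0n s); split.
  by apply: subset_trans l1; exact: (padj_le x hP0.1).
by move=> h; apply: nx; apply: h; apply: l1; exact: (padj_mem x hP0.1).
Qed.

Lemma large_prime_chain s I (M : lmodType R) : hideal I -> large I s ->
  annihilator M `<=` I -> exists P, prime_chain M s P.
Proof.
move=> hId LI MI; have [P [hP sP]] := large_chain hId LI.
pose Q i : {pred R} := [pred a | `[< P i a >]].
have QP i a : (a \in Q i) <-> P i a by split; [move/asboolP|move=> ?; apply/asboolP].
exists Q; split=> i si.
  have [[r0 rD] n1 l1 p1] := hP i si; split; last first.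
    by move=> a /MI /l1 Pa; apply/QP.
  split; last by move=> a b /QP/p1[] h; apply/orP; [left|right]; apply/QP.
  split; first exact/QP.
    by apply/negP => /QP.
  by move=> a x y /QP Px /QP Py; apply/QP; exact: rD.
have [PP nP] := sP i si; split; first by move=> a /QP/PP h; apply/QP.
by move=> h; apply: nP => a Pa; apply/QP; apply: h; apply/QP.
Qed.

End HomogeneousIdeals.

(** * Sequences of polynomial growth *)

Section Sequences.

Lemma ffact_lower N m : (N ^ m <= (N + m) ^_ m)%N.
Proof.
elim: m => // m IH; rewrite addnS ffactSS expnS; apply: leq_mul IH.
by rewrite leqW // leq_addr.
Qed.

Lemma binom_not_bigO (f : nat -> nat) c s :
  (forall q, ('C(q, s.+1) <= f (c * q))%N) -> ~ bigO f s.
Proof.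
move=> hf [K hK].
(* With q = N + s + 1 one has N^(s+1) <= (s+1)! C(q, s+1) <= (s+1)! K (c q + 1)^s, and c q + 1 <= (c
   (s+2) + 1) N for N > 0. Dividing by N^s leaves N <= B. *)
pose B := (s.+1`! * (K * (c * s.+2 + 1) ^ s))%N.
have hN N : (0 < N)%N -> (N <= B)%N.
  move=> N0; rewrite -(@leq_pmul2r (N ^ s)) ?expn_gt0 ?N0 // -expnS.
  apply: leq_trans (ffact_lower N s.+1) _; rewrite -bin_ffact mulnC /B -mulnA leq_mul2l.
  apply/orP; right; apply: leq_trans (hf _) _; apply: leq_trans (hK _) _.
  rewrite -mulnA leq_mul2l -expnMn expn_monol ?orbT // mulnDl mul1n.
  have : (N + s.+1 <= s.+2 * N)%N by rewrite mulSn leq_add2l leq_pmulr.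
  rewrite -mulnA; move=> /(leq_mul (leqnn c)); lia.
by have := hN B.+1 isT; rewrite ltnn.
Qed.

(** Sequences stand for power series: [conv] multiplies by a polynomial, and [cums] divides by 1 -
    X. *)
Definition conv (P : {poly int}) (f : nat -> int) (j : nat) : int :=
  \sum_(i < j.+1) P`_i * f (j - i)%N.

Definition cums (f : nat -> int) (j : nat) : int := \sum_(i < j.+1) f i.

Lemma conv_trunc P f N j : (j < N)%N -> conv P f j = (P * \poly_(i < N) f i)`_j.
Proof.
move=> jN; rewrite coefM; apply: eq_bigr => i _; rewrite coef_poly ifT //.
by apply: leq_ltn_trans jN; exact: leq_subr.
Qed.

Lemma convM P Q f j : conv (P * Q) f j = conv P (conv Q f) j.
Proof.
rewrite (conv_trunc _ _ (ltnSn j)) -mulrA coefM; apply: eq_bigr => i _.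
by rewrite -conv_trunc // ltnS leq_subr.
Qed.

Lemma eq_conv P f g : f =1 g -> conv P f =1 conv P g.
Proof. by move=> fg j; apply: eq_bigr => i _; rewrite fg. Qed.

Lemma eq_cums f g : f =1 g -> cums f =1 cums g.
Proof. by move=> fg j; apply: eq_bigr => i _; rewrite fg. Qed.

Lemma convD P Q f j : conv (P + Q) f j = conv P f j + conv Q f j.
Proof.
by rewrite /conv -big_split; apply: eq_bigr => i _; rewrite coefD mulrDl.
Qed.

Lemma convC c f j : conv c%:P f j = c * f j.
Proof.
rewrite /conv big_ord_recl coefC eqxx subn0 big1 ?addr0 // => i _.
by rewrite coefC mul0r.
Qed.

Lemma convX f j : conv 'X f j = if j is j'.+1 then f j' else 0.
Proof.
rewrite /conv; case: j => [|j]; first by rewrite big_ord1 coefX mul0r.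
rewrite big_ord_recl coefX mul0r add0r big_ord_recl coefX mul1r big1 ?addr0 //.
  by rewrite lift0 subSS subn0.
by move=> i _; rewrite coefX /= mul0r.
Qed.

Definition del : {poly int} := 1 - 'X.

Lemma conv_del f j : conv del f j = f j - (if j is j'.+1 then f j' else 0).
Proof.
rewrite /del convD (convC 1) mul1r; congr (_ + _).
rewrite -mulN1r -polyCN convM convC convX; by rewrite mulN1r.
Qed.

Lemma conv_del_cums f j : conv del (cums f) j = f j.
Proof.
rewrite conv_del; case: j => [|j]; first by rewrite subr0 /cums big_ord1.
by rewrite /cums big_ord_recr /= addrC addrK.
Qed.

Lemma cums_conv_del f j : cums (conv del f) j = f j.
Proof.
elim: j => [|j IH]; first by rewrite /cums big_ord1 conv_del subr0.
by rewrite /cums big_ord_recr /= -/(cums _ j) IH conv_del addrC subrK.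
Qed.

Lemma cums_conv P f j : cums (conv P f) j = conv P (cums f) j.
Proof.
rewrite -[RHS]cums_conv_del; apply: eq_cums => {}j.
rewrite -convM mulrC convM; apply: eq_conv => {}j.
by rewrite conv_del_cums.
Qed.

Definition zO (f : nat -> int) (s : nat) : Prop :=
  exists C : nat, forall j, `|f j| <= (C * j.+1 ^ s)%N%:Z.

Lemma zO_ext f g s : f =1 g -> zO f s -> zO g s.
Proof. by move=> fg [C hC]; exists C => j; rewrite -fg. Qed.

Lemma zO_mono f s t : (s <= t)%N -> zO f s -> zO f t.
Proof.
move=> st [C hC]; exists C => j; apply: le_trans (hC j) _.
by rewrite lez_nat leq_mul2l leq_pexp2l ?orbT.
Qed.

Lemma zOD f g s : zO f s -> zO g s -> zO (fun j => f j + g j) s.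
Proof.
move=> [C hC] [D hD]; exists (C + D)%N => j; apply: le_trans (ler_normD _ _) _.
by rewrite mulnDl PoszD lerD.
Qed.

Lemma zO_cums f s : zO f s -> zO (cums f) s.+1.
Proof.
move=> [C hC]; exists C => j; apply: le_trans (ler_norm_sum _ _ _) _.
apply: (@le_trans _ _ (\sum_(i < j.+1) (C * j.+1 ^ s)%N%:Z)).
  apply: ler_sum => i _; apply: le_trans (hC i) _.
  by rewrite lez_nat leq_mul2l expn_monol ?orbT.
by rewrite sumr_const card_ord -mulr_natr natz -PoszM lez_nat expnS mulnCA mulnC.
Qed.

Lemma zO_conv P f s : zO f s -> zO (conv P f) s.
Proof.
move=> [C hC]; exists (\sum_(i < size P) absz (P`_i)%R * C)%N => j.
apply: le_trans (ler_norm_sum _ _ _) _.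
apply: (@le_trans _ _ (\sum_(i < j.+1) `|P`_i| * (C * j.+1 ^ s)%N%:Z)).
  apply: ler_sum => i _; rewrite normrM ler_wpM2l //; apply: le_trans (hC _) _.
  by rewrite lez_nat leq_mul2l expn_monol ?orbT // ltnS leq_subr.
rewrite -mulr_suml -big_distrl /= -mulnA [X in _ <= X]PoszM ler_wpM2r //.
rewrite (big_morph Posz PoszD (erefl _)).
under [X in _ <= X]eq_bigr do rewrite abszE.
rewrite -(big_mkord xpredT (fun i => `|P`_i|)) -(big_mkord xpredT (fun i => `|P`_i|)).
case: (leqP j.+1 (size P)) => jP.
  by rewrite [X in _ <= X](big_cat_nat (n := j.+1)) //= lerDl sumr_ge0.
rewrite (big_cat_nat (n := size P)) //=; last exact: ltnW.
rewrite gerDl big_nat_cond big1 // => i /andP[/andP[Pi _] _].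
by rewrite nth_default // normr0.
Qed.

(* The operator X d/dX - d multiplies X^n by n - d and lowers the order of
   vanishing at 1 by at most one. *)
Definition euler_op (d : nat) (p : {poly int}) : {poly int} := 'X * p^`() - d%:Z *: p.

Lemma euler_op_sum n (a : 'I_n -> int) (e : 'I_n -> nat) d :
  euler_op d (\sum_i a i *: 'X^(e i)) = \sum_i (a i * ((e i)%:Z - d%:Z)) *: 'X^(e i).
Proof.
rewrite /euler_op raddf_sum mulr_sumr scaler_sumr -sumrB; apply: eq_bigr => i _ /=.
rewrite derivZ derivXn -scalerAr scalerA mulrBr scalerBl mulrC [d%:Z * _]mulrC.
congr (_ - _); case: (e i) => [|m] /=; first by rewrite mulr0n mul0r scaler0 mulr0 scale0r.
by rewrite mulrnAl -exprSr -scaler_nat natz scalerA.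
Qed.

Lemma euler_op_dvd m (q : {poly int}) d : exists q',
  euler_op d (q * ('X - 1%:P) ^+ m.+1) = q' * ('X - 1%:P) ^+ m.
Proof.
exists ('X * (q^`() * ('X - 1%:P) + q *+ m.+1) - d%:Z *: (q * ('X - 1%:P))).
rewrite /euler_op derivM deriv_exp derivXsubC mul1r /= mulrBl; congr (_ - _).
  rewrite -mulrA; congr ('X * _).
  by rewrite mulrDl -mulrA -exprS mulrnAl mulrnAr.
by rewrite -scalerAl -mulrA -exprS.
Qed.

(** Applying [euler_op] with d the exponent of the last term kills that term and costs one order of
    vanishing at 1. The other coefficients are multiplied by differences of distinct exponents,
    nonzero integers, so at the end a single monomial with nonzero coefficient would vanish at 1. *)
Lemma sparse_mult n (a : 'I_n.+1 -> int) (e : 'I_n.+1 -> nat) (q : {poly int}) m :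
  injective e -> a ord0 != 0 ->
  \sum_i a i *: 'X^(e i) = q * ('X - 1%:P) ^+ m -> (m <= n)%N.
Proof.
move=> inj a0 E; rewrite leqNgt; apply/negP => nm.
suff H j (b : 'I_n.+1 -> int) (q' : {poly int}) : (j <= n)%N ->
    (forall i : 'I_n.+1, (j < i)%N -> b i = 0) -> b ord0 != 0 ->
    \sum_i b i *: 'X^(e i) = q' * ('X - 1%:P) ^+ j.+1 -> False.
  apply: (H n a (q * ('X - 1%:P) ^+ (m - n.+1))) => //.
    by move=> i; rewrite ltnNge -ltnS ltn_ord.
  by rewrite E -mulrA -exprD subnK.
elim: j b q' => [|j IH] b q' jn hb b0 E'.
  have := congr1 (fun p => p.[1]) E'.
  rewrite expr1 hornerM hornerXsubC subrr mulr0 big_ord_recl big1 ?addr0.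
    by rewrite hornerZ hornerXn expr1n mulr1 => /eqP; rewrite (negbTE b0).
  by move=> i _; rewrite hb ?scale0r.
pose i0 : 'I_n.+1 := Ordinal (jn : (j.+1 < n.+1)%N).
have [q2 hq2] := euler_op_dvd j.+1 q' (e i0).
apply: (IH (fun i => b i * ((e i)%:Z - (e i0)%:Z)) q2 (ltnW jn)).
- move=> i; rewrite leq_eqVlt => /orP[/eqP ji|/hb ->]; last by rewrite mul0r.
  have -> : i = i0 by apply: val_inj.
  by rewrite subrr mulr0.
- rewrite mulf_neq0 // subr_eq0 eqz_nat; apply/negP => /eqP/inj/(congr1 val).
  by [].
- by rewrite -euler_op_sum E' hq2.
Qed.

Lemma iter_cums_conv_del e f j : iter e cums (conv (del ^+ e) f) j = f j.
Proof.
elim: e f j => [|e IH] f j; first by rewrite /= expr0 -polyC1 convC mul1r.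
rewrite iterSr exprS -[RHS]IH.
have : cums (conv (del * del ^+ e) f) =1 conv (del ^+ e) f.
  move=> i; rewrite -[RHS]cums_conv_del; apply: eq_cums => {}i; exact: convM.
have it g h : g =1 h -> iter e cums g =1 iter e cums h.
  by elim: (e) => // m IHm gh i /=; apply: eq_cums; exact: IHm.
by move=> /it ->.
Qed.

Lemma zO_iter_cums e f s : zO f s -> zO (iter e cums f) (s + e).
Proof.
by move=> hf; elim: e => [|e IH]; rewrite ?addn0 // addnS /=; exact: zO_cums.
Qed.

(** Write P = Q (1 - X)^m with Q(1) nonzero and m <= n. If dl + n < D, undoing (1 - X)^m by m
    summations bounds Q applied to the double sums of h by O(j^D), and Q is invertible up to a term
    in the single sums. *)
Lemma order_bound n (a : 'I_n.+1 -> int) (e : 'I_n.+1 -> nat) (h : nat -> int) D dl :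
  injective e -> a ord0 != 0 ->
  zO (cums (conv (\sum_i a i *: 'X^(e i)) h)) dl -> zO (cums h) D ->
  ~ zO (cums (cums h)) D -> (D <= dl + n)%N.
Proof.
move=> inj a0 hg hh nF; set P := \sum_i _ in hg.
have mult q m : P = q * ('X - 1%:P) ^+ m -> (m <= n)%N by exact: sparse_mult.
have P0 : P != 0.
  by apply/eqP => P0; have := mult 0 n.+1; rewrite P0 mul0r ltnn => /(_ erefl).
have [m [q q1 Pq]] := multiplicity_XsubC P 1.
rewrite P0 /= in q1; have mn := mult _ _ Pq.
rewrite leqNgt; apply/negP => Dn; apply: nF.
have Pdel : P = ((-1) ^+ m *: q) * del ^+ m.
  have e1 : 'X - 1%:P = (-1) *: del by rewrite scaleN1r /del opprB.
  by rewrite Pq e1 exprZn -scalerAr scalerAl.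
set Q := _ *: q in Pdel.
have Q1 : Q.[1] != 0.
  by rewrite hornerZ mulf_neq0 // ?expf_neq0 // -rootE.
have hQ : zO (conv Q (cums (cums h))) D.
  have : zO (cums (iter m cums (cums (conv P h)))) (dl + m).+1.
    by apply: zO_cums; exact: zO_iter_cums.
  have E : iter m cums (cums (conv P h)) =1 cums (conv Q h).
    rewrite -iterSr iterS; apply: eq_cums => i.
    have it g k : g =1 k -> iter m cums g =1 iter m cums k.
      by elim: (m) => // l IHl gk x /=; apply: eq_cums; exact: IHl.
    rewrite (it _ (conv (del ^+ m) (conv Q h))) ?iter_cums_conv_del // => x.
    by rewrite -convM mulrC -Pdel.
  move=> hz; apply: (zO_mono (s := (dl + m).+1)).
    by apply: leq_trans Dn; rewrite ltnS leq_add2l.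
  apply: zO_ext hz => j; rewrite -!cums_conv.
  apply: eq_cums => i; rewrite E; exact: cums_conv.
(* Since 1 - X turns double sums into single sums, which are O(j^D), only the multiplication by Q(1)
   remains; a nonzero integer does not decrease absolute values. *)
have [Q2 hQ2] : exists Q2, Q = (Q.[1])%:P + Q2 * del.
  have /factor_theorem[Q3 hQ3] : root (Q - (Q.[1])%:P) 1.
    by rewrite rootE hornerD hornerN hornerC subrr.
  exists (- Q3); rewrite -[LHS](subrK (Q.[1])%:P) addrC hQ3; congr (_ + _).
  by rewrite mulNr -mulrN opprB.
have : zO (fun j => conv Q (cums (cums h)) j + conv (- Q2) (cums h) j) D.
  by apply: zOD => //; exact: zO_conv.
have E j : conv Q (cums (cums h)) j + conv (- Q2) (cums h) j = Q.[1] * cums (cums h) j.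
  rewrite {1}hQ2 convD convC -addrA [X in _ + X](_ : _ = 0) ?addr0 //.
  rewrite convM (eq_conv Q2 (conv_del_cums (cums h))) -convD subrr.
  by rewrite -polyC0 convC mul0r.
move=> [C hC]; exists C => j; apply: le_trans (hC j); rewrite E normrM.
rewrite ler_peMl // -gtz0_ge1 normr_gt0 //.
Qed.

End Sequences.

(** * Hilbert functions *)

Section HilbertFunctions.
Variables (k : fieldType) (R : comAlgType k) (Rg : nat -> set R).
Hypothesis hR : standard_graded Rg.
Local Notation Rz := (zgrade Rg).
Local Notation mm := (irrelevant_ideal Rg).
Local Notation RR := (R^o : lmodType R).
Local Notation Rk n := (Rg n : set RR).

Lemma fd_Rz z : fd (Rz z : set RR).
Proof. by case: z => n; [exact: fd_Rg|exact: fd0]. Qed.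

Lemma fdim_rVg n (deg : 'I_n -> int) z :
  fdim (rVg Rg deg z) (\sum_s kdim (Rz (z - deg s) : set RR)).
Proof. by apply: (@fdim_rV k R n (fun s => Rz (z - deg s))) => s; exact: fd_Rz. Qed.

Section GradedSurjection.
Variables (M : lmodType R) (Mg : int -> set M) (hM : graded_module Rg Mg).

Lemma cmp_scale_homog a i j (x : M) : Mg i x -> cmp Mg (a *: x) (j + i) = cmp Rz a j *: x.
Proof.
move=> Mx; have dR := Rz_dsd hR; have dM := gm_dsd hM.
have [s [hs us s0 aE]] := cmp_dec dR a.
rewrite {1}aE scaler_suml (cmp_sum dM).
rewrite (eq_bigr (fun z => if z == j then cmp Rz a z *: x else 0)); last first.
  move=> z _; rewrite (cmp_homog dM _ (gm_scale hM (hs z) Mx)).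
  by rewrite (inj_eq (addIr i)) eq_sym.
case: (boolP (j \in s)) => js.
  by rewrite (bigD1_seq j) //= eqxx big1 ?addr0 // => z /negbTE ->.
rewrite s0 // scale0r big1_seq // => z /andP[_ zs].
by case: eqP => // e; rewrite -e zs in js.
Qed.

Lemma annihilator_hideal : hsub (Rz : int -> set RR) (annihilator M).
Proof.
have dM := gm_dsd hM; split.
  split; first by move=> x; rewrite scale0r.
  move=> a x y hx hy z; rewrite scalerDl [y *: z]hy addr0.
  by rewrite [_ *: x]/(a * x) -scalerA hx scaler0.
move=> a j ha x; have [s [hs us s0 ->]] := cmp_dec dM x.
rewrite scaler_sumr big1 // => i _.
by rewrite -(cmp_scale_homog a j (hs i)) ha (cmp0 dM).
Qed.

Variables (n0 : nat) (deg0 : 'I_n0 -> int) (g0 : 'I_n0 -> M).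
Hypothesis hg0 : hgens Mg setT deg0 g0.

Lemma graded_surj z : lcomb g0 @` rVg Rg deg0 z = Mg z.
Proof.
have [hg _ gen] := hg0; have hF := rVg_graded hR deg0.
have hh j x : rVg Rg deg0 j x -> Mg j (lcomb g0 x) by exact: lcomb_homog.
apply/seteqP; split=> [_ [x Fx <-]|x Mx]; first exact: hh.
have [c xc] := gen x I; exists (cmp (rVg Rg deg0) c z).
  exact: (cmp_mem (gm_dsd hF)).
by rewrite -(cmp_homog_map hM hF hh) -xc (cmp_id (gm_dsd hM)).
Qed.

(** M in degree d0 + j is a quotient of n0 copies of R / Ann M in degree j. The common degree of the
    generators makes one value of j suffice. *)
Lemma hilbert_bound d0 j : (forall s, deg0 s = d0) ->
  (kdim (Mg (d0 + j%:Z)) <= n0 * hI Rg (annihilator M) j)%N.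
Proof.
move=> hd; have kA := rsub_ksub annihilator_hideal.1.
have dimF : fdim (rVg Rg deg0 (d0 + j%:Z)) (n0 * kdim (Rk j))%N.
  have := fdim_rVg deg0 (d0 + j%:Z); rewrite (eq_bigr (fun=> kdim (Rk j))); last first.
    by move=> s _; rewrite hd addrAC subrr add0r.
  by rewrite sum_nat_const card_ord.
have fF : fd (rVg Rg deg0 (d0 + j%:Z)) by eexists; exact: dimF.
have := kdim_image (lcomb g0) fF; rewrite graded_surj (kdim_eq dimF).
have fAj : fd ((annihilator M : set RR) `&` Rk j) by apply: fdI => //; exact: fd_Rg.
have := fdim_rV (A := fun _ : 'I_n0 => (annihilator M : set RR) `&` Rk j) (fun=> fAj).
rewrite sum_nat_const card_ord => dB.
have : (n0 * kdim ((annihilator M : set RR) `&` Rk j) <=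
    kdim (rVg Rg deg0 (d0 + j%:Z) `&` lcomb g0 @^-1` [set 0%R]))%N.
  rewrite -(kdim_eq dB); apply: kdim_leq; first exact: (fdim_ksub dB).
    apply: (fd_subset _ fF) => [|x []//]; apply: ksubI; first exact: fd_ksub.
    by apply: rsub_ksub; apply: rsub_preim; exact: rsub_zero.
  move=> x hx; split.
    by move=> s; rewrite hd addrAC subrr add0r; have [] := hx s.
  by rewrite /= big1 // => s _; have [ha _] := hx s; exact: ha.
rewrite /hI mulnBr.
move: (kdim _) (n0 * _)%N (kdim _) (n0 * _)%N => a b c d; lia.
Qed.

End GradedSurjection.

(** * The Hilbert function of a pure module *)

Section Resolution.
Variables (M : lmodType R) (Mg : int -> set M) (hM : graded_module Rg Mg).
Variables (n0 : nat) (deg0 : 'I_n0 -> int) (g0 : 'I_n0 -> M).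
Hypothesis hg0 : hgens Mg setT deg0 g0.
Hypothesis ming0 : forall c, lcomb g0 c = 0 -> forall s, mm (c 0 s).
Local Notation syz := (syz0 hR hM hg0).
Local Notation F := (mF hR syz).
Local Notation d := (mD hR syz).
Local Notation fdeg i := (@mdeg _ _ _ hR syz i).
Local Notation Fg i := (@mFg _ _ _ hR syz i).
Local Notation b i := (gn (mst hR syz i)).

Lemma fd_Fg i z : fd (Fg i z).
Proof. by eexists; exact: fdim_rVg. Qed.

Lemma graded_exact i z : Fg i.+1 z `&` d i @^-1` [set 0] = d i.+1 @` Fg i.+2 z.
Proof.
have hd j x : Fg i.+2 j x -> Fg i.+1 j (d i.+1 x) by exact: mD_homog.
apply/seteqP; split=> [x [Fx x0]|_ [y Fy <-]]; last first.
  by split; [exact: hd|exact: mD_comp].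
have [y hy] := (mD_exact x).1 x0; exists (cmp (Fg i.+2) y z).
  exact: (cmp_mem (gm_dsd (mFg_graded hR syz i.+2))).
rewrite -(cmp_homog_map (mFg_graded hR syz i.+1) (mFg_graded hR syz i.+2) hd) hy.
exact: (cmp_id (gm_dsd (mFg_graded hR syz i.+1))).
Qed.

Lemma graded_exact0 z : Fg 0 z `&` lcomb g0 @^-1` [set 0] = d 0 @` Fg 1 z.
Proof.
have hd j x : Fg 1 j x -> Fg 0 j (d 0 x) by exact: mD_homog.
apply/seteqP; split=> [x [Fx x0]|_ [y Fy <-]]; last first.
  by split; [exact: hd|apply: (@aug_exact _ _ _ hR _ _ hM _ _ _ hg0 _).2; exists y].
have [y hy] := (@aug_exact _ _ _ hR _ _ hM _ _ _ hg0 x).1 x0; exists (cmp (Fg 1) y z).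
  exact: (cmp_mem (gm_dsd (mFg_graded hR syz 1))).
rewrite -(cmp_homog_map (mFg_graded hR syz 0) (mFg_graded hR syz 1) hd) hy.
exact: (cmp_id (gm_dsd (mFg_graded hR syz 0))).
Qed.

Lemma hilbert_alternating L z : b L.+1 = 0%N ->
  (kdim (Mg z))%:Z = \sum_(i < L.+1) (-1) ^+ i * (kdim (Fg i z))%:Z.
Proof.
move=> bL.
(* Generalized to a truncation of F, whose only defect is the image of the next differential; it
   vanishes when F stops. *)
suff -> : \sum_(i < L.+1) (-1) ^+ i * (kdim (Fg i z))%:Z =
    (kdim (Mg z))%:Z + (-1) ^+ L * (kdim (d L @` Fg L.+1 z))%:Z.
  have -> : d L @` Fg L.+1 z = [set 0].
    apply/seteqP; split=> [_ [y _ <-]|x ->].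
      have -> : y = 0 by apply/rowP => s; have := ltn_ord s; rewrite [X in (_ < X)%N]bL.
      by rewrite linear0.
    exists 0; last by rewrite linear0.
    exact: (dsd_add0 (gm_dsd (mFg_graded hR syz L.+1))).
  by rewrite kdim0 mulr0 addr0.
elim: L {bL} => [|L IH].
  rewrite big_ord1 expr0 !mul1r -graded_exact0 -PoszD -(graded_surj hM hg0 z).
  by rewrite (kdim_image (lcomb g0) (fd_Fg 0 z)).
rewrite big_ord_recr /= IH -graded_exact.
have e := kdim_image (d L) (fd_Fg L.+1 z).
by rewrite -e PoszD exprS; ring.
Qed.

Lemma d_basis_neq0 i s : d i (delta_mx 0 s) != 0.
Proof.
apply/eqP => /mD_exact[y hy]; apply: (basis_not_mm hR (s := s)).
by rewrite -hy; exact: (mD_min (i := i)).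
Qed.

(** The image of a generator is nonzero with all coefficients in m and homogeneous of degree D' - D;
    in degree 0 or below such coefficients vanish. *)
Lemma degree_lt i D D' s : (forall t, fdeg i t = D) -> fdeg i.+1 s = D' -> D < D'.
Proof.
move=> hD hD'; have := d_basis_neq0 s.
have : Fg i D' (d i (delta_mx 0 s)).
  by apply: mD_homog; rewrite -hD'; exact: delta_homog.
have := @d_min _ _ _ hR _ _ hM _ _ _ hg0 ming0 i (delta_mx 0 s).
move: (d i _) => x /(mm_set_scale_rV hR) xm Fx x0.
rewrite ltNge; apply: contra x0 => DD'; apply/eqP/rowP => t; rewrite mxE.
have := Fx t; rewrite hD; have : D' - D <= 0 by rewrite subr_le0.
have /(mmP hR) := xm t.
case: (D' - D) => [[|n]|n] //= x0 _ hx.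
by rewrite -x0 (cmp_id (Rz_dsd hR) (i := 0)).
Qed.

Lemma conv_sparse n (a : 'I_n -> int) (e : 'I_n -> nat) (h : nat -> int) j :
  conv (\sum_i a i *: 'X^(e i)) h j =
  \sum_i a i * (if (e i <= j)%N then h (j - e i)%N else 0).
Proof.
rewrite /conv.
under eq_bigr do rewrite coef_sum mulr_suml.
rewrite exchange_big; apply: eq_bigr => i _ /=.
under eq_bigr do rewrite coefZ coefXn.
case: ifP => ej.
  have ej' : (e i < j.+1)%N by [].
  rewrite (bigD1 (Ordinal ej')) //= eqxx mulr1 big1 ?addr0 // => l /negbTE.
  by rewrite -val_eqE /= => ->; rewrite mulr0 mul0r.
rewrite mulr0 big1 // => l _; case: eqP => [le|_]; last by rewrite mulr0 mul0r.
by have := ltn_ord l; rewrite le ltnS ej.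
Qed.

Hypothesis pureF : forall i s t, fdeg i s = fdeg i t.

(** Shifting by the degree d0 of the generators makes the exponents D_i - D_0 natural numbers, and
    strict growth of the D_i makes them distinct. *)
Lemma pure_hilbert L : (forall i, (i <= L)%N -> (0 < b i)%N) -> b L.+1 = 0%N ->
  exists (d0 : int) (e : 'I_L.+1 -> nat), [/\ injective e, forall s, deg0 s = d0 &
    forall j, (kdim (Mg (d0 + j%:Z)))%:Z =
      conv (\sum_(i < L.+1) ((-1) ^+ i * (b i)%:Z) *: 'X^(e i))
           (fun n => (kdim (Rk n))%:Z) j].
Proof.
move=> bpos bL.
have /choice[D hD] : forall i, exists D, (i <= L)%N -> forall s, fdeg i s = D.
  move=> i; case: (leqP i L) => iL; last by exists 0.
  by exists (fdeg i (Ordinal (bpos i iL))) => _ s; exact: pureF.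
have Dlt i : (i < L)%N -> D i < D i.+1.
  move=> iL; apply: (@degree_lt i _ _ (Ordinal (bpos i.+1 iL))).
    by apply: hD; exact: ltnW.
  exact: hD.
have Dmono i j : (i < j)%N -> (j <= L)%N -> D i < D j.
  move=> ij jL; elim: j ij jL => // j IH; rewrite ltnS leq_eqVlt => /orP[/eqP ->|ij] jL.
    exact: Dlt.
  by apply: lt_trans (Dlt _ jL); apply: IH => //; exact: ltnW.
have De i : (i <= L)%N -> D i = D 0%N + (absz (D i - D 0%N)%R)%:Z.
  move=> iL; have D0 : 0 <= D i - D 0%N.
    by rewrite subr_ge0; case: i iL => // i iL; apply: ltW; apply: Dmono.
  by rewrite gez0_abs // addrC subrK.
exists (D 0%N), (fun i : 'I_L.+1 => absz (D i - D 0%N)%R); split.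
- move=> i j eij; have ij : D i = D j.
    by rewrite De -1?ltnS // [RHS]De -1?ltnS // eij.
  apply: val_inj; case: (ltngtP i j) => // h.
    by have := Dmono _ _ h (ltn_ord j); rewrite ij ltxx.
  by have := Dmono _ _ h (ltn_ord i); rewrite ij ltxx.
- by move=> s; exact: (hD 0%N (leq0n L) s).
move=> j; rewrite conv_sparse (hilbert_alternating _ bL); apply: eq_bigr => i _.
rewrite -mulrA; congr (_ * _).
have iL : (i <= L)%N by rewrite -ltnS.
rewrite (kdim_eq (fdim_rVg (fdeg i) (D 0%N + j))).
rewrite (eq_bigr (fun=> kdim (Rz (j%:Z - (absz (D i - D 0%N)%R)%:Z) : set RR))); last first.
  by move=> s _; rewrite hD // {1}(De i iL) opprD addrACA subrr add0r.
rewrite sum_nat_const card_ord PoszM; congr (_ * _).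
set e := absz _; case: (leqP e j) => ej; first by rewrite subzn.
have : j%:Z - e%:Z < 0 by rewrite subr_lt0 ltz_nat.
by case: (j%:Z - e%:Z) => // m _ /=; rewrite kdim0.
Qed.

End Resolution.
End HilbertFunctions.

(** * The inequalities *)

Section SupInf.

Lemma supremum_eq (x0 x : \bar int) (A : set (\bar int)) :
  A !=set0 -> (forall y, A y -> (y <= x)%E) ->
  (forall z, (forall y, A y -> (y <= z)%E) -> (x <= z)%E) -> supremum x0 A = x.
Proof.
move=> /set0P/negbTE A0 ub lub; rewrite /supremum A0; apply: xget_unique.
  by split=> [y /ub //|z hz]; apply: lub => y; exact: hz.
move=> y [uy ly]; apply/le_anti/andP; split; first by apply: ly => z; exact: ub.
by apply: lub => z; exact: uy.
Qed.

Lemma esup_max (A : set nat) n : A n -> (forall m, A m -> (m <= n)%N) ->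
  esup A = n%:Z%:E.
Proof.
move=> An mx; apply: supremum_eq.
- by exists n%:Z%:E; exists n.
- by move=> _ [m /mx mn <-]; rewrite lee_fin lez_nat.
- by move=> z; apply; exists n.
Qed.

Lemma esup_unbounded (A : set nat) : (forall n, exists2 m, A m & (n <= m)%N) ->
  esup A = +oo%E.
Proof.
move=> ub; apply: supremum_eq.
- by have [m Am _] := ub 0%N; exists m%:Z%:E; exists m.
- by move=> y _; rewrite leey.
case=> [z| |] hz //.
- have [m Am zm] := ub (absz z).+1.
  have := hz m%:Z%:E (ex_intro2 _ _ m Am erefl); rewrite lee_fin => mz.
  have zm' : ((absz z).+1)%:Z <= m%:Z by rewrite lez_nat.
  by exfalso; have := le_trans zm' mz; lia.
- have [m Am _] := ub 0%N.
  by have := hz m%:Z%:E (ex_intro2 _ _ m Am erefl).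
Qed.

Lemma nat_max (A : set nat) : (exists n, A n) -> (exists b, forall n, A n -> (n <= b)%N) ->
  exists n, A n /\ forall m, A m -> (m <= n)%N.
Proof.
move=> [n0 An0] [b hb].
have ex : exists n, `[< A n >] by exists n0; apply/asboolP.
have ub n : `[< A n >] -> (n <= b)%N by move=> /asboolP; exact: hb.
case: (ex_maxnP ex ub) => n /asboolP An mx; exists n; split=> // m Am.
by apply: mx; apply/asboolP.
Qed.

Lemma einf_set0 : einf set0 = +oo%E.
Proof. by rewrite /einf image_set0 /infimum eqxx. Qed.

Lemma einf_min (A : set nat) : (exists n, A n) ->
  exists n, A n /\ einf A = n%:Z%:E.
Proof.
move=> [n0 An0]; have ex : exists n, `[< A n >] by exists n0; apply/asboolP.
case: (ex_minnP ex) => n /asboolP An mn; exists n; split=> //.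
have mn' m : A m -> (n <= m)%N by move=> Am; apply: mn; apply/asboolP.
rewrite /einf /infimum ifF; last by apply/negbTE/set0P; exists n%:Z%:E; exists n.
apply: xget_unique.
  by split=> [_ [m /mn' nm <-]|z]; [rewrite lee_fin lez_nat|apply; exists n].
move=> y [ly uy]; apply/le_anti/andP; split; first by apply: ly; exists n.
by apply: uy => _ [m /mn' nm <-]; rewrite lee_fin lez_nat.
Qed.

End SupInf.

Section Main.
Variables (k : fieldType) (R : comAlgType k) (Rg : nat -> set R).
Hypothesis hR : standard_graded Rg.
Local Notation mm := (irrelevant_ideal Rg).
Local Notation RR := (R^o : lmodType R).

(** Chain lengths are bounded by [ring_bigO] and [chain_growth], so a longest chain exists. Growth
    of R / Ann M beyond exponent D would produce a chain of length D + 1. *)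
Lemma chain_dim (M : lmodType R) I :
  hsub (zgrade Rg : int -> set RR) I -> annihilator M `<=` I -> ~ I 1 ->
  exists D, [/\ krull_dim M = D%:Z%:E, exists P, prime_chain M D P &
    (I = annihilator M -> bigO (SI Rg I) D)].
Proof.
move=> hI MI I1.
have [||D [DA Dmax]] := @nat_max [set n | exists P, prime_chain M n P].
- by exists 0%N; exact: (large_prime_chain hR (s := 0) hI I1 MI).
- have [s hs] := ring_bigO hR; exists s => n [P hP]; rewrite leqNgt; apply/negP => sn.
  case: n sn P hP => // n sn P hP; have [c hc] := chain_growth hR hP.
  by apply: (binom_not_bigO hc); apply: bigO_mono hs.
exists D; split=> //; first exact: esup_max.
move=> eI; apply: contrapT => nO.
have [P hP] := large_prime_chain hR (s := D.+1) hI nO MI.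
by have := Dmax D.+1 (ex_intro _ P hP); rewrite ltnn.
Qed.


Lemma zO_nat (f : nat -> nat) s : bigO f s -> zO (fun j => (f j)%:Z) s.
Proof. by move=> [C hC]; exists C => j; rewrite ger0_norm // lez_nat; exact: hC. Qed.

Lemma cums_nat (f : nat -> nat) j :
  cums (fun i => (f i)%:Z) j = (\sum_(i < j.+1) f i)%N%:Z.
Proof. by rewrite (big_morph Posz PoszD (erefl _)). Qed.

(** The lower bound C(q, D) on SR is compatible with O(j^D); one further summation, by Pascal's
    rule, raises it to C(q, D + 1). *)
Lemma cums_SR_large c D : (forall q, ('C(q, D) <= SR Rg (c * q))%N) ->
  ~ zO (cums (cums (fun n => (kdim (Rg n : set RR))%:Z))) D.
Proof.
move=> hc [K hK]; pose FR j := (\sum_(i < j.+1) SR Rg i)%N.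
have FRS j : FR j.+1 = (FR j + SR Rg j.+1)%N by rewrite /FR big_ord_recr.
have FR_le i j : (i <= j)%N -> (FR i <= FR j)%N.
  move=> ij; rewrite -(subnK ij); elim: (j - i)%N => // l IH.
  by rewrite addSn FRS; apply: leq_trans IH _; exact: leq_addr.
have SR_le i j : (i <= j)%N -> (SR Rg i <= SR Rg j)%N.
  move=> ij; rewrite -(subnK ij); elim: (j - i)%N => // l IH.
  by rewrite addSn [SR Rg _.+1]big_ord_recr; apply: leq_trans IH _; exact: leq_addr.
have E j : cums (cums (fun n => (kdim (Rg n : set RR))%:Z)) j = (FR j)%:Z.
  by rewrite -cums_nat; apply: eq_cums => i; exact: cums_nat.
(* The slope [c.+1] leaves room in each step for a new summand of FR, whose index is at least c (q +
   1). *)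
apply: (@binom_not_bigO FR c.+1 D); last first.
  by exists K => j; have := hK j; rewrite E.
elim=> [|q IH]; first by rewrite bin0n.
rewrite binS mulnS addSn FRS.
apply: leq_add; first by apply: leq_trans IH _; apply: FR_le; exact: leq_addl.
apply: leq_trans (leq_bin2l _ (leqnSn q)) _; apply: leq_trans (hc q.+1) _.
by apply: SR_le; rewrite mulSn mulnS; lia.
Qed.

Section PureModule.
Variables (M : lmodType R) (Mg : int -> set M) (hM : graded_module Rg Mg).
Hypothesis M_nonzero : exists x : M, x <> 0.
Hypothesis M_pure : pure_module Rg Mg.
Variables (n0 : nat) (deg0 : 'I_n0 -> int) (g0 : 'I_n0 -> M).
Hypothesis hg0 : hgens Mg setT deg0 g0.
Hypothesis ming0 : forall c, lcomb g0 c = 0 -> forall s, mm (c 0 s).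
Local Notation b i := (gn (mst hR (syz0 hR hM hg0) i)).

(** L is the index before the first zero module of F: index 0 is excluded as M is nonzero, and
    comparison with P bounds L by p. *)
Lemma last_index p (P : projective_resolution M) :
  (forall i, (p < i)%N -> forall x : P i, x = 0) ->
  exists L, [/\ (L <= p)%N, forall i, (i <= L)%N -> (0 < b i)%N & b L.+1 = 0%N].
Proof.
move=> hP; have bp := min_res_length hR hM hg0 ming0 hP.
have b0 : (0 < b 0)%N.
  rewrite lt0n; apply/eqP => e; have [x x0] := M_nonzero; apply: x0.
  have [_ _ /(_ x I)[c ->]] := hg0.
  by rewrite lcombE big1 // => s _; have := ltn_ord s; rewrite [X in (_ < X)%N]e.
have ex : exists i, b i == 0%N by exists p.+1; rewrite bp.
case: (ex_minnP ex) => -[/eqP e|L /eqP bL minL]; first by rewrite e in b0.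
exists L; split=> //; first by rewrite -ltnS; apply: minL; rewrite bp.
by move=> i iL; rewrite lt0n; apply/negP => /minL; rewrite ltnNge iL.
Qed.

Lemma codim_le_length L D dl : (forall i, (i <= L)%N -> (0 < b i)%N) -> b L.+1 = 0%N ->
  (exists P, prime_chain RR D P) -> bigO (SR Rg) D ->
  bigO (SI Rg (annihilator M)) dl -> (D <= dl + L)%N.
Proof.
move=> bpos bL [P hP] hSR [C hC].
have pF := @pure_deg _ _ _ hR _ _ hM _ _ _ hg0 ming0 M_pure.
have [d0 [e [inj hd0 hE]]] := pure_hilbert ming0 pF bpos bL.
apply: (order_bound (a := fun i : 'I_L.+1 => (-1) ^+ i * (b i)%:Z)
  (h := fun n => (kdim (Rg n : set RR))%:Z) inj _ _).
- by rewrite mulf_neq0 ?signr_eq0 // eqz_nat -lt0n; exact: bpos.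
- apply: (zO_ext (f := cums (fun j => (kdim (Mg (d0 + j%:Z)))%:Z))).
    by apply: eq_cums => j; exact: hE.
  exists (n0 * C)%N => j; rewrite cums_nat lez_nat -mulnA.
  apply: leq_trans (_ : n0 * SI Rg (annihilator M) j <= _)%N; last by rewrite leq_mul2l hC orbT.
  rewrite /SI big_distrr; apply: leq_sum => i _; exact: (hilbert_bound hR hM hg0).
- apply: zO_ext (zO_nat hSR) => j; by rewrite cums_nat.
have [c hc] := chain_growth hR hP; exact: cums_SR_large hc.
Qed.

Hypothesis k_inf : infinite_set [set: k].

Lemma regular_length L n : (forall i, (i <= L)%N -> (0 < b i)%N) -> b L.+1 = 0%N ->
  (exists s : seq R, [/\ size s = n, forall x, x \in s -> mm x & regular_sequence M s]) ->
  exists s : seq R, [/\ size s = (n + L)%N, forall x, x \in s -> mm x & regular_sequence RR s].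
Proof.
move=> bpos bL [s [ss smm rs]]; apply: (@ext0_regular _ _ _ hR k_inf (n + L)).
apply: (ext0_ring (hR := hR) ming0 _ (bpos L (leqnn L)) bL).
by rewrite -ss; exact: (regular_ext0 smm rs).
Qed.

End PureModule.
End Main.

Theorem proposition2p7 (k : fieldType) (R : comAlgType k) (Rg : nat -> set R)
    (M : lmodType R) (Mg : int -> set M)
    (k_infinite : infinite_set [set: k])
    (R_standard : standard_graded Rg)
    (M_graded : graded_module Rg Mg)
    (M_fg : finitely_generated M)
    (M_nonzero : exists x : M, x <> 0)
    (M_pure : pure_module Rg Mg) :
  (codim M <= pdim M)%E /\
  ((pdim M < +oo)%E -> (cmd Rg (R^o : lmodType R) <= cmd Rg M)%E).
Proof.
have dM := gm_dsd M_graded.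
have setT_hsub : hsub Mg [set: M] by split.
have M_gen : exists s : seq M, (forall x, x \in s -> [set: M] x) /\
    [set: M] `<=` lspan s.
  have [s hs] := M_fg; exists s; split=> // x _; have [c ->] := hs x.
  apply: rsub_sum => [|i _]; first exact: lspan_sub.
  by apply: rsubZ; [exact: lspan_sub|apply: lspan_mem; rewrite mem_nth].
have [n0 [deg0 [g0 [hg0 ming0]]]] := min_hgens R_standard M_graded setT_hsub M_gen.
have hann := annihilator_hideal R_standard M_graded.
have [|dl [dimM _ bM]] := @chain_dim k R Rg R_standard M _ hann (@subset_refl _ _).
  by move=> h; have [x x0] := M_nonzero; apply: x0; rewrite -[x]scale1r; exact: h.
have h0 : hsub (zgrade Rg : int -> set (R^o : lmodType R)) (annihilator (R^o : lmodType R)).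
  exact: (annihilator_hideal R_standard (Rz_graded R_standard)).
have [|D [dimR chR bR]] := @chain_dim k R Rg R_standard (R^o : lmodType R) _ h0 (@subset_refl _ _).
  by move=> h; have := h (1 : R); rewrite scale1r => /eqP; rewrite oner_eq0.
(* The annihilator of R is zero, so SI of it is SR. *)
have SR_O : bigO (SR Rg) D.
  apply: bigO_le (bR erefl) => j; apply: leq_sum => i _; rewrite /hI.
  suff -> : annihilator (R^o : lmodType R) `&` (Rg i : set (R^o : lmodType R)) = [set 0].
    by rewrite kdim0 subn0.
  apply/seteqP; split=> [x [hx _]|x ->].
    by have := hx (1 : R); rewrite [_ *: _]mulr1.
  by split; [move=> y; rewrite scale0r|exact: (ksub0 (Rg_ksub R_standard i))].
pose len := [set n | exists F : projective_resolution M,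
  forall i, (n < i)%N -> forall x : F i, x = 0].
(* Both inequalities use the same L, the length of F, which is at most the length of any projective
   resolution. *)
have key p : len p -> exists L, [/\ (L <= p)%N, (D <= dl + L)%N &
    forall n, (exists s : seq R, [/\ size s = n,
        forall x, x \in s -> irrelevant_ideal Rg x & regular_sequence M s]) ->
      exists s : seq R, [/\ size s = (n + L)%N,
        forall x, x \in s -> irrelevant_ideal Rg x & regular_sequence (R^o : lmodType R) s]].
  case=> P hP.
  have [L [Lp bpos bL]] := last_index R_standard M_graded M_nonzero hg0 ming0 hP.
  exists L; split=> //; last by move=> n; exact: (regular_length ming0 k_infinite bpos bL).
  exact: (codim_le_length M_pure ming0 bpos bL chR SR_O (bM erefl)).
have cod : codim M = (D%:Z - dl%:Z)%:E by rewrite /codim dimR dimM.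
split.
  case: (pselect (exists p, len p)) => [/einf_min[p [lp ep]]|nl]; last first.
    rewrite /pdim -/len (_ : len = set0) ?einf_set0 ?leey //.
    by apply/seteqP; split=> // p lp; apply: nl; exists p.
  have [L [Lp DL _]] := key p lp.
  by rewrite /pdim -/len ep cod lee_fin; lia.
move=> pfin; have [p lp] : exists p, len p.
  apply: contrapT => nl; move: pfin; rewrite /pdim -/len (_ : len = set0) ?einf_set0 ?ltxx //.
  by apply/seteqP; split=> // p lp; apply: nl; exists p.
have [L [_ DL hreg]] := key p lp.
pose A (V : lmodType R) := [set n | exists s : seq R, [/\ size s = n,
    forall x, x \in s -> irrelevant_ideal Rg x & regular_sequence V s]].
have AM0 : exists n, A M n.
  exists 0%N, [::]; split=> //; split=> //; apply/eqP => e.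
  have [x x0] := M_nonzero; apply: x0.
  have : set_scale (M := M) [set` [::]] x by rewrite e.
  by rewrite set_scale_nil.
rewrite /cmd dimR dimM /depth -!/(A _).
(* If the lengths of R-regular sequences are unbounded, cmd R is -oo and the inequality is
   immediate. *)
case: (pselect (exists c, forall n, A (R^o : lmodType R) n -> (n <= c)%N)) => [bdd|nb]; last first.
  rewrite (_ : esup (A (R^o : lmodType R)) = +oo%E) ?leNye //.
  apply: esup_unbounded => n; apply: contrapT => H; apply: nb; exists n => m Am.
  by rewrite leqNgt; apply/negP => nm; apply: H; exists m => //; exact: ltnW.
have [n1 An1] := AM0.
have [||a [Aa amax]] := @nat_max (A (R^o : lmodType R)).
- by exists (n1 + L)%N; exact: hreg.
- exact: bdd.
(* Boundedness over M follows from that over R through [hreg], so both depths are attained; then n +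
   L <= a and D <= dl + L give D - a <= dl - n. *)
have [|n [An nmax]] := @nat_max (A M) AM0.
  by exists a => n An; apply: leq_trans (amax _ (hreg n An)); exact: leq_addr.
rewrite (esup_max Aa amax) (esup_max An nmax) lee_fin.
by have := amax _ (hreg n An); lia.
Qed.
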